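(* Suppose $1<\alpha<2$ and $1\leq\beta\leq2$. For $z\in\mathbb{C}$ with $\operatorname{Re}(z)>0$ define $$\omega_{\alpha,\beta}(z)=\frac{z^{\frac{1-\beta}{\alpha}}}{\alpha}\left[\exp\left(a_\alpha(z)+\frac{1-\beta}{\alpha}\pi i\right)+\exp\left(b_\alpha(z)-\frac{1-\beta}{\alpha}\pi i\right)\right],$$ $$l_{\alpha,\beta}(z)=\int_0^\infty\mathcal{H}_{\alpha,\beta}(s)\,e^{-z^{1/\alpha}s^{1/\alpha}}\,z^{\frac{1}{\alpha}(1-\beta)}\,ds,$$ where $$\mathcal{H}_{\alpha,\beta}(s)=\frac{1}{\alpha\pi}\,\frac{s\sin(\beta\pi)-\sin[(\alpha-\beta)\pi]}{s^2+2s\cos(\alpha\pi)+1}\,s^{\frac{1-\beta}{\alpha}},\qquad a_\alpha(z)=z^{\frac1\alpha}e^{\frac{\pi i}{\alpha}},\qquad b_\alpha(z)=z^{\frac1\alpha}e^{-\frac{\pi i}{\alpha}}.$$ Then $$E_{\alpha,\beta}(-z)=\omega_{\alpha,\beta}(z)+l_{\alpha,\beta}(z).$$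
   Context: $E_{\alpha,\beta}(z)=\sum_{k=0}^\infty\frac{z^k}{\Gamma(\alpha k+\beta)}$ is the two-parametric Mittag-Leffler function. Complex powers are taken with the principal branch. *)

(* Defs.v *)
From Stdlib Require Export Reals.
From Coquelicot Require Export Coquelicot.

Open Scope R_scope.

Definition Cexp (z : C) : C :=
  (exp (Re z) * cos (Im z), exp (Re z) * sin (Im z)).

(** Principal argument, with values in (-PI, PI]; [Carg 0 = 0]. *)
Definition Carg (z : C) : R :=
  let x := Re z in
  let y := Im z in
  if Rlt_dec 0 x then atan (y / x)
  else if Rlt_dec x 0 then
    if Rle_dec 0 y then atan (y / x) + PI else atan (y / x) - PI
  else
    if Rlt_dec 0 y then PI / 2 else if Rlt_dec y 0 then - (PI / 2) else 0.

(** Principal branch; only meaningful for nonzero arguments. *)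
Definition Clog (z : C) : C := (ln (Cmod z), Carg z).

Definition Cpower (z w : C) : C := Cexp (w * Clog z)%C.

(** Euler's integral, as a doubly improper Riemann integral.  It converges for
    [0 < x], which covers every argument [alpha * k + beta] with [0 <= alpha]
    and [0 < beta]. *)
Definition Gamma (x : R) : R :=
  RInt_gen (fun t : R => Rpower t (x - 1) * exp (- t))
    (at_right 0) (Rbar_locally p_infty).

(** Sum of a convergent complex series, the analogue of [Series] over [C]. *)
Definition CSeries (u : nat -> C) : C :=
  iota (T := C_R_CompleteNormedModule)
    (is_series (V := C_R_NormedModule) u).

Definition mittag_leffler (alpha beta : R) (z : C) : C :=
  CSeries (fun k : nat => (z ^ k / RtoC (Gamma (alpha * INR k + beta)))%C).

Definition a_fun (alpha : R) (z : C) : C :=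
  (Cpower z (RtoC (1 / alpha)) * Cexp (RtoC PI * Ci / RtoC alpha))%C.

Definition b_fun (alpha : R) (z : C) : C :=
  (Cpower z (RtoC (1 / alpha)) * Cexp (- (RtoC PI * Ci / RtoC alpha)))%C.

Definition omega_fun (alpha beta : R) (z : C) : C :=
  (Cpower z (RtoC ((1 - beta) / alpha)) / RtoC alpha *
   (Cexp (a_fun alpha z + RtoC ((1 - beta) / alpha) * RtoC PI * Ci) +
    Cexp (b_fun alpha z - RtoC ((1 - beta) / alpha) * RtoC PI * Ci)))%C.

(** Used for [0 < s] only, where [Rpower] is the real power. *)
Definition H_fun (alpha beta s : R) : R :=
  1 / (alpha * PI) *
  ((s * sin (beta * PI) - sin ((alpha - beta) * PI)) /
   (s ^ 2 + 2 * s * cos (alpha * PI) + 1)) *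
  Rpower s ((1 - beta) / alpha).

(** The integral is improper at both ends: for [1 < beta] the integrand is
    unbounded near [0]. *)
Definition l_fun (alpha beta : R) (z : C) : C :=
  RInt_gen (V := C_R_CompleteNormedModule)
    (fun s : R =>
       (RtoC (H_fun alpha beta s) *
        Cexp (- (Cpower z (RtoC (1 / alpha)) * RtoC (Rpower s (1 / alpha)))) *
        Cpower z (RtoC (1 / alpha * (1 - beta))))%C)
    (at_right 0) (Rbar_locally p_infty).

(* Main.v *)
Require Import Defs.
From Stdlib Require Import Lra Lia Psatz.

(** Put [s = exp u], so that the plane cut along the negative axis becomes the
    strip [|Im u| <= PI], and write [lam = Clog z / alpha].  The function
    [ml_fun alpha (1 - beta) lam] is the integrand of the inverse Laplace
    transform of [s^(alpha-beta) / (s^alpha + 1)] in this variable; its only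
    singularities in the strip are the simple poles [+- i PI / alpha].  Let
    [J X] be its integral over the vertical segment of the strip with abscissa
    [X].  The theorem compares two evaluations of [lim J B] for [B -> +oo].

    To the right of the poles, expand [1 / (1 + exp (- alpha u))] as a finite
    geometric sum plus a remainder.  The [k]-th term is a Hankel integral, with
    limit [2 PI i exp ((x - 1) lam) / Gamma x] for [x = alpha k + beta]
    ([Hankel_formula]), and the remainder is [O (exp (- n))] uniformly in [B]
    ([vert_int_remainder_bound]).  Hence the limit exists and equals
    [2 PI i exp ((beta - 1) lam)] times the Mittag-Leffler series, whose
    convergence comes out of the same estimate ([Mittag_Leffler_limit]).

    On the other hand, Cauchy's theorem on the rectangle with abscissas
    [A < 0 < B] writes [J B] as [2 PI i] times the two residues, plus [J A],
    plus the integral along [Im u = PI] minus the one along [Im u = - PI]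
    ([contour_identity]).  When
    [A -> -oo], [J A] vanishes; the residues give [omega_fun], and the
    difference of the two edges is the integrand of [l_fun] after
    [s = exp (alpha v)] ([l_integrand]).  In particular the improper integral
    converges because [J] has a limit.

    Hankel's formula is reduced to Euler's reflection formula by collapsing the
    contour on the cut when [0 < x < 1], and is propagated to all [x > 0] by
    integration by parts.  For the reflection formula, squeezing between finite
    double integrals shows that [Gamma x * Gamma (1 - x)] is the integral of
    [exp (x v) / (1 + exp v)] over the real line, and the residue at [i PI] in
    the strip [0 <= Im u <= 2 PI] evaluates that integral.  All of this rests on one residue theorem for
    rectangles ([residue_rectangle]), which follows from differentiation under
    the integral sign. *)

(** * Green's formula on a rectangle *)

(** Both sides are the integral of [D] over the rectangle.  The hypotheses hold
    on a larger open rectangle because differentiation under the integral sign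
    needs a neighbourhood of each parameter, edges included. *)
Lemma Green_rectangle (P Q D : R -> R -> R) (A B y1 y2 d : R) :
  A <= B -> y1 <= y2 -> 0 < d ->
  (forall x y, A - d < x < B + d -> y1 - d < y < y2 + d ->
     is_derive (fun t => P x t) y (D x y) /\
     is_derive (fun t => Q t y) x (D x y) /\
     continuous (fun t => P t y) x /\
     continuous (fun t => Q x t) y /\
     continuity_2d_pt D x y) ->
  RInt (fun x => P x y2) A B - RInt (fun x => P x y1) A B =
  RInt (fun y => Q B y) y1 y2 - RInt (fun y => Q A y) y1 y2.
Proof.
intros hAB hy hd H.
assert (HF : forall y, y1 - d < y < y2 + d ->
  is_derive (fun y => RInt (fun x => P x y) A B) y (Q B y - Q A y)).
{ intros y hyy.
  assert (Hloc : locally y (fun y' => y1 - d < y' < y2 + d)).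
  { apply (locally_interval _ y (y1 - d) (y2 + d)); simpl; try lra.
    intros; lra. }
  assert (HR : RInt (fun x => Derive (fun t => P x t) y) A B = Q B y - Q A y).
  { apply is_RInt_unique.
    apply (is_RInt_ext (fun x => D x y)).
    - intros x hx. rewrite Rmin_left, Rmax_right in hx by lra.
      symmetry. apply is_derive_unique. apply H; lra.
    - apply (is_RInt_derive (fun x => Q x y) (fun x => D x y)).
      + intros x hx. rewrite Rmin_left, Rmax_right in hx by lra. apply H; lra.
      + intros x hx. rewrite Rmin_left, Rmax_right in hx by lra.
        destruct (H x y) as (_ & _ & _ & _ & HD); try lra.
        apply continuity_2d_pt_filterlim in HD.
        unfold continuous.
        apply (filterlim_comp _ _ _ (fun t => (t, y)) (fun z => D (fst z) (snd z)) _ (locally (x, y))).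
        2: exact HD.
        intros S [e He]. exists e. intros t Ht. apply He. split; simpl; auto.
        apply ball_center. }
  rewrite <- HR.
  apply (is_derive_RInt_param (fun y x => P x y) A B y).
  - revert Hloc; apply filter_imp; intros y' h t ht.
    rewrite Rmin_left, Rmax_right in ht by lra.
    exists (D t y'). apply H; lra.
  - intros t ht. rewrite Rmin_left, Rmax_right in ht by lra.
    destruct (H t y) as (_ & _ & _ & _ & HD); try lra.
    apply (continuity_2d_pt_ext_loc (fun u v => D v u)).
    + assert (hm : exists m : posreal, forall u v, Rabs (u - y) < m -> Rabs (v - t) < m ->
        y1 - d < u < y2 + d /\ A - d < v < B + d).
      { assert (h0 : 0 < Rmin (Rmin (y - (y1 - d)) (y2 + d - y)) (Rmin (t - (A - d)) (B + d - t))).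
        { repeat apply Rmin_glb_lt; lra. }
        exists (mkposreal _ h0); simpl.
        intros u v hu hv. 
        apply Rabs_def2 in hu. apply Rabs_def2 in hv.
        pose proof (Rmin_l (Rmin (y - (y1 - d)) (y2 + d - y)) (Rmin (t - (A - d)) (B + d - t))).
        pose proof (Rmin_r (Rmin (y - (y1 - d)) (y2 + d - y)) (Rmin (t - (A - d)) (B + d - t))).
        pose proof (Rmin_l (y - (y1 - d)) (y2 + d - y)).
        pose proof (Rmin_r (y - (y1 - d)) (y2 + d - y)).
        pose proof (Rmin_l (t - (A - d)) (B + d - t)).
        pose proof (Rmin_r (t - (A - d)) (B + d - t)). lra. }
      destruct hm as [m hm]. exists m. intros u v hu hv.
      destruct (hm u v hu hv). symmetry. apply is_derive_unique. apply H; lra.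
    + intros eps. destruct (HD eps) as [m hm]. exists m. intros u v hu hv. apply hm; auto.
  - revert Hloc; apply filter_imp; intros y' h.
    apply (ex_RInt_continuous (V := R_CompleteNormedModule)).
    intros t ht. rewrite Rmin_left, Rmax_right in ht by lra. apply H; lra. }
assert (HQ : forall x, A <= x <= B -> ex_RInt (fun y => Q x y) y1 y2).
{ intros x hx. apply (ex_RInt_continuous (V := R_CompleteNormedModule)).
  intros t ht. rewrite Rmin_left, Rmax_right in ht by lra. apply H; lra. }
assert (HI := is_RInt_derive (V := R_CompleteNormedModule)
   (fun y => RInt (fun x => P x y) A B) (fun y => Q B y - Q A y) y1 y2).
rewrite Rmin_left, Rmax_right in HI by lra.
lapply HI. 2: intros; apply HF; lra.
clear HI; intro HI. lapply HI; clear HI.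
- intro HI. apply is_RInt_unique in HI.
  change (RInt (fun x => P x y2) A B - RInt (fun x => P x y1) A B) with
   (minus (RInt (fun x => P x y2) A B) (RInt (fun x => P x y1) A B)).
  rewrite <- HI.
  change (RInt (fun y => minus (Q B y) (Q A y)) y1 y2 = minus (RInt (fun y => Q B y) y1 y2) (RInt (fun y => Q A y) y1 y2)).
  apply (RInt_minus (V := R_CompleteNormedModule)); apply HQ; lra.
- intros y hyy. apply (continuous_minus (V := R_NormedModule)); apply H; lra.
Qed.

(** * Complex exponential and complex derivatives *)

Lemma Cexp_plus (a b : C) : Cexp (a + b) = (Cexp a * Cexp b)%C.
Proof.
destruct a as [a1 a2], b as [b1 b2]; unfold Cexp, Cmult; simpl.
rewrite exp_plus, cos_plus, sin_plus. f_equal; ring.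
Qed.

Lemma Cexp_0 : Cexp 0 = 1.
Proof. unfold Cexp; simpl. rewrite exp_0, cos_0, sin_0. unfold RtoC. f_equal; ring. Qed.

Lemma Cmod_Cexp (a : C) : Cmod (Cexp a) = exp (Re a).
Proof.
destruct a as [x y]; unfold Cmod, Cexp; simpl.
replace (_ + _) with ((exp x) ^ 2 * ((sin y)² + (cos y)²)) by (unfold Rsqr; ring).
rewrite sin2_cos2, Rmult_1_r. apply sqrt_pow2. left; apply exp_pos.
Qed.

Lemma Cexp_nz (a : C) : Cexp a <> 0.
Proof. apply Cmod_gt_0. rewrite Cmod_Cexp. apply exp_pos. Qed.

Lemma Cexp_opp (a : C) : Cexp (- a) = (/ Cexp a)%C.
Proof.
assert (h : (Cexp a * Cexp (- a) = 1)%C).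
{ rewrite <- Cexp_plus. replace (a + - a)%C with (RtoC 0) by ring. apply Cexp_0. }
rewrite <- (Cmult_1_l (/ Cexp a)), <- h. field. apply Cexp_nz.
Qed.

Lemma Cexp_RtoC (x : R) : Cexp (RtoC x) = RtoC (exp x).
Proof. unfold Cexp; simpl. rewrite cos_0, sin_0. unfold RtoC. f_equal; ring. Qed.

Lemma Cexp_mult_INR (n : nat) (a : C) : Cexp (RtoC (INR n) * a) = (Cexp a ^ n)%C.
Proof.
induction n as [|n IH].
- replace (RtoC (INR 0) * a)%C with (RtoC 0) by (simpl; ring). apply Cexp_0.
- rewrite S_INR, RtoC_plus. replace ((INR n + 1) * a)%C with (a + INR n * a)%C by ring.
  rewrite Cexp_plus, IH. reflexivity.
Qed.

Lemma Cmod_pair_le (x y : R) : Cmod (x, y) <= Rabs x + Rabs y.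
Proof.
replace (x, y) with (RtoC x + RtoC y * Ci)%C.
2: { unfold RtoC, Ci, Cplus, Cmult; simpl; f_equal; ring. }
eapply Rle_trans. apply Cmod_triangle.
rewrite Cmod_mult, Cmod_Ci, !Cmod_R. lra.
Qed.

Lemma Rabs_Re_le_Cmod (z : C) : Rabs (Re z) <= Cmod z.
Proof. eapply Rle_trans. 2: apply Rmax_Cmod. apply Rmax_l. Qed.

Lemma Rabs_Im_le_Cmod (z : C) : Rabs (Im z) <= Cmod z.
Proof. eapply Rle_trans. 2: apply Rmax_Cmod. apply Rmax_r. Qed.

Lemma Cplus_minus_cancel (z y : C) : (z + (y - z))%C = y.
Proof. ring. Qed.

Lemma is_Cderive_eps (f : C -> C) (z l : C) :
  is_derive (K := C_AbsRing) (V := AbsRing_NormedModule C_AbsRing) f z l <->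
  forall eps : posreal, exists del : posreal, forall h : C, Cmod h < del ->
    Cmod (f (z + h)%C - f z - h * l)%C <= eps * Cmod h.
Proof.
split.
- intros [_ H] eps.
  specialize (H z (fun P h => h) eps).
  destruct H as [del Hd]. exists del. intros h hh.
  specialize (Hd (z + h)%C).
  replace h with ((z + h) - z)%C at 2 3 by ring.
  apply Hd. change (Cmod ((z + h) - z)%C < del).
  replace ((z + h) - z)%C with h by ring. exact hh.
- intros H. split. apply is_linear_scal_l.
  intros x Hx eps.
  assert (hx : z = x) by exact (is_filter_lim_locally_unique (K := C_AbsRing) (V := AbsRing_NormedModule C_AbsRing) _ _ Hx).
  subst x.
  destruct (H eps) as [del Hd]. exists del. intros y hy.
  change (Cmod (y - z)%C < del) in hy.
  specialize (Hd (y - z)%C hy).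
  rewrite (Cplus_minus_cancel z y) in Hd. exact Hd.
Qed.

Lemma is_derive_R_eps (f : R -> R) (x l : R) :
  is_derive f x l -> forall eps : posreal, exists del : posreal,
  forall h, Rabs h < del -> Rabs (f (x + h) - f x - l * h) <= eps * Rabs h.
Proof.
intros H eps. apply is_derive_Reals in H.
destruct (H eps (cond_pos eps)) as [del Hd]. exists del. intros h hh.
destruct (Req_dec h 0) as [->|h0].
- rewrite Rplus_0_r. rewrite Rabs_R0. replace (_ - _ - _) with 0 by ring. rewrite Rabs_R0; lra.
- specialize (Hd h h0 hh).
  replace (f (x + h) - f x - l * h) with (((f (x + h) - f x) / h - l) * h) by (field; auto).
  rewrite Rabs_mult. apply Rmult_le_compat_r. apply Rabs_pos. lra.
Qed.

(** Splitting off the modulus, [exp (x + i y) - 1 - (x + i y)] is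
    [(exp x - 1 - x) e^(iy) + x (e^(iy) - 1) + (e^(iy) - 1 - i y)], and each
    summand is controlled by a one-variable derivative. *)
Lemma Cexp_first_order (eps : posreal) : exists del : posreal, forall h : C,
  Cmod h < del -> Cmod (Cexp h - 1 - h)%C <= eps * Cmod h.
Proof.
set (e := Rmin 1 (eps / 6)).
assert (he : 0 < e) by (apply Rmin_glb_lt; [lra| destruct eps; simpl; lra]).
assert (he1 : e <= 1) by apply Rmin_l.
assert (he2 : 6 * e <= eps) by (pose proof (Rmin_r 1 (eps / 6)) as h; fold e in h; lra).
clearbody e.
assert (D1 : is_derive exp 0 1) by (pose proof (is_derive_exp 0) as h; rewrite exp_0 in h; exact h).
assert (D2 : is_derive sin 0 1) by (pose proof (is_derive_sin 0) as h; rewrite cos_0 in h; exact h).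
assert (D3 : is_derive cos 0 0).
{ pose proof (is_derive_cos 0) as h. rewrite sin_0, Ropp_0 in h. exact h. }
destruct (is_derive_R_eps exp 0 1 D1 (mkposreal e he)) as [d1 H1].
destruct (is_derive_R_eps sin 0 1 D2 (mkposreal e he)) as [d2 H2].
destruct (is_derive_R_eps cos 0 0 D3 (mkposreal e he)) as [d3 H3].
assert (hd : 0 < Rmin (Rmin d1 e) (Rmin d2 d3)).
{ repeat apply Rmin_glb_lt; try apply cond_pos; auto. }
exists (mkposreal _ hd); simpl. intros [x y] hh.
assert (hx := Rabs_Re_le_Cmod (x, y)); assert (hy := Rabs_Im_le_Cmod (x, y)); simpl in hx, hy.
pose proof (Rmin_l (Rmin d1 e) (Rmin d2 d3)). pose proof (Rmin_r (Rmin d1 e) (Rmin d2 d3)).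
pose proof (Rmin_l d1 e). pose proof (Rmin_r d1 e). pose proof (Rmin_l d2 d3). pose proof (Rmin_r d2 d3).
specialize (H1 x ltac:(lra)). specialize (H2 y ltac:(lra)). specialize (H3 y ltac:(lra)).
simpl in H1, H2, H3. rewrite Rplus_0_l in H1, H2, H3. rewrite exp_0 in H1. rewrite sin_0 in H2. rewrite cos_0 in H3.
rewrite Rminus_0_r in H2. rewrite Rmult_0_l, Rminus_0_r in H3. rewrite Rmult_1_l in H1, H2.
set (m := Cmod (x, y)) in *.
assert (hm : 0 <= m) by apply Cmod_ge_0.
replace (Cexp (x, y) - 1 - (x, y))%C with
  (RtoC (exp x - 1 - x) * Cexp (0, y) + RtoC x * (Cexp (0, y) - 1) + (Cexp (0, y) - 1 - (0, y)))%C.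
2: { apply injective_projections; simpl; rewrite ?exp_0; ring. }
assert (hc1 : Cmod (Cexp (0, y)) = 1) by (rewrite Cmod_Cexp; simpl; apply exp_0).
assert (hc3 : Cmod (Cexp (0, y) - 1 - (0, y))%C <= 2 * e * m).
{ replace (Cexp (0, y) - 1 - (0, y))%C with (cos y - 1, sin y - y).
  2: { apply injective_projections; simpl; rewrite ?exp_0; ring. }
  eapply Rle_trans. apply Cmod_pair_le. nra. }
assert (hc2 : Cmod (Cexp (0, y) - 1)%C <= 3 * m).
{ replace (Cexp (0, y) - 1)%C with ((Cexp (0, y) - 1 - (0, y)) + RtoC y * Ci)%C.
  2: { apply injective_projections; simpl; ring. }
  eapply Rle_trans. apply Cmod_triangle. rewrite Cmod_mult, Cmod_Ci, Cmod_R. nra. }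
eapply Rle_trans. apply Cmod_triangle.
eapply Rle_trans. apply Rplus_le_compat_r. apply Cmod_triangle.
rewrite !Cmod_mult, hc1, !Cmod_R.
assert (Rabs x * Cmod (Cexp (0, y) - 1)%C <= m * (3 * e)).
{ apply Rmult_le_compat; try apply Rabs_pos; try apply Cmod_ge_0; try lra. }
assert (e * Rabs x <= e * m) by (apply Rmult_le_compat_l; lra).
assert (6 * e * m <= eps * m) by (apply Rmult_le_compat_r; lra).
lra.
Qed.

(** The codomain carries the uniform structure of the absolute ring [C], which
    is the one for which the product and composition rules are stated; the
    product structure of [C_NormedModule] is only equivalent to it. *)
Notation is_Cderive := (is_derive (K := C_AbsRing) (V := AbsRing_NormedModule C_AbsRing)).

Lemma is_Cderive_Cexp (z : C) : is_Cderive Cexp z (Cexp z).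
Proof.
apply is_Cderive_eps. intros eps.
assert (hp : 0 < eps / exp (Re z)).
{ apply Rdiv_lt_0_compat. apply cond_pos. apply exp_pos. }
destruct (Cexp_first_order (mkposreal _ hp)) as [del H]. exists del. intros h hh.
specialize (H h hh). simpl in H.
replace (Cexp (z + h) - Cexp z - h * Cexp z)%C with (Cexp z * (Cexp h - 1 - h))%C.
2: rewrite Cexp_plus; ring.
rewrite Cmod_mult, Cmod_Cexp.
replace (eps * Cmod h) with (exp (Re z) * (eps / exp (Re z) * Cmod h)).
2: field; apply Rgt_not_eq, exp_pos.
apply Rmult_le_compat_l. left; apply exp_pos. exact H.
Qed.

Lemma is_Cderive_Cinv (z : C) : z <> 0 -> is_Cderive Cinv z (- / (z * z))%C.
Proof.
intros hz. apply is_Cderive_eps. intros eps.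
assert (hm : 0 < Cmod z) by (apply Cmod_gt_0; auto).
set (m := Cmod z) in *.
assert (hp : 0 < Rmin (m / 2) (eps * m * m * m / 2)).
{ apply Rmin_glb_lt. lra. pose proof (cond_pos eps). 
  apply Rdiv_lt_0_compat; [|lra]. repeat apply Rmult_lt_0_compat; auto. }
exists (mkposreal _ hp); simpl. intros h hh.
pose proof (Rmin_l (m / 2) (eps * m * m * m / 2)).
pose proof (Rmin_r (m / 2) (eps * m * m * m / 2)).
assert (hzh : m / 2 <= Cmod (z + h)%C).
{ assert (m <= Cmod (z + h)%C + Cmod h).
  { unfold m. replace z with ((z + h) + (- h))%C at 1 by ring.
    eapply Rle_trans. apply Cmod_triangle. rewrite Cmod_opp. lra. } lra. }
assert (hnz : (z + h)%C <> 0) by (apply Cmod_gt_0; lra).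
replace (/ (z + h) - / z - h * - / (z * z))%C with (h * h / ((z + h) * (z * z)))%C.
2: field; auto.
rewrite Cmod_div, !Cmod_mult. 2: repeat apply Cmult_neq_0; auto.
fold m. set (k := Cmod h) in *. assert (0 <= k) by apply Cmod_ge_0.
apply Rle_div_l. apply Rmult_lt_0_compat. lra. nra.
assert (k * k <= k * (eps * m * m * m / 2)) by (apply Rmult_le_compat_l; lra).
assert (eps * k * (m / 2 * (m * m)) <= eps * k * (Cmod (z + h) * (m * m))).
{ apply Rmult_le_compat_l. pose proof (cond_pos eps); nra. apply Rmult_le_compat_r; nra. }
nra.
Qed.

Lemma is_Cderive_ext_val (f : C -> C) (z l l' : C) : is_Cderive f z l -> l = l' -> is_Cderive f z l'.
Proof. intros h <-; exact h. Qed.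

Lemma is_Cderive_mult (f g : C -> C) z df dg : is_Cderive f z df -> is_Cderive g z dg ->
  is_Cderive (fun u => f u * g u)%C z (df * g z + f z * dg)%C.
Proof.
intros hf hg. exact (is_derive_mult (K := C_AbsRing) f g z df dg hf hg Cmult_comm).
Qed.

Lemma is_Cderive_plus (f g : C -> C) z df dg : is_Cderive f z df -> is_Cderive g z dg ->
  is_Cderive (fun u => f u + g u)%C z (df + dg)%C.
Proof.
intros hf hg. exact (is_derive_plus (K := C_AbsRing) (V := AbsRing_NormedModule C_AbsRing) f g z df dg hf hg).
Qed.

Lemma is_Cderive_const (c z : C) : is_Cderive (fun _ => c) z (RtoC 0).
Proof. exact (is_derive_const (K := C_AbsRing) (V := AbsRing_NormedModule C_AbsRing) c z). Qed.

Lemma is_Cderive_id (z : C) : is_Cderive (fun u => u) z (RtoC 1).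
Proof. exact (is_derive_id (K := C_AbsRing) z). Qed.

Lemma is_Cderive_comp (f g : C -> C) z df dg : is_Cderive f (g z) df -> is_Cderive g z dg ->
  is_Cderive (fun u => f (g u)) z (dg * df)%C.
Proof.
intros hf hg. exact (is_derive_comp (K := C_AbsRing) (V := AbsRing_NormedModule C_AbsRing) f g z df dg hf hg).
Qed.

(** * Integration of complex-valued functions of a real variable *)

Notation CV := C_R_CompleteNormedModule.
Notation ccont := (continuous (T := R_UniformSpace) (U := C_UniformSpace)).
Notation CInt := (RInt (V := CV)).
Notation is_CInt := (is_RInt (V := CV)).
Notation ex_CInt := (ex_RInt (V := CV)).

(** Bridge to real analysis: along [t |-> z + t d] the derivative is [d l].
    The directions [1] and [i] give the Cauchy-Riemann equations. *)
Lemma is_Cderive_line (f : C -> C) (z l d : C) :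
  is_Cderive f z l ->
  is_derive (fun t : R => Re (f (z + RtoC t * d)%C)) 0 (Re (d * l)%C) /\
  is_derive (fun t : R => Im (f (z + RtoC t * d)%C)) 0 (Im (d * l)%C).
Proof.
intros H.
assert (K : forall eps : posreal, exists del : posreal, forall t : R, t <> 0 -> Rabs t < del ->
  Cmod ((f (z + RtoC t * d) - f z) / RtoC t - d * l)%C < eps).
{ intros eps.
  assert (hp : 0 < eps / (2 * (1 + Cmod d))).
  { apply Rdiv_lt_0_compat. apply cond_pos. pose proof (Cmod_ge_0 d); lra. }
  rewrite is_Cderive_eps in H. destruct (H (mkposreal _ hp)) as [del Hd]; simpl in Hd.
  assert (hp2 : 0 < del / (1 + Cmod d)).
  { apply Rdiv_lt_0_compat. apply cond_pos. pose proof (Cmod_ge_0 d); lra. }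
  exists (mkposreal _ hp2); simpl. intros t t0 ht.
  assert (hd := Cmod_ge_0 d).
  assert (0 < Rabs t) by (apply Rabs_pos_lt; auto).
  assert (tC : RtoC t <> 0) by (intros h; apply t0; apply RtoC_inj; auto).
  specialize (Hd (RtoC t * d)%C).
  rewrite Cmod_mult, Cmod_R in Hd.
  replace ((f (z + RtoC t * d) - f z) / RtoC t - d * l)%C with
    ((f (z + RtoC t * d) - f z - RtoC t * d * l) / RtoC t)%C by (field; auto).
  rewrite Cmod_div, Cmod_R by auto. apply Rlt_div_l. auto.
  apply Rlt_div_r in ht; [|lra].
  eapply Rle_lt_trans. apply Hd. nra.
  replace (eps / (2 * (1 + Cmod d)) * (Rabs t * Cmod d)) with (eps * Rabs t * (Cmod d / (2 * (1 + Cmod d)))) by (field; lra).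
  pose proof (cond_pos eps).
  assert (Cmod d / (2 * (1 + Cmod d)) < 1).
  { apply Rlt_div_l; lra. }
  assert (0 < eps * Rabs t) by (apply Rmult_lt_0_compat; auto).
  nra. }
assert (E : forall t, t <> 0 -> Re ((f (z + RtoC t * d) - f z) / RtoC t - d * l)%C =
    (Re (f (z + RtoC t * d)%C) - Re (f z)) / t - Re (d * l)%C /\
  Im ((f (z + RtoC t * d) - f z) / RtoC t - d * l)%C =
    (Im (f (z + RtoC t * d)%C) - Im (f z)) / t - Im (d * l)%C).
{ intros t t0.
  assert (E0 : ((f (z + RtoC t * d) - f z) / RtoC t)%C = ((f (z + RtoC t * d) - f z) * RtoC (/ t))%C).
  { rewrite RtoC_inv by auto. reflexivity. }
  rewrite E0. unfold Re, Im, Cminus, Cplus, Copp, Cmult, RtoC; simpl. 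
  split; field; auto. }
split; apply is_derive_Reals; intros eps he;
 destruct (K (mkposreal eps he)) as [del Hd]; exists del; intros t t0 ht;
 specialize (Hd t t0 ht); destruct (E t t0) as [E1 E2]; simpl in Hd;
 rewrite Rplus_0_l; replace (z + RtoC 0 * d)%C with z by ring.
- rewrite <- E1. eapply Rle_lt_trans. apply Rabs_Re_le_Cmod. exact Hd.
- rewrite <- E2. eapply Rle_lt_trans. apply Rabs_Im_le_Cmod. exact Hd.
Qed.

Lemma is_derive_shift0 (f : R -> R) (x l : R) :
  is_derive (fun t => f (x + t)) 0 l -> is_derive f x l.
Proof.
intros H. apply is_derive_Reals. apply is_derive_Reals in H.
intros eps he. destruct (H eps he) as [del Hd]. exists del. intros h h0 hh.
specialize (Hd h h0 hh). rewrite Rplus_0_l, Rplus_0_r in Hd. exact Hd.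
Qed.

Lemma is_Cderive_horizontal (f : C -> C) (x y : R) (l : C) :
  is_Cderive f (x, y) l ->
  is_derive (fun t => Re (f (t, y))) x (Re l) /\
  is_derive (fun t => Im (f (t, y))) x (Im l).
Proof.
intros H. destruct (is_Cderive_line f (x, y) l 1 H) as [H1 H2].
rewrite Cmult_1_l in H1, H2.
split; apply is_derive_shift0.
- revert H1. apply is_derive_ext. intros t. do 2 f_equal. apply injective_projections; simpl; ring.
- revert H2. apply is_derive_ext. intros t. do 2 f_equal. apply injective_projections; simpl; ring.
Qed.

Lemma is_Cderive_vertical (f : C -> C) (x y : R) (l : C) :
  is_Cderive f (x, y) l ->
  is_derive (fun t => Re (f (x, t))) y (- Im l) /\
  is_derive (fun t => Im (f (x, t))) y (Re l).
Proof.
intros H. destruct (is_Cderive_line f (x, y) l Ci H) as [H1 H2].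
replace (Re (Ci * l)%C) with (- Im l) in H1 by (unfold Im; simpl; ring).
replace (Im (Ci * l)%C) with (Re l) in H2 by (unfold Re; simpl; ring).
split; apply is_derive_shift0.
- revert H1. apply is_derive_ext. intros t. do 2 f_equal. apply injective_projections; simpl; ring.
- revert H2. apply is_derive_ext. intros t. do 2 f_equal. apply injective_projections; simpl; ring.
Qed.

(** Continuity with an explicit rate; the residue computation uses the rate. *)
Lemma is_Cderive_lipschitz (f : C -> C) (z l : C) : is_Cderive f z l ->
  exists del : posreal, forall h, Cmod h < del -> Cmod (f (z + h)%C - f z)%C <= (1 + Cmod l) * Cmod h.
Proof.
intros H. rewrite is_Cderive_eps in H. destruct (H (mkposreal 1 Rlt_0_1)) as [del Hd].
exists del. intros h hh. specialize (Hd h hh); simpl in Hd.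
replace (f (z + h) - f z)%C with ((f (z + h) - f z - h * l) + h * l)%C by ring.
eapply Rle_trans. apply Cmod_triangle. rewrite Cmod_mult. lra.
Qed.

Lemma is_Cderive_continuity_2d (f : C -> C) (x y : R) (l : C) : is_Cderive f (x, y) l ->
  continuity_2d_pt (fun u v => Re (f (u, v))) x y /\
  continuity_2d_pt (fun u v => Im (f (u, v))) x y.
Proof.
intros H. destruct (is_Cderive_lipschitz f _ l H) as [del Hd].
assert (K : forall eps : posreal, exists d : posreal, forall u v, Rabs (u - x) < d -> Rabs (v - y) < d ->
   Cmod (f (u, v) - f (x, y))%C < eps).
{ intros eps. pose proof (Cmod_ge_0 l) as hl. pose proof (cond_pos eps) as he. pose proof (cond_pos del) as hdl.
  assert (hp : 0 < Rmin (del / 2) (eps / (2 * (1 + Cmod l)))).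
  { apply Rmin_glb_lt; apply Rdiv_lt_0_compat; lra. }
  exists (mkposreal _ hp); simpl. intros u v hu hv.
  pose proof (Rmin_l (del / 2) (eps / (2 * (1 + Cmod l)))).
  pose proof (Rmin_r (del / 2) (eps / (2 * (1 + Cmod l)))).
  pose proof (Cmod_pair_le (u - x) (v - y)).
  replace (u, v) with ((x, y) + ((u - x)%R, (v - y)%R))%C by (apply injective_projections; simpl; ring).
  eapply Rle_lt_trans. apply Hd. lra.
  apply Rle_lt_trans with ((1 + Cmod l) * (Rabs (u - x) + Rabs (v - y))).
  apply Rmult_le_compat_l; lra.
  replace (pos eps) with ((1 + Cmod l) * (eps / (2 * (1 + Cmod l)) + eps / (2 * (1 + Cmod l)))) by (field; lra).
  apply Rmult_lt_compat_l; lra. }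
split; intros eps; destruct (K eps) as [d hd]; exists d; intros u v hu hv; 
 specialize (hd u v hu hv); eapply Rle_lt_trans; try exact hd.
- exact (Rabs_Re_le_Cmod (f (u, v) - f (x, y))%C).
- exact (Rabs_Im_le_Cmod (f (u, v) - f (x, y))%C).
Qed.

Lemma ccont_pair (f : R -> C) (t : R) :
  ccont f t <-> (continuous (fun t => Re (f t)) t /\ continuous (fun t => Im (f t)) t).
Proof.
split.
- intros H. split; apply (continuous_comp (U := R_UniformSpace) (V := C_UniformSpace) f); auto.
  apply continuous_fst. apply continuous_snd.
- intros [H1 H2]. 
  intros P [eps HP]. 
  assert (K1 : locally t (fun s => Rabs (Re (f s) - Re (f t)) < eps)).
  { apply (H1 (fun y => Rabs (y - Re (f t)) < eps)). exists eps. intros y hy. exact hy. }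
  assert (K2 : locally t (fun s => Rabs (Im (f s) - Im (f t)) < eps)).
  { apply (H2 (fun y => Rabs (y - Im (f t)) < eps)). exists eps. intros y hy. exact hy. }
  assert (K := filter_and _ _ K1 K2). unfold filtermap. revert K. apply filter_imp. intros s [h1 h2].
  apply HP. split; [exact h1|exact h2].
Qed.

Lemma is_CInt_pair (f : R -> C) a b (l : C) :
  is_CInt f a b l <-> (is_RInt (fun t => Re (f t)) a b (Re l) /\ is_RInt (fun t => Im (f t)) a b (Im l)).
Proof.
split.
- intros H. split.
  exact (is_RInt_fct_extend_fst (U := R_NormedModule) (V := R_NormedModule) f a b l H).
  exact (is_RInt_fct_extend_snd (U := R_NormedModule) (V := R_NormedModule) f a b l H).
- intros [H1 H2]. destruct l as [l1 l2].
  exact (is_RInt_fct_extend_pair (U := R_NormedModule) (V := R_NormedModule) f a b l1 l2 H1 H2).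
Qed.

Lemma ex_CInt_cont (f : R -> C) a b : (forall t, Rmin a b <= t <= Rmax a b -> ccont f t) -> ex_CInt f a b.
Proof. intros H. exact (ex_RInt_continuous (V := CV) f a b H). Qed.

Lemma CInt_pair (f : R -> C) a b : ex_CInt f a b ->
  CInt f a b = (RInt (fun t => Re (f t)) a b, RInt (fun t => Im (f t)) a b).
Proof.
intros [l H]. rewrite (is_RInt_unique (V := CV) f a b l H).
apply is_CInt_pair in H. destruct H as [H1 H2].
apply (is_RInt_unique (V := R_CompleteNormedModule)) in H1.
apply (is_RInt_unique (V := R_CompleteNormedModule)) in H2. rewrite H1, H2.
destruct l; reflexivity.
Qed.

Lemma is_CInt_Cmult (c : C) (f : R -> C) a b l : is_CInt f a b l ->
  is_CInt (fun t => c * f t)%C a b (c * l)%C.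
Proof.
intros H. apply is_CInt_pair in H. destruct H as [H1 H2]. apply is_CInt_pair. 
assert (S : forall k (g : R -> R) v, is_RInt g a b v -> is_RInt (fun t => k * g t) a b (k * v)).
{ intros k g v h. exact (is_RInt_scal (V := R_NormedModule) g a b k v h). }
split.
- exact (is_RInt_minus (V := R_NormedModule) _ _ _ _ _ _ (S (Re c) _ _ H1) (S (Im c) _ _ H2)).
- exact (is_RInt_plus (V := R_NormedModule) _ _ _ _ _ _ (S (Re c) _ _ H2) (S (Im c) _ _ H1)).
Qed.

Lemma CInt_Cmult (c : C) (f : R -> C) a b : ex_CInt f a b ->
  CInt (fun t => c * f t)%C a b = (c * CInt f a b)%C.
Proof. intros H. apply is_RInt_unique. apply is_CInt_Cmult. exact (RInt_correct (V := CV) f a b H). Qed.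

Lemma CInt_plus (f g : R -> C) a b : ex_CInt f a b -> ex_CInt g a b ->
  CInt (fun t => f t + g t)%C a b = (CInt f a b + CInt g a b)%C.
Proof. intros H1 H2. exact (RInt_plus (V := CV) f g a b H1 H2). Qed.

Lemma CInt_minus (f g : R -> C) a b : ex_CInt f a b -> ex_CInt g a b ->
  CInt (fun t => f t - g t)%C a b = (CInt f a b - CInt g a b)%C.
Proof. intros H1 H2. exact (RInt_minus (V := CV) f g a b H1 H2). Qed.

Lemma CInt_Chasles (f : R -> C) a b c : ex_CInt f a b -> ex_CInt f b c ->
  (CInt f a b + CInt f b c)%C = CInt f a c.
Proof. intros H1 H2. exact (RInt_Chasles (V := CV) f a b c H1 H2). Qed.

Lemma CInt_swap (f : R -> C) a b : ex_CInt f a b -> CInt f b a = (- CInt f a b)%C.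
Proof. intros H. symmetry. exact (opp_RInt_swap (V := CV) f a b H). Qed.

Lemma CInt_ext (f g : R -> C) a b : (forall t, f t = g t) -> CInt f a b = CInt g a b.
Proof. intros H. apply RInt_ext. intros; apply H. Qed.

Lemma CInt_bound (f : R -> C) (g : R -> R) a b : a <= b -> ex_CInt f a b -> ex_RInt g a b ->
  (forall t, a <= t <= b -> Cmod (f t) <= g t) -> Cmod (CInt f a b) <= RInt g a b.
Proof.
intros hab H1 H2 H. rewrite Cmod_norm.
apply (norm_RInt_le (V := CV) f g a b); auto.
- intros x hx. change (norm (f x)) with (norm (K := R_AbsRing) (V := C_R_NormedModule) (f x)). 
  rewrite <- Cmod_norm; auto.
- exact (RInt_correct (V := CV) f a b H1).
- exact (RInt_correct (V := R_CompleteNormedModule) g a b H2).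
Qed.

Lemma CInt_bound_const (f : R -> C) (M : R) a b : a <= b -> ex_CInt f a b ->
  (forall t, a <= t <= b -> Cmod (f t) <= M) -> Cmod (CInt f a b) <= M * (b - a).
Proof.
intros hab H1 H. eapply Rle_trans. apply (CInt_bound f (fun _ => M)); auto.
apply ex_RInt_const. rewrite RInt_const. apply Req_le. unfold scal; simpl; unfold mult; simpl. ring.
Qed.

Lemma CInt_shift (f : R -> C) a b c : ex_CInt f (a + c) (b + c) ->
  CInt (fun t => f (t + c)) a b = CInt f (a + c) (b + c).
Proof.
intros H. 
rewrite <- (Rmult_1_l a) at 2. rewrite <- (Rmult_1_l b) at 2.
rewrite <- (RInt_comp_lin (V := CV) f 1 c a b).
- apply CInt_ext. intros t. rewrite Rmult_1_l. symmetry; apply (scal_one (V := CV)).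
- rewrite !Rmult_1_l. exact H.
Qed.

(** By the Cauchy-Riemann equations, the pairs [(Re f, - Im f)] and
    [(Im f, Re f)] satisfy the hypothesis of Green's formula with
    [D = - Im f'] and [D = Re f']. *)
Lemma rectangle_Cauchy (f f' : C -> C) (A B y1 y2 d : R) :
  A <= B -> y1 <= y2 -> 0 < d ->
  (forall x y, A - d < x < B + d -> y1 - d < y < y2 + d ->
     is_Cderive f (x, y) (f' (x, y)) /\ exists l, is_Cderive f' (x, y) l) ->
  (CInt (fun x => f (x, y2)) A B - CInt (fun x => f (x, y1)) A B)%C =
  (Ci * (CInt (fun y => f (B, y)) y1 y2 - CInt (fun y => f (A, y)) y1 y2))%C.
Proof.
intros hAB hy hd H.
assert (c1 : forall x y, A - d < x < B + d -> y1 - d < y < y2 + d -> 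
  ccont (fun t => f (t, y)) x /\ ccont (fun t => f (x, t)) y).
{ intros x y hx hyy. destruct (H x y hx hyy) as [H1 _].
  split; apply ccont_pair; split; apply (ex_derive_continuous (K := R_AbsRing) (V := R_NormedModule)).
  - exists (Re (f' (x, y))). apply (is_Cderive_horizontal f x y). auto.
  - exists (Im (f' (x, y))). apply (is_Cderive_horizontal f x y). auto.
  - exists (- Im (f' (x, y))). apply (is_Cderive_vertical f x y). auto.
  - exists (Re (f' (x, y))). apply (is_Cderive_vertical f x y). auto. }
assert (G1 := Green_rectangle (fun x y => Re (f (x, y))) (fun x y => - Im (f (x, y))) (fun x y => - Im (f' (x, y))) A B y1 y2 d hAB hy hd).
assert (G2 := Green_rectangle (fun x y => Im (f (x, y))) (fun x y => Re (f (x, y))) (fun x y => Re (f' (x, y))) A B y1 y2 d hAB hy hd).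
lapply G1; clear G1. intros G1.
lapply G2; clear G2. intros G2.
- assert (ex1 : forall y, y1 <= y <= y2 -> ex_CInt (fun x => f (x, y)) A B).
  { intros y h. apply ex_CInt_cont. intros t ht. rewrite Rmin_left, Rmax_right in ht by lra. apply c1; lra. }
  assert (ex2 : forall x, A <= x <= B -> ex_CInt (fun y => f (x, y)) y1 y2).
  { intros x h. apply ex_CInt_cont. intros t ht. rewrite Rmin_left, Rmax_right in ht by lra. apply c1; lra. }
  rewrite !CInt_pair; try (apply ex1; lra); try (apply ex2; lra).
  rewrite (RInt_opp (V := R_CompleteNormedModule) (fun y => Im (f (B, y)))) in G1.
  rewrite (RInt_opp (V := R_CompleteNormedModule) (fun y => Im (f (A, y)))) in G1.
  + apply injective_projections; simpl.
    * unfold opp in G1; simpl in G1. rewrite !Rmult_0_l, Rmult_1_l. unfold Rminus in *. lra.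
    * rewrite !Rmult_0_l, Rmult_1_l. unfold Rminus in *. lra.
  + destruct (ex2 A ltac:(lra)) as [l hl]. exists (Im l). apply is_CInt_pair in hl. apply hl.
  + destruct (ex2 B ltac:(lra)) as [l hl]. exists (Im l). apply is_CInt_pair in hl. apply hl.
- intros x y hx hyy. destruct (H x y hx hyy) as [H1 [l H2]].
  destruct (c1 x y hx hyy) as [k1 k2]. apply ccont_pair in k1. apply ccont_pair in k2.
  refine (conj (proj2 (is_Cderive_vertical f x y _ H1)) (conj (proj1 (is_Cderive_horizontal f x y _ H1))
    (conj (proj2 k1) (conj (proj1 k2) (proj1 (is_Cderive_continuity_2d f' x y l H2)))))).
- intros x y hx hyy. destruct (H x y hx hyy) as [H1 [l H2]].
  destruct (c1 x y hx hyy) as [k1 k2]. apply ccont_pair in k1. apply ccont_pair in k2.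
  refine (conj (proj1 (is_Cderive_vertical f x y _ H1)) (conj
    (is_derive_opp (K := R_AbsRing) (V := R_NormedModule) (fun t => Im (f (t, y))) _ _
       (proj2 (is_Cderive_horizontal f x y _ H1)))
    (conj (proj1 k1) (conj (continuous_opp (V := R_NormedModule) (fun t => Im (f (x, t))) _ (proj2 k2)) _)))).
  intros eps. destruct (is_Cderive_continuity_2d f' x y l H2) as [_ K]. destruct (K eps) as [dd hdd].
  exists dd. intros u v hu hv. specialize (hdd u v hu hv).
  replace (- Im (f' (u, v)) - - Im (f' (x, y))) with (- (Im (f' (u, v)) - Im (f' (x, y)))) by ring.
  rewrite Rabs_Ropp. exact hdd.
Qed.

(** * Contour integrals over rectangles and the residue theorem *)

(** The counterclockwise integral of [f] along the boundary. *)
Definition rect_int (f : C -> C) (A B y1 y2 : R) : C :=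
  (CInt (fun x => f (x, y1)) A B - CInt (fun x => f (x, y2)) A B +
   Ci * (CInt (fun y => f (B, y)) y1 y2 - CInt (fun y => f (A, y)) y1 y2))%C.

(** The second derivative is there to make [f'] continuous while keeping the
    notion stable under algebraic operations, so that continuity never has to
    be proved separately. *)
Definition holo_at (f f' : C -> C) (z : C) : Prop :=
  is_Cderive f z (f' z) /\ exists l, is_Cderive f' z l.

Lemma rect_int_0 (f f' : C -> C) (A B y1 y2 d : R) :
  A <= B -> y1 <= y2 -> 0 < d ->
  (forall x y, A - d < x < B + d -> y1 - d < y < y2 + d -> holo_at f f' (x, y)) ->
  rect_int f A B y1 y2 = 0.
Proof.
intros hAB hy hd H. unfold rect_int.
rewrite <- (rectangle_Cauchy f f' A B y1 y2 d hAB hy hd H). ring.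
Qed.

Lemma Cderive_ccont (f : C -> C) (x y : R) l : is_Cderive f (x, y) l ->
  ccont (fun t => f (t, y)) x /\ ccont (fun t => f (x, t)) y.
Proof.
intros H1.
split; apply ccont_pair; split; apply (ex_derive_continuous (K := R_AbsRing) (V := R_NormedModule)).
- exists (Re l). apply (is_Cderive_horizontal f x y). auto.
- exists (Im l). apply (is_Cderive_horizontal f x y). auto.
- exists (- Im l). apply (is_Cderive_vertical f x y). auto.
- exists (Re l). apply (is_Cderive_vertical f x y). auto.
Qed.

Lemma ex_CInt_h (f : C -> C) (y A B : R) : A <= B ->
  (forall x, A <= x <= B -> exists l, is_Cderive f (x, y) l) -> ex_CInt (fun x => f (x, y)) A B.
Proof.
intros hAB H. apply ex_CInt_cont. intros t ht. rewrite Rmin_left, Rmax_right in ht by lra.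
destruct (H t ht) as [l hl]. apply (Cderive_ccont f t y l hl).
Qed.

Lemma ex_CInt_v (f : C -> C) (x A B : R) : A <= B ->
  (forall y, A <= y <= B -> exists l, is_Cderive f (x, y) l) -> ex_CInt (fun y => f (x, y)) A B.
Proof.
intros hAB H. apply ex_CInt_cont. intros t ht. rewrite Rmin_left, Rmax_right in ht by lra.
destruct (H t ht) as [l hl]. apply (Cderive_ccont f x t l hl).
Qed.

Lemma rect_int_split_h (f : C -> C) (A M B y1 y2 : R) :
  (forall y, y = y1 \/ y = y2 -> ex_CInt (fun x => f (x, y)) A M) -> 
  (forall y, y = y1 \/ y = y2 -> ex_CInt (fun x => f (x, y)) M B) -> 
  rect_int f A B y1 y2 = (rect_int f A M y1 y2 + rect_int f M B y1 y2)%C.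
Proof.
intros H1 H2. unfold rect_int.
rewrite <- (CInt_Chasles (fun x => f (x, y1)) A M B); auto.
rewrite <- (CInt_Chasles (fun x => f (x, y2)) A M B); auto.
ring.
Qed.

Lemma rect_int_split_v (f : C -> C) (A B y1 m y2 : R) :
  (forall x, x = A \/ x = B -> ex_CInt (fun y => f (x, y)) y1 m) -> 
  (forall x, x = A \/ x = B -> ex_CInt (fun y => f (x, y)) m y2) -> 
  rect_int f A B y1 y2 = (rect_int f A B y1 m + rect_int f A B m y2)%C.
Proof.
intros H1 H2. unfold rect_int.
rewrite <- (CInt_Chasles (fun y => f (A, y)) y1 m y2); auto.
rewrite <- (CInt_Chasles (fun y => f (B, y)) y1 m y2); auto.
ring.
Qed.

(** The integral of [1 / h] around the square of half-side [e] centred at [0]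
    is [i] times this one: opposite sides combine into [4 e / (t^2 + e^2)]. *)
Lemma square_kernel (e : R) : 0 < e ->
  is_RInt (fun t => 4 * e / (t ^ 2 + e ^ 2)) (- e) e (2 * PI).
Proof.
intros he.
replace (2 * PI) with (minus (4 * atan (e / e)) (4 * atan (- e / e))).
2: { replace (e / e) with 1 by (field; lra). replace (- e / e) with (- (1)) by (field; lra).
     rewrite atan_opp, atan_1. unfold minus, plus, opp; simpl. field. }
apply (is_RInt_derive (V := R_CompleteNormedModule) (fun t => 4 * atan (t / e))).
- intros t _. auto_derive. auto. field. split; nra.
- intros t _. apply (ex_derive_continuous (K := R_AbsRing) (V := R_NormedModule)). auto_derive. nra.
Qed.

(** Cauchy's theorem on the four rectangles that surround a small square
    centred at the pole reduces the integral to the square.  There [f] differs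
    from [c / h] by [o (1 / h)] while the perimeter is of the order of [Cmod h],
    so the error tends to [0]. *)
Lemma residue_rectangle (f f' : C -> C) (A B y1 y2 d px py : R) (c : C) :
  A < px < B -> y1 < py < y2 -> 0 < d ->
  (forall x y, A - d < x < B + d -> y1 - d < y < y2 + d -> (x, y) <> (px, py) ->
    holo_at f f' (x, y)) ->
  (forall eps : posreal, exists del : posreal, forall h : C, h <> 0 -> Cmod h < del ->
     Cmod (h * f ((px, py) + h) - c)%C <= eps) ->
  rect_int f A B y1 y2 = (2 * PI * Ci * c)%C.
Proof.
intros hx hy hd H L.
assert (small : exists e0, 0 < e0 /\ forall e, 0 < e < e0 ->
  A < px - e /\ px + e < B /\ y1 < py - e /\ py + e < y2 /\ e < d).
{ exists (Rmin (Rmin (Rmin (px - A) (B - px)) (Rmin (py - y1) (y2 - py))) d).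
  split. repeat apply Rmin_glb_lt; lra.
  intros e [h1 h2]. 
  pose proof (Rmin_l (Rmin (Rmin (px - A) (B - px)) (Rmin (py - y1) (y2 - py))) d).
  pose proof (Rmin_r (Rmin (Rmin (px - A) (B - px)) (Rmin (py - y1) (y2 - py))) d).
  pose proof (Rmin_l (Rmin (px - A) (B - px)) (Rmin (py - y1) (y2 - py))).
  pose proof (Rmin_r (Rmin (px - A) (B - px)) (Rmin (py - y1) (y2 - py))).
  pose proof (Rmin_l (px - A) (B - px)).
  pose proof (Rmin_r (px - A) (B - px)).
  pose proof (Rmin_l (py - y1) (y2 - py)).
  pose proof (Rmin_r (py - y1) (y2 - py)). lra. }
destruct small as [e0 [he0 small]].
assert (exh : forall y a b, y <> py -> y1 <= y <= y2 -> A <= a -> a <= b -> b <= B -> ex_CInt (fun x => f (x, y)) a b).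
{ intros y a b n1 n2 n3 n4 n5. apply ex_CInt_h; auto. intros x hxx. exists (f' (x, y)).
  apply H; try lra. intros E; inversion E; auto. }
assert (exv : forall x a b, x <> px -> A <= x <= B -> y1 <= a -> a <= b -> b <= y2 -> ex_CInt (fun y => f (x, y)) a b).
{ intros x a b n1 n2 n3 n4 n5. apply ex_CInt_v; auto. intros y hxx. exists (f' (x, y)).
  apply H; try lra. intros E; inversion E; auto. }
assert (S : forall e, 0 < e < e0 -> rect_int f A B y1 y2 = rect_int f (px - e) (px + e) (py - e) (py + e)).
{ intros e he. destruct (small e he) as (s1 & s2 & s3 & s4 & s5).
  rewrite (rect_int_split_h f A (px - e) B) by (intros y [-> | ->]; apply exh; lra).
  rewrite (rect_int_split_h f (px - e) (px + e) B) by (intros y [-> | ->]; apply exh; lra).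
  rewrite (rect_int_0 f f' A (px - e) y1 y2 e); try lra.
  2: { intros x y h1 h2. apply H; try lra. intros E; inversion E; lra. }
  rewrite (rect_int_0 f f' (px + e) B y1 y2 e); try lra.
  2: { intros x y h1 h2. apply H; try lra. intros E; inversion E; lra. }
  rewrite (rect_int_split_v f (px - e) (px + e) y1 (py - e) y2) by (intros x [-> | ->]; apply exv; lra).
  rewrite (rect_int_split_v f (px - e) (px + e) (py - e) (py + e) y2) by (intros x [-> | ->]; apply exv; lra).
  rewrite (rect_int_0 f f' (px - e) (px + e) y1 (py - e) e); try lra.
  2: { intros x y h1 h2. apply H; try lra. intros E; inversion E; lra. }
  rewrite (rect_int_0 f f' (px - e) (px + e) (py + e) y2 e); try lra.
  2: { intros x y h1 h2. apply H; try lra. intros E; inversion E; lra. }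
  ring. }
apply Ceq_minus. apply Cmod_eq_0. apply Rle_antisym. 2: apply Cmod_ge_0.
apply le_epsilon. intros eta heta. rewrite Rplus_0_l.
assert (h8 : 0 < eta / 8) by lra.
destruct (L (mkposreal _ h8)) as [del Hd]; simpl in Hd. pose proof (cond_pos del) as hdel.
(* on the square, [e <= Cmod h <= 2 e < del] *)
set (e := Rmin (e0 / 2) (del / 3)).
assert (he : 0 < e) by (apply Rmin_glb_lt; lra).
assert (he1 : e <= e0 / 2) by apply Rmin_l.
assert (he2 : e <= del / 3) by apply Rmin_r.
clearbody e.
destruct (small e) as (s1 & s2 & s3 & s4 & s5). lra.
rewrite (S e) by lra. unfold rect_int.
set (P := (px, py)) in *.
assert (E : forall (g : R -> C) q, ex_CInt g (q - e) (q + e) ->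
   CInt g (q - e) (q + e) = CInt (fun t => g (t + q)) (- e) e /\ ex_CInt (fun t => g (t + q)) (- e) e).
{ intros g q hg. replace (q - e) with (- e + q) in * by ring. replace (q + e) with (e + q) in * by ring. split.
  symmetry; apply CInt_shift. exact hg.
  rewrite <- (Rmult_1_l (- e)) in hg. rewrite <- (Rmult_1_l e) in hg at 2.
  assert (K := ex_RInt_comp_lin (V := CV) g 1 q (- e) e hg).
  revert K. apply (ex_RInt_ext (V := CV)). intros t _. rewrite Rmult_1_l. apply (scal_one (V := CV)). }
destruct (E (fun x => f (x, py - e)) px) as [E1 X1]. apply exh; lra.
destruct (E (fun x => f (x, py + e)) px) as [E2 X2]. apply exh; lra.
destruct (E (fun y => f (px + e, y)) py) as [E3 X3]. apply exv; lra.
destruct (E (fun y => f (px - e, y)) py) as [E4 X4]. apply exv; lra.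
rewrite E1, E2, E3, E4.
rewrite <- (CInt_minus _ _ _ _ X1 X2), <- (CInt_minus _ _ _ _ X3 X4).
assert (XX := fun f g u v => ex_RInt_minus (V := CV) f g (- e) e u v).
rewrite <- CInt_Cmult. 2: exact (XX _ _ X3 X4).
assert (Y1 := XX _ _ X1 X2). 
destruct (XX _ _ X3 X4) as [l34 h34]. assert (Y2 := is_CInt_Cmult Ci _ _ _ _ h34).
rewrite <- CInt_plus; [| exact Y1 | exists (Ci * l34)%C; exact Y2].
assert (Y := ex_RInt_plus (V := CV) _ _ _ _ Y1 (ex_intro _ _ Y2)). clear Y1 Y2.
assert (K := square_kernel e he).
assert (KC : is_CInt (fun t => (c * Ci) * RtoC (4 * e / (t ^ 2 + e ^ 2)))%C (- e) e (c * Ci * RtoC (2 * PI))%C).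
{ apply is_CInt_Cmult. apply is_CInt_pair. split. exact K.
  assert (Z : forall l : R, l = 0 -> is_RInt (V := R_NormedModule) (fun _ : R => 0) (- e) e l).
  { intros l hl. replace l with (scal (e - - e) (0 : R_NormedModule)). exact (is_RInt_const (V := R_NormedModule) (- e) e 0). rewrite hl; exact (Rmult_0_r _). }
  apply Z. reflexivity. }
replace (2 * PI * Ci * c)%C with (c * Ci * RtoC (2 * PI))%C by (rewrite RtoC_mult; ring).
rewrite <- (is_RInt_unique (V := CV) _ _ _ _ KC).
rewrite <- CInt_minus. 2: exact Y. 2: exists (c * Ci * RtoC (2 * PI))%C; exact KC.
assert (Z := ex_RInt_minus (V := CV) _ _ _ _ Y (ex_intro _ _ KC)).
eapply Rle_trans. apply (CInt_bound_const _ (4 * (eta / 8 / e))). lra. exact Z.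
2: apply Req_le; field; lra.
intros t ht.
assert (q : forall h : C, h <> 0 -> e <= Cmod h -> Cmod h < del -> Cmod (f (P + h) - c / h)%C <= eta / 8 / e).
{ intros h h0 h1 h2. specialize (Hd h h0 h2).
  replace (f (P + h) - c / h)%C with ((h * f (P + h) - c) / h)%C by (field; auto).
  rewrite Cmod_div by auto.
  apply Rmult_le_compat. apply Cmod_ge_0. left; apply Rinv_0_lt_compat; lra. exact Hd.
  apply Rinv_le_contravar; lra. }
assert (m1 : forall a b, Rabs a = e -> Rabs b <= e -> (a, b) <> RtoC 0 /\ (b, a) <> RtoC 0 /\
   e <= Cmod (a, b) < del /\ e <= Cmod (b, a) < del).
{ intros a b h1 h2. 
  pose proof (Rabs_Re_le_Cmod (a, b)) as k1. pose proof (Rabs_Im_le_Cmod (b, a)) as k2. simpl in k1, k2.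
  pose proof (Cmod_pair_le a b). pose proof (Cmod_pair_le b a).
  assert (a0 : a <> 0) by (intros ->; rewrite Rabs_R0 in h1; lra).
  split; [|split; [|lra]].
  - intros k. apply a0. exact (f_equal fst k).
  - intros k. apply a0. exact (f_equal snd k). }
assert (at1 : Rabs t <= e) by (apply Rabs_le; lra).
assert (ae : Rabs e = e) by (apply Rabs_pos_eq; lra).
assert (ane : Rabs (- e) = e) by (rewrite Rabs_Ropp; lra).
destruct (m1 e t ae at1) as (n1 & n2 & n3 & n4).
destruct (m1 (- e) t ane at1) as (n5 & n6 & n7 & n8).
assert (q1 := q _ n1 (proj1 n3) (proj2 n3)).
assert (q2 := q _ n2 (proj1 n4) (proj2 n4)).
assert (q3 := q _ n5 (proj1 n7) (proj2 n7)).
assert (q4 := q _ n6 (proj1 n8) (proj2 n8)).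
replace (t + px, py - e) with (P + (t, - e)%R)%C by (apply injective_projections; simpl; ring).
replace (t + px, py + e) with (P + (t, e))%C by (apply injective_projections; simpl; ring).
replace (px + e, t + py) with (P + (e, t))%C by (apply injective_projections; simpl; ring).
replace (px - e, t + py) with (P + (- e, t)%R)%C by (apply injective_projections; simpl; ring).
replace (f (P + (t, - e)%R) - f (P + (t, e)) + Ci * (f (P + (e, t)) - f (P + (- e, t)%R)) -
  c * Ci * RtoC (4 * e / (t ^ 2 + e ^ 2)))%C with
 ((f (P + (t, - e)%R) - c / (t, - e)%R) - (f (P + (t, e)) - c / (t, e)) +
   Ci * ((f (P + (e, t)) - c / (e, t)) - (f (P + (- e, t)%R) - c / (- e, t)%R)))%C.
- eapply Rle_trans. apply Cmod_triangle. rewrite Cmod_mult, Cmod_Ci. unfold Cminus at 1 4.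
  eapply Rle_trans. apply Rplus_le_compat. apply Cmod_triangle. apply Rmult_le_compat_l. lra. apply Cmod_triangle.
  rewrite !Cmod_opp. lra.
- assert (Q : (/ (t, - e)%R - / (t, e) + Ci * (/ (e, t) - / (- e, t)%R) = Ci * RtoC (4 * e / (t ^ 2 + e ^ 2)))%C).
  { assert (0 < e * e) by nra. assert (0 <= t * t) by nra.
    apply injective_projections; simpl; field; repeat split; nra. }
  unfold Cdiv. rewrite <- Cmult_assoc, <- Q. ring.
Qed.

Lemma holo_affine (a b z : C) : holo_at (fun u => a + b * u)%C (fun _ => b) z.
Proof.
split.
- apply is_Cderive_ext_val with (0 + (0 * z + b * 1))%C. 2: ring.
  apply is_Cderive_plus. apply is_Cderive_const.
  apply is_Cderive_mult. apply is_Cderive_const. apply is_Cderive_id.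
- exists (RtoC 0). apply is_Cderive_const.
Qed.

Lemma holo_plus (f f' g g' : C -> C) z : holo_at f f' z -> holo_at g g' z ->
  holo_at (fun u => f u + g u)%C (fun u => f' u + g' u)%C z.
Proof.
intros [h1 [l1 k1]] [h2 [l2 k2]]. split. apply is_Cderive_plus; auto.
exists (l1 + l2)%C. apply is_Cderive_plus; auto.
Qed.

Lemma holo_mult (f f' g g' : C -> C) z : holo_at f f' z -> holo_at g g' z ->
  holo_at (fun u => f u * g u)%C (fun u => f' u * g u + f u * g' u)%C z.
Proof.
intros [h1 [l1 k1]] [h2 [l2 k2]]. split. apply is_Cderive_mult; auto.
eexists. apply is_Cderive_plus; apply is_Cderive_mult; eauto.
Qed.

Lemma holo_Cexp (f f' : C -> C) z : holo_at f f' z ->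
  holo_at (fun u => Cexp (f u)) (fun u => f' u * Cexp (f u))%C z.
Proof.
intros [h1 [l1 k1]].
assert (E : is_Cderive (fun u => Cexp (f u)) z (f' z * Cexp (f z))%C).
{ apply is_Cderive_comp; auto. apply is_Cderive_Cexp. }
split; auto. eexists. apply is_Cderive_mult; eauto.
Qed.

Lemma holo_inv (f f' : C -> C) z : holo_at f f' z -> f z <> 0 ->
  holo_at (fun u => / f u)%C (fun u => f' u * - / (f u * f u))%C z.
Proof.
intros [h1 [l1 k1]] h0. split.
- apply (is_Cderive_comp Cinv f). apply is_Cderive_Cinv; auto. auto.
- eexists. apply is_Cderive_mult. eauto.
  apply (is_Cderive_comp (fun v => - / v)%C (fun u => f u * f u)%C).
  2: apply is_Cderive_mult; eauto.
  apply (is_Cderive_comp Copp Cinv).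
  2: apply is_Cderive_Cinv; apply Cmult_neq_0; auto.
  apply is_Cderive_ext_val with (opp (one : C_AbsRing)). 2: reflexivity.
  apply (is_derive_opp (K := C_AbsRing) (V := AbsRing_NormedModule C_AbsRing) (fun u => u)). apply is_Cderive_id.
Qed.

(** The residue of [g / D] at a simple zero of [D] is [g / D'], in the form
    required by [residue_rectangle].  The bound
    [Cmod (D (p + h)) >= Cmod D1 * Cmod h / 2] shows that the zero is isolated. *)
Lemma simple_pole (g D : C -> C) (p g1 D1 : C) : is_Cderive g p g1 -> is_Cderive D p D1 ->
  D p = 0 -> D1 <> 0 ->
  forall eps : posreal, exists del : posreal, forall h : C, h <> 0 -> Cmod h < del ->
     Cmod (h * (g (p + h) * / D (p + h)) - g p / D1)%C <= eps.
Proof.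
intros Hg HD D0 D1n eps. pose proof (cond_pos eps) as heps.
destruct (is_Cderive_lipschitz g p g1 Hg) as [d1 Hd1].
rewrite is_Cderive_eps in HD.
set (m := Cmod D1) in *. assert (hm : 0 < m) by (apply Cmod_gt_0; auto).
set (L := 1 + Cmod g1) in *. assert (hL : 0 < L) by (pose proof (Cmod_ge_0 g1); unfold L; lra).
set (G := 1 + Cmod (g p)). assert (hG : 1 <= G) by (pose proof (Cmod_ge_0 (g p)); unfold G; lra).
set (e := Rmin (m / 2) (eps * m * m / (4 * G))).
assert (he : 0 < e).
{ apply Rmin_glb_lt. lra. apply Rdiv_lt_0_compat. repeat apply Rmult_lt_0_compat; auto. lra. }
assert (he1 : e <= m / 2) by apply Rmin_l.
assert (he2 : e * (4 * G) <= eps * m * m).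
{ apply Rle_div_r. lra. apply Rmin_r. }
clearbody e.
destruct (HD (mkposreal e he)) as [d2 Hd2]; simpl in Hd2.
assert (h4 : 0 < eps * m / (4 * L)) by (apply Rdiv_lt_0_compat; [nra|lra]).
assert (hdel : 0 < Rmin (Rmin d1 d2) (eps * m / (4 * L))).
{ repeat apply Rmin_glb_lt; auto; apply cond_pos. }
exists (mkposreal _ hdel); simpl. intros h h0 hh.
pose proof (Rmin_l (Rmin d1 d2) (eps * m / (4 * L))).
pose proof (Rmin_r (Rmin d1 d2) (eps * m / (4 * L))).
pose proof (Rmin_l d1 d2). pose proof (Rmin_r d1 d2).
specialize (Hd1 h ltac:(lra)). specialize (Hd2 h ltac:(lra)).
assert (kh : 0 < Cmod h) by (apply Cmod_gt_0; auto).
assert (hankel_fun : Cmod h * (4 * L) <= eps * m) by (apply Rle_div_r; lra).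
rewrite D0 in Hd2.
set (Dp := D (p + h)%C) in *.
assert (lowD : m / 2 * Cmod h <= Cmod Dp).
{ assert (m * Cmod h <= Cmod Dp + e * Cmod h).
  { unfold m. rewrite <- Cmod_mult. replace (D1 * h)%C with (Dp + - (Dp - 0 - h * D1))%C by ring.
    eapply Rle_trans. apply Cmod_triangle. rewrite Cmod_opp. lra. }
  nra. }
assert (Dh : Dp <> 0) by (apply Cmod_gt_0; nra).
replace (h * (g (p + h) * / Dp) - g p / D1)%C with
  ((h * D1 * (g (p + h) - g p) - g p * (Dp - 0 - h * D1)) / (D1 * Dp))%C by (field; auto).
rewrite Cmod_div by (apply Cmult_neq_0; auto). rewrite Cmod_mult. fold m.
apply Rle_div_l. apply Rmult_lt_0_compat; auto. apply Cmod_gt_0; auto.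
eapply Rle_trans. apply Cmod_triangle. rewrite Cmod_opp, !Cmod_mult. fold m.
apply Rle_trans with (eps * (m * (m / 2 * Cmod h))).
2: { apply Rmult_le_compat_l. lra. apply Rmult_le_compat_l; lra. }
assert (Cmod h * m * Cmod (g (p + h)%C - g p)%C <= Cmod h * m * (L * Cmod h)) by (apply Rmult_le_compat_l; [nra|lra]).
assert (Cmod (g p) * Cmod (Dp - 0 - h * D1)%C <= G * (e * Cmod h)).
{ apply Rmult_le_compat; try apply Cmod_ge_0; auto. unfold G; lra. }
assert (Cmod h * m * (L * Cmod h) <= eps * m * m * Cmod h / 4).
{ replace (Cmod h * m * (L * Cmod h)) with (m * Cmod h * (Cmod h * (4 * L)) / 4) by field.
  replace (eps * m * m * Cmod h / 4) with (m * Cmod h * (eps * m) / 4) by field.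
  apply Rmult_le_compat_r. lra. apply Rmult_le_compat_l; nra. }
assert (G * (e * Cmod h) <= eps * m * m * Cmod h / 4).
{ replace (G * (e * Cmod h)) with (e * (4 * G) * Cmod h / 4) by field.
  apply Rmult_le_compat_r. lra. apply Rmult_le_compat_r; lra. }
lra.
Qed.

(** * Limits of complex-valued functions *)

(** Convergence measured with [Cmod] rather than componentwise, since all the
    estimates are estimates of moduli. *)
Definition Clim {T : Type} (F : (T -> Prop) -> Prop) (f : T -> C) (l : C) : Prop :=
  forall eps : posreal, F (fun x => Cmod (f x - l)%C < eps).

Lemma Clim_filterlim {T} (F : (T -> Prop) -> Prop) {FF : Filter F} (f : T -> C) (l : C) :
  Clim F f l -> filterlim f F (locally (T := C_R_CompleteNormedModule) l).
Proof.
intros H P [eps HP]. unfold filtermap. generalize (H eps). apply filter_imp. intros x hx.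
apply HP. split; simpl; unfold ball; simpl; unfold AbsRing_ball, abs, minus, plus, opp; simpl.
eapply Rle_lt_trans. exact (Rabs_Re_le_Cmod (f x - l)%C). exact hx.
eapply Rle_lt_trans. exact (Rabs_Im_le_Cmod (f x - l)%C). exact hx.
Qed.

Lemma Clim_unique {T} (F : (T -> Prop) -> Prop) {FF : ProperFilter F} (f : T -> C) (l l' : C) :
  Clim F f l -> Clim F f l' -> l = l'.
Proof.
intros H1 H2. apply Ceq_minus, Cmod_eq_0, Rle_antisym; [|apply Cmod_ge_0].
apply le_epsilon. intros eps he. rewrite Rplus_0_l.
assert (hp : 0 < eps / 2) by lra.
destruct (filter_ex _ (filter_and _ _ (H1 (mkposreal _ hp)) (H2 (mkposreal _ hp)))) as [x [k1 k2]].
simpl in k1, k2. replace (l - l')%C with (- (f x - l) + (f x - l'))%C by ring.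
eapply Rle_trans. apply Cmod_triangle. rewrite Cmod_opp. lra.
Qed.

Lemma Clim_plus {T} (F : (T -> Prop) -> Prop) {FF : Filter F} (f g : T -> C) (l m : C) :
  Clim F f l -> Clim F g m -> Clim F (fun x => f x + g x)%C (l + m)%C.
Proof.
intros H1 H2 eps. assert (hp : 0 < eps / 2) by (pose proof (cond_pos eps); lra).
generalize (filter_and _ _ (H1 (mkposreal _ hp)) (H2 (mkposreal _ hp))).
apply filter_imp. intros x [k1 k2]; simpl in k1, k2.
replace (f x + g x - (l + m))%C with ((f x - l) + (g x - m))%C by ring.
eapply Rle_lt_trans. apply Cmod_triangle. lra.
Qed.

Lemma Clim_const {T} (F : (T -> Prop) -> Prop) {FF : Filter F} (c : C) : Clim F (fun _ => c) c.
Proof.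
intros eps. apply filter_forall. intros _. replace (c - c)%C with (RtoC 0) by ring.
rewrite Cmod_0. apply cond_pos.
Qed.

Lemma Clim_scal {T} (F : (T -> Prop) -> Prop) {FF : Filter F} (c : C) (f : T -> C) (l : C) :
  Clim F f l -> Clim F (fun x => c * f x)%C (c * l)%C.
Proof.
intros H eps. pose proof (cond_pos eps). pose proof (Cmod_ge_0 c).
assert (hp : 0 < eps / (1 + Cmod c)) by (apply Rdiv_lt_0_compat; lra).
generalize (H (mkposreal _ hp)). apply filter_imp. simpl. intros x hx.
replace (c * f x - c * l)%C with (c * (f x - l))%C by ring. rewrite Cmod_mult.
apply Rlt_div_r in hx; [|lra]. pose proof (Cmod_ge_0 (f x - l)%C). nra.
Qed.

Lemma Clim_ext {T} (F : (T -> Prop) -> Prop) {FF : Filter F} (f g : T -> C) (l : C) :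
  F (fun x => f x = g x) -> Clim F f l -> Clim F g l.
Proof.
intros E H eps. generalize (filter_and _ _ E (H eps)). apply filter_imp. intros x [<- k]; exact k.
Qed.

Lemma Clim_0 {T} (F : (T -> Prop) -> Prop) {FF : Filter F} (f : T -> C) (g : T -> R) :
  F (fun x => Cmod (f x) <= g x) -> filterlim g F (locally 0) -> Clim F f 0.
Proof.
intros E H eps. 
assert (K : F (fun x => Rabs (g x) < eps)).
{ apply (H (fun y => Rabs y < eps)). exists eps. intros y hy. 
  replace y with (y - 0) by ring. exact hy. }
generalize (filter_and _ _ E K). apply filter_imp. intros x [k1 k2].
replace (f x - 0)%C with (f x) by ring. eapply Rle_lt_trans. exact k1.
eapply Rle_lt_trans. apply Rle_abs. exact k2.
Qed.

Lemma Clim_comp {T S} (F : (T -> Prop) -> Prop) (G : (S -> Prop) -> Prop) (f : S -> C) (g : T -> S) l :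
  filterlim g F G -> Clim G f l -> Clim F (fun x => f (g x)) l.
Proof. intros H K eps. apply (H _ (K eps)). Qed.

Notation at_minf := (Rbar_locally m_infty).
Notation at_pinf := (Rbar_locally p_infty).
Notation both_ends := (filter_prod at_minf at_pinf).

Lemma Clim_RtoC {T} (F : (T -> Prop) -> Prop) {FF : Filter F} (f : T -> R) (l : R) :
  filterlim f F (locally l) <-> Clim F (fun x => RtoC (f x)) (RtoC l).
Proof.
split.
- intros H eps. 
  assert (K : F (fun x => Rabs (f x - l) < eps)).
  { apply (H (fun y => Rabs (y - l) < eps)). exists eps. intros y hy. exact hy. }
  revert K. apply filter_imp. intros x. rewrite <- RtoC_minus, Cmod_R. auto.
- intros H P [eps HP]. unfold filtermap. generalize (H eps). apply filter_imp. intros x.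
  rewrite <- RtoC_minus, Cmod_R. intros k. apply HP. exact k.
Qed.

(** * Improper integrals of nonnegative functions *)

(** For nonnegative integrands the doubly improper integral is the supremum of
    the proper ones.  Inequalities between such integrals then only involve
    finite intervals, and no interchange of limits arises. *)
Definition is_pos_integral (h : R -> R) (G : R) : Prop :=
  is_lub (fun x => exists A B, A <= B /\ x = RInt h A B) G.

Lemma ex_RInt_cont (h : R -> R) a b : (forall t, continuous h t) -> ex_RInt h a b.
Proof. intros H. apply (ex_RInt_continuous (V := R_CompleteNormedModule)). intros; apply H. Qed.

Lemma RInt_pos_mono (h : R -> R) A A' B B' : (forall t, continuous h t) -> (forall t, 0 <= h t) ->
  A' <= A -> A <= B -> B <= B' -> RInt h A B <= RInt h A' B'.
Proof.
intros hc hp h1 h2 h3.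
rewrite <- (RInt_Chasles (V := R_CompleteNormedModule) h A' A B') by (apply ex_RInt_cont; auto).
rewrite <- (RInt_Chasles (V := R_CompleteNormedModule) h A B B') by (apply ex_RInt_cont; auto).
assert (0 <= RInt h A' A) by (apply RInt_ge_0; auto; apply ex_RInt_cont; auto).
assert (0 <= RInt h B B') by (apply RInt_ge_0; auto; apply ex_RInt_cont; auto).
unfold plus; simpl. lra.
Qed.

Lemma pos_integral_lim (h : R -> R) (G : R) : (forall t, continuous h t) -> (forall t, 0 <= h t) ->
  is_pos_integral h G -> filterlim (fun ab => RInt h (fst ab) (snd ab)) both_ends (locally G).
Proof.
intros hc hp [Hub Hl] P [eps HP]. unfold filtermap. pose proof (cond_pos eps).
assert (hA : exists A B, A <= B /\ G - eps < RInt h A B).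
{ destruct (Classical_Prop.classic (exists A B, A <= B /\ G - eps < RInt h A B)) as [k|k]; auto. 
  assert (G <= G - eps); [|lra]. apply Hl. intros x [A [B [hAB ->]]].
  apply Rnot_lt_le. intros k2. apply k. exists A, B; auto. }
destruct hA as [A [B [hAB k]]].
apply (Filter_prod _ _ _ (fun a => a < A) (fun b => B < b)).
- exists A. auto.
- exists B. auto.
- intros a b ha hb. apply HP. simpl.
  assert (RInt h A B <= RInt h a b) by (apply RInt_pos_mono; auto; lra).
  assert (RInt h a b <= G) by (apply Hub; exists a, b; split; auto; lra).
  change (Rabs (RInt h a b - G) < eps). apply Rabs_def1; lra.
Qed.

Lemma exp_primitive (k c A B : R) : c <> 0 ->
  is_RInt (fun v => k * exp (c * v)) A B (k / c * exp (c * B) - k / c * exp (c * A)).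
Proof.
intros hc.
apply (is_RInt_derive (V := R_CompleteNormedModule) (fun v => k / c * exp (c * v))).
- intros t _. auto_derive. auto. field. auto.
- intros t _. apply (ex_derive_continuous (K := R_AbsRing) (V := R_NormedModule)). auto_derive. auto.
Qed.

Lemma pos_integral_ex (h : R -> R) (k1 c1 k2 c2 : R) :
  (forall t, continuous h t) -> (forall t, 0 <= h t) -> 0 < c1 -> 0 < c2 ->
  (forall t, h t <= k1 * exp (c1 * t)) -> (forall t, h t <= k2 * exp (- c2 * t)) ->
  exists G, is_pos_integral h G.
Proof.
intros hc hp p1 p2 b1 b2.
destruct (completeness (fun x => exists A B, A <= B /\ x = RInt h A B)) as [G HG].
- exists (k1 / c1 + k2 / c2). intros x [A [B [hAB ->]]].
  assert (0 <= k1). { specialize (b1 0). specialize (hp 0). rewrite Rmult_0_r, exp_0 in b1. lra. }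
  assert (0 <= k2). { specialize (b2 0). specialize (hp 0). rewrite Rmult_0_r, exp_0 in b2. lra. }
  pose proof (Rmin_l A 0). pose proof (Rmin_r A 0). pose proof (Rmax_l B 0). pose proof (Rmax_r B 0).
  apply Rle_trans with (RInt h (Rmin A 0) (Rmax B 0)).
  apply RInt_pos_mono; auto.
  rewrite <- (RInt_Chasles (V := R_CompleteNormedModule) h _ 0 _) by (apply ex_RInt_cont; auto).
  unfold plus; simpl. apply Rplus_le_compat.
  + assert (I := exp_primitive k1 c1 (Rmin A 0) 0 ltac:(lra)).
    apply Rle_trans with (k1 / c1 * exp (c1 * 0) - k1 / c1 * exp (c1 * Rmin A 0)).
    * rewrite <- (is_RInt_unique _ _ _ _ I). apply RInt_le; auto. apply ex_RInt_cont; auto. eexists; exact I.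
    * rewrite Rmult_0_r, exp_0. assert (0 <= k1 / c1) by (apply Rdiv_le_0_compat; lra).
      pose proof (exp_pos (c1 * Rmin A 0)). nra.
  + assert (I := exp_primitive k2 (- c2) 0 (Rmax B 0) ltac:(lra)).
    apply Rle_trans with (k2 / - c2 * exp (- c2 * Rmax B 0) - k2 / - c2 * exp (- c2 * 0)).
    * rewrite <- (is_RInt_unique _ _ _ _ I). apply RInt_le; auto. apply ex_RInt_cont; auto. eexists; exact I.
    * rewrite Rmult_0_r, exp_0. assert (0 <= k2 / c2) by (apply Rdiv_le_0_compat; lra).
      replace (k2 / - c2) with (- (k2 / c2)) by (field; lra).
      pose proof (exp_pos (- c2 * Rmax B 0)). nra.
- exists (RInt h 0 0). exists 0, 0. split; [lra|auto].
- exists G. exact HG.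
Qed.

(** * The simple poles of 1 / (1 + exp (- alpha u)) *)

Lemma cos_eq_1 (t : R) : cos t = 1 -> - (2 * PI) < t < 2 * PI -> t = 0.
Proof.
intros h ht.
assert (hs : sin (t / 2) = 0).
{ replace t with (2 * (t / 2)) in h by field. rewrite cos_2a_sin in h. nra. }
destruct (Rtotal_order t 0) as [k|[k|k]]; auto.
- assert (0 < sin (- (t / 2))) by (apply sin_gt_0; lra). rewrite sin_neg in H. lra.
- assert (0 < sin (t / 2)) by (apply sin_gt_0; lra). lra.
Qed.

(** With [s = exp u] this is [(s^alpha + 1) / s^alpha]; the poles of
    [1 / (s^alpha + 1)] are its zeros. *)
Definition pole_den (alpha : R) (u : C) : C := (1 + Cexp (- alpha * u))%C.

Lemma holo_pole_den alpha z :
  holo_at (pole_den alpha) (fun u => 0 + - alpha * Cexp (0 + - alpha * u))%C z.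
Proof.
assert (H := holo_plus _ _ _ _ z (holo_affine 1 0 z) (holo_Cexp _ _ z (holo_affine 0 (- alpha)%C z))).
destruct H as [H1 H2]. split; auto.
revert H1. apply is_derive_ext. intros t. unfold pole_den. 
replace (0 + - alpha * t)%C with (- alpha * t)%C by (simpl; ring). simpl; ring.
Qed.

(** The zeros lie on the imaginary axis with spacing [2 PI / alpha], so [th] is
    the only one at distance less than [2 PI / alpha] from itself. *)
Lemma pole_den_nz (alpha x y th : R) : 0 < alpha -> Cexp (- alpha * (0, th)) = (- (1))%C ->
  - (2 * PI) < alpha * (y - th) < 2 * PI -> (x, y) <> (0, th) -> pole_den alpha (x, y) <> 0.
Proof.
intros ha hth hy hxy E. unfold pole_den in E.
assert (E1 : Cexp (- alpha * (x, y)) = (- (1))%C).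
{ replace (Cexp (- alpha * (x, y)))%C with ((1 + Cexp (- alpha * (x, y))) - 1)%C by ring. rewrite E. ring. }
assert (hx : x = 0).
{ assert (K : Cmod (Cexp (- alpha * (x, y))) = 1) by (rewrite E1, Cmod_opp; apply Cmod_1).
  rewrite Cmod_Cexp in K. simpl in K. rewrite <- exp_0 in K. apply exp_inv in K. nra. }
subst x. apply hxy. f_equal.
replace (- alpha * (0, y))%C with (- alpha * (0, th) + (0, - (alpha * (y - th)))%R)%C in E1
  by (apply injective_projections; simpl; ring).
rewrite Cexp_plus, hth in E1.
assert (K : Cexp (0, - (alpha * (y - th)))%R = 1).
{ replace (Cexp (0, - (alpha * (y - th)))%R) with (- (- (1) * Cexp (0, - (alpha * (y - th)))%R))%C by ring. rewrite E1. ring. }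
apply (f_equal fst) in K. simpl in K. rewrite exp_0, Rmult_1_l, cos_neg in K.
apply cos_eq_1 in K; nra.
Qed.

Lemma pole_den_nz_off_axis (alpha x y : R) : 0 < alpha -> x <> 0 -> pole_den alpha (x, y) <> 0.
Proof.
intros ha hx E. unfold pole_den in E.
assert (E1 : Cexp (- alpha * (x, y)) = (- (1))%C).
{ replace (Cexp (- alpha * (x, y)))%C with ((1 + Cexp (- alpha * (x, y))) - 1)%C by ring. rewrite E. ring. }
assert (K : Cmod (Cexp (- alpha * (x, y))) = 1) by (rewrite E1, Cmod_opp; apply Cmod_1).
rewrite Cmod_Cexp in K. simpl in K. rewrite <- exp_0 in K. apply exp_inv in K. nra.
Qed.

(** At a zero of [pole_den alpha] its derivative is [alpha], whence the factor
    [/ alpha] in the residue. *)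
Lemma rect_int_pole (g g' : C -> C) (alpha A B y1 y2 th : R) :
  (forall z, holo_at g g' z) -> 0 < alpha -> A < 0 < B -> y1 < th < y2 ->
  alpha * (y2 - th) < 2 * PI -> alpha * (th - y1) < 2 * PI ->
  Cexp (- alpha * (0, th)) = (- (1))%C ->
  rect_int (fun u => g u * / pole_den alpha u)%C A B y1 y2 = (2 * PI * Ci * (g (0, th) / alpha))%C.
Proof.
intros Hg ha hAB hy h2 h1 hth.
set (d := Rmin (2 * PI / alpha - (y2 - th)) (2 * PI / alpha - (th - y1))).
assert (hd : 0 < d).
{ assert (y2 - th < 2 * PI / alpha) by (apply Rlt_div_r; lra).
  assert (th - y1 < 2 * PI / alpha) by (apply Rlt_div_r; lra).
  apply Rmin_glb_lt; lra. }
assert (d1 : d <= 2 * PI / alpha - (y2 - th)) by apply Rmin_l.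
assert (d2 : d <= 2 * PI / alpha - (th - y1)) by apply Rmin_r.
clearbody d.
eapply (residue_rectangle _ _ A B y1 y2 d 0 th); auto.
- intros x y hx hyy hn. apply holo_mult. apply Hg. apply holo_inv. apply holo_pole_den.
  apply (pole_den_nz alpha x y th); auto.
  assert (- (2 * PI / alpha) < y - th < 2 * PI / alpha) by lra.
  replace (2 * PI) with (alpha * (2 * PI / alpha)) by (field; lra). nra.
- apply (simple_pole g (pole_den alpha) (0, th) (g' (0, th)) alpha).
  apply Hg. 
  + destruct (holo_pole_den alpha (0, th)) as [H1 _]. 
    replace (0 + - alpha * Cexp (0 + - alpha * (0, th)))%C with (RtoC alpha) in H1. exact H1.
    rewrite !Cplus_0_l. rewrite hth. ring.
  + unfold pole_den. rewrite hth. ring.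
  + intros k. apply RtoC_inj in k. lra.
Qed.

Lemma rect_int_no_pole (g g' : C -> C) (alpha A B y1 y2 : R) :
  (forall z, holo_at g g' z) -> 0 < alpha -> 0 < A <= B -> y1 <= y2 ->
  rect_int (fun u => g u * / pole_den alpha u)%C A B y1 y2 = 0.
Proof.
intros Hg ha hAB hy.
eapply (rect_int_0 _ _ A B y1 y2 A); try lra.
intros x y hx hyy. apply holo_mult. apply Hg. apply holo_inv. apply holo_pole_den.
apply pole_den_nz_off_axis; lra.
Qed.

Lemma pole_den_lower_pos (alpha x y : R) : 1 - exp (- alpha * x) <= Cmod (pole_den alpha (x, y)).
Proof.
unfold pole_den. 
assert (Cmod 1 <= Cmod (1 + Cexp (- alpha * (x, y)))%C + Cmod (Cexp (- alpha * (x, y)))).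
{ replace (RtoC 1) with ((1 + Cexp (- alpha * (x, y))) + - Cexp (- alpha * (x, y)))%C at 1 by ring.
  eapply Rle_trans. apply Cmod_triangle. rewrite Cmod_opp. lra. }
rewrite Cmod_Cexp, Cmod_1 in H. simpl in H. replace (- alpha * x - - 0 * y) with (- alpha * x) in H by ring. lra.
Qed.

Lemma pole_den_lower_neg (alpha x y : R) : exp (- alpha * x) - 1 <= Cmod (pole_den alpha (x, y)).
Proof.
unfold pole_den. 
assert (Cmod (Cexp (- alpha * (x, y))) <= Cmod (1 + Cexp (- alpha * (x, y)))%C + Cmod 1).
{ replace (Cexp (- alpha * (x, y)))%C with ((1 + Cexp (- alpha * (x, y))) + - RtoC 1)%C at 1 by ring.
  eapply Rle_trans. apply Cmod_triangle. rewrite Cmod_opp. lra. }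
rewrite Cmod_Cexp, Cmod_1 in H. simpl in H. replace (- alpha * x - - 0 * y) with (- alpha * x) in H by ring. lra.
Qed.

Lemma lim_exp_pinf (c : R) : 0 < c -> filterlim (fun B => exp (- c * B)) at_pinf (locally 0).
Proof.
intros hc. 
apply (filterlim_comp _ _ _ (fun B => - c * B) exp _ at_minf).
2: exact is_lim_exp_m.
intros P [M HM]. exists (- M / c). intros x hx. apply HM.
apply Rlt_div_l in hx; lra.
Qed.

Lemma lim_exp_minf (c : R) : 0 < c -> filterlim (fun A => exp (c * A)) at_minf (locally 0).
Proof.
intros hc. 
apply (filterlim_comp _ _ _ (fun B => c * B) exp _ at_minf).
2: exact is_lim_exp_m.
intros P [M HM]. exists (M / c). intros x hx. apply HM.
apply Rlt_div_r in hx; lra.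
Qed.

Lemma lim_0_scal {T} (F : (T -> Prop) -> Prop) {FF : Filter F} (k : R) (g : T -> R) :
  filterlim g F (locally 0) -> filterlim (fun x => k * g x) F (locally 0).
Proof.
intros H. replace 0 with (k * 0) by ring.
apply (filterlim_comp _ _ _ g (fun y => k * y) F (locally 0)). exact H.
exact (filterlim_scal_r (V := R_NormedModule) k 0).
Qed.

(** * The Gamma function *)

(** The tangent line of [exp] at the point [m] where [c * exp m = y + 1] bounds
    [c * exp v] from below by a line of slope [y + 1]. *)
Lemma double_exp_bound (y c : R) : -1 < y -> 0 < c ->
  exists K, forall v, exp (y * v - c * exp v) <= K * exp (- v).
Proof.
intros hy hc. set (m := ln ((y + 1) / c)).
assert (hm : c * exp m = y + 1).
{ unfold m. rewrite exp_ln. field; lra. apply Rdiv_lt_0_compat; lra. }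
exists (exp ((y + 1) * (m - 1))). intros v. rewrite <- exp_plus.
assert (h : exp v >= exp m * (1 + (v - m))).
{ replace v with (m + (v - m)) at 1 by ring. rewrite exp_plus.
  apply Rmult_ge_compat_l. left; apply exp_pos. apply Rle_ge. 
  destruct (Req_dec (v - m) 0) as [->|hn]. rewrite exp_0; lra. left; apply exp_ineq1; auto. }
assert (c * exp v >= (y + 1) * (1 + (v - m))).
{ rewrite <- hm, Rmult_assoc. apply Rmult_ge_compat_l; lra. }
destruct (Rle_lt_or_eq_dec (y * v - c * exp v) ((y + 1) * (m - 1) + - v)) as [k| ->]. nra.
left. apply exp_increasing; auto. lra.
Qed.

(** Existence and value of an integral over [(0, +oo)] are both read off after
    the substitution [s = exp (k v)]. *)
Lemma RInt_gen_exp_subst {V : CompleteNormedModule R_AbsRing} (f : R -> V) (k : R) (l : V) :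
  0 < k -> (forall s, 0 < s -> continuous f s) ->
  filterlim (fun ab => RInt (fun v => scal (k * exp (k * v)) (f (exp (k * v)))) (fst ab) (snd ab))
     both_ends (locally l) ->
  RInt_gen f (at_right 0) (Rbar_locally p_infty) = l.
Proof.
intros hankel_fun hc H.
apply is_RInt_gen_unique.
intros P HP. specialize (H P HP). 
destruct H as [Q1 Q2 [M1 h1] [M2 h2] H].
assert (hpos : 0 < exp (k * M1)) by apply exp_pos.
apply (Filter_prod _ _ _ (fun a => 0 < a < exp (k * M1)) (fun b => exp (k * M2) < b)).
- exists (mkposreal _ hpos). intros a ha ha0. 
  apply Rabs_def2 in ha. simpl in ha. unfold minus, plus, opp in ha; simpl in ha. lra.
- exists (exp (k * M2)). auto.
- intros a b ha hb. assert (hb0 : 0 < b) by (pose proof (exp_pos (k * M2)); lra).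
  assert (Ea : exp (k * (ln a / k)) = a).
  { replace (k * (ln a / k)) with (ln a) by (field; lra). apply exp_ln; lra. }
  assert (Eb : exp (k * (ln b / k)) = b).
  { replace (k * (ln b / k)) with (ln b) by (field; lra). apply exp_ln; lra. }
  assert (la : Q1 (ln a / k)).
  { apply h1. apply Rlt_div_l. auto. apply exp_lt_inv. rewrite exp_ln by lra. rewrite Rmult_comm. lra. }
  assert (lb : Q2 (ln b / k)).
  { apply h2. apply Rlt_div_r. auto. apply exp_lt_inv. rewrite exp_ln by lra. rewrite Rmult_comm. lra. }
  specialize (H _ _ la lb). simpl in H.
  exists (RInt f a b). split.
  + apply (RInt_correct f). apply (ex_RInt_continuous f). intros s hs. apply hc.
    pose proof (Rmin_glb_lt a b 0). simpl in *. lra.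
  + rewrite <- Ea, <- Eb.
    rewrite <- (RInt_comp f (fun v => exp (k * v)) (fun v => k * exp (k * v))). exact H.
    * intros v _. apply hc. apply exp_pos.
    * intros v _. split. auto_derive; auto. ring.
      apply (ex_derive_continuous (K := R_AbsRing) (V := R_NormedModule)). auto_derive. auto.
Qed.

(** Euler's integrand [t^(y-1) exp (- t) dt] in the variable [v = ln t]. *)
Definition euler_density (y v : R) : R := exp (y * v - exp v).

Lemma euler_density_cont y v : continuous (euler_density y) v.
Proof. unfold euler_density. apply (ex_derive_continuous (K := R_AbsRing) (V := R_NormedModule)). auto_derive. auto. Qed.

Lemma euler_density_pos y v : 0 <= euler_density y v.
Proof. left. apply exp_pos. Qed.

Lemma euler_density_le_left y v : euler_density y v <= exp (y * v).
Proof. left. apply exp_increasing. pose proof (exp_pos v). lra. Qed.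

Lemma euler_density_le_right y : 0 < y -> exists K, forall v, euler_density y v <= K * exp (-1 * v).
Proof.
intros hy. destruct (double_exp_bound y 1) as [K HK]; try lra. exists K. intros v.
specialize (HK v). unfold euler_density. replace (-1 * v) with (- v) by ring. rewrite Rmult_1_l in HK. exact HK.
Qed.

Lemma Gamma_pos_integral (y : R) : 0 < y -> is_pos_integral (euler_density y) (Gamma y).
Proof.
intros hy. destruct (euler_density_le_right y hy) as [K HK].
destruct (pos_integral_ex (euler_density y) 1 y K 1) as [G HG]; try lra.
- apply euler_density_cont.
- apply euler_density_pos.
- intros t. rewrite Rmult_1_l. apply euler_density_le_left.
- exact HK.
- replace (Gamma y) with G. exact HG.
  symmetry. unfold Gamma.
  apply (RInt_gen_exp_subst (V := R_CompleteNormedModule) _ 1). lra.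
  + intros s hs. apply (ex_derive_continuous (K := R_AbsRing) (V := R_NormedModule)).
    unfold Rpower. auto_derive. auto.
  + apply (filterlim_ext (fun ab => RInt (euler_density y) (fst ab) (snd ab))).
    * intros ab. apply RInt_ext. intros v _. unfold scal; simpl; unfold mult; simpl.
      unfold Rpower, euler_density. rewrite ln_exp, !Rmult_1_l, <- !exp_plus. f_equal. ring.
    * apply pos_integral_lim. apply euler_density_cont. apply euler_density_pos. exact HG.
Qed.

Lemma Gamma_lim (y : R) : 0 < y ->
  filterlim (fun ab => RInt (euler_density y) (fst ab) (snd ab)) both_ends (locally (Gamma y)).
Proof.
intros hy. apply pos_integral_lim. apply euler_density_cont. apply euler_density_pos. apply Gamma_pos_integral; auto.
Qed.

Lemma euler_density_pinf y : 0 < y -> filterlim (euler_density y) at_pinf (locally 0).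
Proof.
intros hy. destruct (euler_density_le_right y hy) as [K HK].
apply (filterlim_le_le (fun _ => 0) (euler_density y) (fun v => K * exp (-1 * v)) 0).
- apply filter_forall. intros v. split. apply euler_density_pos. apply HK.
- apply filterlim_const.
- apply lim_0_scal. typeclasses eauto. exact (lim_exp_pinf 1 Rlt_0_1).
Qed.

Lemma euler_density_minf y : 0 < y -> filterlim (euler_density y) at_minf (locally 0).
Proof.
intros hy.
apply (filterlim_le_le (fun _ => 0) (euler_density y) (fun v => exp (y * v)) 0).
- apply filter_forall. intros v. split. apply euler_density_pos. apply euler_density_le_left.
- apply filterlim_const.
- exact (lim_exp_minf y hy).
Qed.

(** Integrate the derivative [(y - exp v) euler_density y v] of
    [euler_density y]; the boundary terms vanish. *)
Lemma Gamma_recursion (y : R) : 0 < y -> Gamma (y + 1) = y * Gamma y.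
Proof.
intros hy.
assert (I : forall A B, RInt (euler_density (y + 1)) A B = y * RInt (euler_density y) A B - (euler_density y B - euler_density y A)).
{ intros A B.
  assert (I1 : is_RInt (fun v => y * euler_density y v - euler_density (y + 1) v) A B (euler_density y B - euler_density y A)).
  { apply (is_RInt_derive (V := R_CompleteNormedModule) (euler_density y)).
    - intros v _. unfold euler_density. auto_derive. auto. 
      replace ((y + 1) * v - exp v) with (v + (y * v - exp v)) by ring. unfold Rminus. rewrite !exp_plus. ring.
    - intros v _. unfold euler_density. apply (ex_derive_continuous (K := R_AbsRing) (V := R_NormedModule)). auto_derive. auto. }
  assert (I2 := is_RInt_minus (V := R_NormedModule) _ _ _ _ _ _
    (is_RInt_scal (V := R_NormedModule) _ _ _ y _ (RInt_correct (V := R_CompleteNormedModule) (euler_density y) A B (ex_RInt_cont _ A B (euler_density_cont y)))) I1).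
  apply is_RInt_unique. revert I2. 
  apply (is_RInt_ext (V := R_NormedModule)). intros v _. unfold minus, plus, opp, scal; simpl; unfold mult; simpl. ring. }
apply (filterlim_locally_unique (K := R_AbsRing) (V := R_NormedModule) (F := both_ends) (fun ab => RInt (euler_density (y + 1)) (fst ab) (snd ab))).
apply Gamma_lim; lra.
apply (filterlim_ext (fun ab => plus (y * RInt (euler_density y) (fst ab) (snd ab)) (opp (plus (euler_density y (snd ab)) (opp (euler_density y (fst ab))))))).
{ intros ab. rewrite I. reflexivity. }
replace (y * Gamma y) with (plus (y * Gamma y) (opp (plus 0 (opp 0)))).
2: { unfold plus, opp; simpl. ring. }
assert (P : forall (f g : R * R -> R) (a b : R), filterlim f both_ends (locally a) -> filterlim g both_ends (locally b) ->
  filterlim (fun x => plus (f x) (g x)) both_ends (locally (plus a b))).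
{ intros f g a b h1 h2. eapply filterlim_comp_2. exact h1. exact h2. exact (filterlim_plus (K := R_AbsRing) (V := R_NormedModule) a b). }
assert (O : forall (f : R * R -> R) (a : R), filterlim f both_ends (locally a) -> 
  filterlim (fun x => opp (f x)) both_ends (locally (opp a))).
{ intros f a h1. apply (filterlim_comp _ _ _ f opp _ (locally a)). exact h1. exact (filterlim_opp (K := R_AbsRing) (V := R_NormedModule) a). }
apply P. 
- apply (filterlim_comp _ _ _ (fun ab => RInt (euler_density y) (fst ab) (snd ab)) (fun z => y * z) _ (locally (Gamma y))).
  apply Gamma_lim; auto. exact (filterlim_scal_r (V := R_NormedModule) y (Gamma y)).
- apply O. apply P. 
  + apply (filterlim_comp _ _ _ snd (euler_density y) _ at_pinf). apply filterlim_snd. apply euler_density_pinf; auto.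
  + apply O. apply (filterlim_comp _ _ _ fst (euler_density y) _ at_minf). apply filterlim_fst. apply euler_density_minf; auto.
Qed.

Lemma Gamma_1 : Gamma 1 = 1.
Proof.
apply Rle_antisym.
- apply (Gamma_pos_integral 1 Rlt_0_1). intros x [A [B [hAB ->]]].
  assert (I : is_RInt (euler_density 1) A B (- exp (- exp B) - - exp (- exp A))).
  { apply (is_RInt_derive (V := R_CompleteNormedModule) (fun v => - exp (- exp v))).
    - intros v _. unfold euler_density. auto_derive. auto. replace (1 * v - exp v) with (v + - exp v) by ring. rewrite exp_plus. ring.
    - intros v _. apply euler_density_cont. }
  rewrite (is_RInt_unique _ _ _ _ I).
  pose proof (exp_pos (- exp B)). 
  assert (exp (- exp A) < 1). { rewrite <- exp_0. apply exp_increasing. pose proof (exp_pos A). lra. }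
  lra.
- apply le_epsilon. intros eps heps.
  assert (hA := lim_exp_minf 1 Rlt_0_1 (fun y => Rabs y < eps / 2)).
  assert (hB := euler_density_pinf 1 Rlt_0_1 (fun y => Rabs y < eps / 2)).
  assert (hp : 0 < eps / 2) by lra.
  assert (L : locally 0 (fun y => Rabs y < eps / 2)).
  { exists (mkposreal _ hp). intros y hy. replace y with (y - 0) by ring. exact hy. }
  destruct (hA L) as [A hA']. destruct (hB L) as [B hB'].
  specialize (hA' (Rmin (A - 1) 0)). specialize (hB' (Rmax (B + 1) 0)).
  pose proof (Rmin_l (A - 1) 0). pose proof (Rmin_r (A - 1) 0).
  pose proof (Rmax_l (B + 1) 0). pose proof (Rmax_r (B + 1) 0).
  set (a := Rmin (A - 1) 0) in *. set (b := Rmax (B + 1) 0) in *.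
  assert (I : is_RInt (euler_density 1) a b (- exp (- exp b) - - exp (- exp a))).
  { apply (is_RInt_derive (V := R_CompleteNormedModule) (fun v => - exp (- exp v))).
    - intros v _. unfold euler_density. auto_derive. auto. replace (1 * v - exp v) with (v + - exp v) by ring. rewrite exp_plus. ring.
    - intros v _. apply euler_density_cont. }
  assert (RInt (euler_density 1) a b <= Gamma 1).
  { apply (Gamma_pos_integral 1 Rlt_0_1). exists a, b; split; auto. lra. }
  rewrite (is_RInt_unique _ _ _ _ I) in H3.
  specialize (hA' ltac:(lra)). specialize (hB' ltac:(lra)).
  apply Rabs_def2 in hA'. apply Rabs_def2 in hB'. unfold euler_density in hB'. rewrite Rmult_1_l in hA'. rewrite Rmult_1_l in hB'.
  assert (exp (- exp b) <= exp (b - exp b)).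
  { destruct (Req_dec b 0) as [->|]. right; f_equal; ring. left; apply exp_increasing. lra. }
  assert (1 - exp a <= exp (- exp a)).
  { pose proof (exp_pos a). left. replace (1 - exp a) with (1 + - exp a) by ring. apply exp_ineq1. lra. }
  lra.
Qed.

(** * The reflection formula *)

(** The Beta integrand [t^(x-1) / (1 + t) dt] in the variable [v = ln t]. *)
Definition beta_density (x v : R) : R := exp (x * v) / (1 + exp v).

Lemma beta_density_cont x v : continuous (beta_density x) v.
Proof.
unfold beta_density. apply (ex_derive_continuous (K := R_AbsRing) (V := R_NormedModule)). auto_derive.
pose proof (exp_pos v). lra.
Qed.

Lemma beta_density_pos x v : 0 <= beta_density x v.
Proof. unfold beta_density. pose proof (exp_pos v). pose proof (exp_pos (x * v)). apply Rdiv_le_0_compat; lra. Qed.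

Lemma beta_density_integral (x : R) : 0 < x < 1 -> exists b, is_pos_integral (beta_density x) b.
Proof.
intros hx. apply (pos_integral_ex (beta_density x) 1 x 1 (1 - x)); try lra.
- apply beta_density_cont.
- apply beta_density_pos.
- intros t. unfold beta_density. pose proof (exp_pos t). pose proof (exp_pos (x * t)).
  rewrite Rmult_1_l. apply Rle_div_l; nra.
- intros t. unfold beta_density. pose proof (exp_pos t). pose proof (exp_pos (- (1 - x) * t)).
  rewrite Rmult_1_l. apply Rle_div_l. lra.
  replace (x * t) with (- (1 - x) * t + t) by ring. rewrite exp_plus. nra.
Qed.

Lemma vertical_bound (g g' : C -> C) (alpha X y1 y2 M D : R) :
  (forall z, holo_at g g' z) -> 0 < alpha -> X <> 0 -> y1 <= y2 ->
  (forall y, y1 <= y <= y2 -> Cmod (g (X, y)) <= M) ->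
  0 < D -> (forall y, D <= Cmod (pole_den alpha (X, y))) ->
  Cmod (CInt (fun y => g (X, y) * / pole_den alpha (X, y))%C y1 y2) <= M / D * (y2 - y1).
Proof.
intros Hg ha hX hy hM hD hlow.
apply CInt_bound_const; auto.
- apply (ex_CInt_v (fun u => g u * / pole_den alpha u)%C); auto. intros y _.
  destruct (holo_mult _ _ _ _ (X, y) (Hg _) (holo_inv _ _ _ (holo_pole_den alpha (X, y)) (pole_den_nz_off_axis alpha X y ha hX))) as [H _].
  eexists; exact H.
- intros y h. rewrite Cmod_mult, Cmod_inv by (apply pole_den_nz_off_axis; auto).
  apply Rmult_le_compat. apply Cmod_ge_0. left; apply Rinv_0_lt_compat. apply Rlt_le_trans with D; auto.
  auto. apply Rinv_le_contravar; auto.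
Qed.

Lemma exp_ge_2 (t : R) : 1 <= t -> 2 <= exp t.
Proof.
intros ht. left. apply Rle_lt_trans with (1 + t). lra. apply exp_ineq1. lra.
Qed.

(** For [alpha * X >= 1] the denominator has modulus at least [1 / 2]. *)
Lemma vertical_right (g g' : C -> C) (alpha X y1 y2 M : R) :
  (forall z, holo_at g g' z) -> 0 < alpha -> 1 / alpha <= X -> y1 <= y2 ->
  (forall y, y1 <= y <= y2 -> Cmod (g (X, y)) <= M) ->
  Cmod (CInt (fun y => g (X, y) * / pole_den alpha (X, y))%C y1 y2) <= 2 * (y2 - y1) * M.
Proof.
intros Hg ha hX hy hM.
assert (0 < 1 / alpha) by (apply Rdiv_lt_0_compat; lra).
assert (h1 : 1 <= alpha * X) by (apply Rle_div_l in hX; lra).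
replace (2 * (y2 - y1) * M) with (M / (1 / 2) * (y2 - y1)) by field.
eapply vertical_bound; eauto; try lra.
intros y. eapply Rle_trans. 2: apply pole_den_lower_pos.
replace (- alpha * X) with (- (alpha * X)) by ring. rewrite exp_Ropp.
pose proof (exp_ge_2 _ h1). assert (/ exp (alpha * X) <= / 2) by (apply Rinv_le_contravar; lra). lra.
Qed.

(** For [alpha * X <= -1] the denominator has modulus at least
    [exp (- alpha X) / 2], which contributes the decaying factor. *)
Lemma vertical_left (g g' : C -> C) (alpha X y1 y2 M : R) :
  (forall z, holo_at g g' z) -> 0 < alpha -> X <= - (1 / alpha) -> y1 <= y2 ->
  (forall y, y1 <= y <= y2 -> Cmod (g (X, y)) <= M) ->
  Cmod (CInt (fun y => g (X, y) * / pole_den alpha (X, y))%C y1 y2) <= 2 * (y2 - y1) * (M * exp (alpha * X)).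
Proof.
intros Hg ha hX hy hM.
assert (0 < 1 / alpha) by (apply Rdiv_lt_0_compat; lra).
assert (h1 : 1 <= - alpha * X).
{ assert (h : 1 / alpha <= - X) by lra. apply Rle_div_l in h; lra. }
assert (he := exp_pos (- alpha * X)).
replace (2 * (y2 - y1) * (M * exp (alpha * X))) with (M / (exp (- alpha * X) / 2) * (y2 - y1)).
2: { replace (alpha * X) with (- (- alpha * X)) by ring. rewrite exp_Ropp. field. lra. }
eapply vertical_bound; eauto; try lra.
intros y. eapply Rle_trans. 2: apply pole_den_lower_neg.
pose proof (exp_ge_2 _ h1). lra.
Qed.

Lemma both_ends_eventually (a b : R) (P : R * R -> Prop) :
  (forall A B, A < a -> b < B -> P (A, B)) -> both_ends P.
Proof.
intros H. apply (Filter_prod _ _ _ (fun A => A < a) (fun B => b < B)).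
exists a; auto. exists b; auto. auto.
Qed.

(** The integrand on [Im u = 2 PI] is [exp (2 PI i x)] times the one on the
    real axis, and the strip between them contains the pole [i PI] only. *)
Lemma Beta_value (x b : R) : 0 < x < 1 -> is_pos_integral (beta_density x) b -> b * sin (PI * x) = PI.
Proof.
intros hx Hb.
pose proof PI_RGT_0 as hpi.
set (g := fun u : C => Cexp (0 + RtoC (x - 1) * u)).
assert (Hg : forall z, holo_at g (fun u => RtoC (x - 1) * g u)%C z).
{ intros z. apply (holo_Cexp (fun u => 0 + RtoC (x - 1) * u)%C (fun _ => RtoC (x - 1))). apply holo_affine. }
set (E := Cexp (0, (x - 1) * PI)%R).
assert (mg : forall X y, Cmod (g (X, y)) = exp ((x - 1) * X)).
{ intros X y. unfold g. rewrite Cmod_Cexp. f_equal. simpl. ring. }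
set (VB := fun B => CInt (fun y => g (B, y) * / pole_den 1 (B, y))%C 0 (2 * PI)).
set (VA := fun A => CInt (fun y => g (A, y) * / pole_den 1 (A, y))%C 0 (2 * PI)).
assert (LB : Clim at_pinf VB 0).
{ apply (Clim_0 _ _ (fun B => 2 * (2 * PI - 0) * exp (- (1 - x) * B))).
  - exists 1. intros B hB. unfold VB. eapply vertical_right; eauto; try lra.
    intros y _. rewrite mg. right; f_equal; ring.
  - apply lim_0_scal. typeclasses eauto. apply lim_exp_pinf. lra. }
assert (LA : Clim at_minf VA 0).
{ apply (Clim_0 _ _ (fun A => 2 * (2 * PI - 0) * exp (x * A))).
  - exists (-1). intros A hA. unfold VA. 
    replace (exp (x * A)) with (exp ((x - 1) * A) * exp (1 * A)) by (rewrite <- exp_plus; f_equal; ring).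
    eapply vertical_left; eauto; try lra.
    intros y _. rewrite mg. right; f_equal; ring.
  - apply lim_0_scal. typeclasses eauto. apply lim_exp_minf. lra. }
assert (h0 : forall v, (g (v, 0) * / pole_den 1 (v, 0))%C = RtoC (beta_density x v)).
{ intros v. unfold g, pole_den. 
  replace (0 + RtoC (x - 1) * (v, 0))%C with (RtoC ((x - 1) * v)) by (apply injective_projections; simpl; ring).
  replace (- (1) * (v, 0))%C with (RtoC (- v)) by (apply injective_projections; simpl; ring).
  rewrite !Cexp_RtoC, <- RtoC_plus, <- RtoC_inv, <- RtoC_mult. f_equal.
  unfold beta_density. replace (exp (x * v)) with (exp ((x - 1) * v) * exp v) by (rewrite <- exp_plus; f_equal; ring).
  rewrite exp_Ropp. pose proof (exp_pos v). field. lra. 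
  pose proof (exp_pos (- v)). lra. }
assert (h2 : forall v, (g (v, (2 * PI)%R) * / pole_den 1 (v, (2 * PI)%R))%C = (E * E * RtoC (beta_density x v))%C).
{ intros v. rewrite <- h0.
  assert (e1 : pole_den 1 (v, (2 * PI)%R) = pole_den 1 (v, 0)).
  { unfold pole_den. f_equal. unfold Cexp. simpl.
    replace (- (1) * (2 * PI) + - 0 * v) with (- (2 * PI)) by ring.
    replace (- (1) * 0 + - 0 * v) with 0 by ring. rewrite cos_neg, sin_neg, cos_2PI, sin_2PI, cos_0, sin_0.
    f_equal; [do 2 f_equal|]; ring. }
  rewrite e1. unfold g, E. rewrite Cmult_assoc, <- !Cexp_plus. do 2 f_equal.
  apply injective_projections; simpl; ring. }
assert (exr : forall A B, ex_CInt (fun v => RtoC (beta_density x v)) A B).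
{ intros A B. apply ex_CInt_cont. intros t _. apply ccont_pair. split. apply beta_density_cont. apply continuous_const. }
assert (Ir : forall A B, CInt (fun v => RtoC (beta_density x v)) A B = RtoC (RInt (beta_density x) A B)).
{ intros A B. rewrite CInt_pair by auto. apply injective_projections; simpl. reflexivity.
  rewrite RInt_const. apply (Rmult_0_r). }
assert (L1 : Clim both_ends (fun ab => (1 - E * E) * RtoC (RInt (beta_density x) (fst ab) (snd ab)) +
   (Ci * VB (snd ab) + (- Ci) * VA (fst ab)))%C ((1 - E * E) * RtoC b + (Ci * 0 + (- Ci) * 0))%C).
{ apply Clim_plus. typeclasses eauto.
  - apply Clim_scal. typeclasses eauto. apply Clim_RtoC. typeclasses eauto. apply pos_integral_lim; auto.
    apply beta_density_cont. apply beta_density_pos.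
  - apply Clim_plus. typeclasses eauto. 
    + apply Clim_scal. typeclasses eauto. apply (Clim_comp both_ends at_pinf VB snd). apply filterlim_snd. exact LB.
    + apply Clim_scal. typeclasses eauto. apply (Clim_comp both_ends at_minf VA fst). apply filterlim_fst. exact LA. }
assert (L2 : Clim both_ends (fun ab => (1 - E * E) * RtoC (RInt (beta_density x) (fst ab) (snd ab)) +
   (Ci * VB (snd ab) + (- Ci) * VA (fst ab)))%C (2 * PI * Ci * (g (0, PI) / RtoC 1))%C).
{ apply (Clim_ext _ (fun _ => 2 * PI * Ci * (g (0, PI) / RtoC 1))%C). 2: apply Clim_const; typeclasses eauto.
  apply (both_ends_eventually 0 0). intros A B hA hB. simpl.
  rewrite <- (rect_int_pole g (fun u => RtoC (x - 1) * g u)%C 1 A B 0 (2 * PI) PI); auto; try lra.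
  - unfold rect_int. fold (VB B). fold (VA A).
    rewrite (CInt_ext _ _ A B h0), (CInt_ext _ _ A B h2).
    rewrite CInt_Cmult by auto. rewrite Ir. ring.
  - apply injective_projections; simpl.
    replace (- (1) * 0 - - 0 * PI) with 0 by ring. replace (- (1) * PI + - 0 * 0) with (- PI) by ring.
    rewrite exp_0, cos_neg, cos_PI. ring.
    replace (- (1) * 0 - - 0 * PI) with 0 by ring. replace (- (1) * PI + - 0 * 0) with (- PI) by ring.
    rewrite exp_0, sin_neg, sin_PI. ring. }
assert (K := Clim_unique _ _ _ _ L1 L2).
assert (gE : g (0, PI) = E).
{ unfold g, E. f_equal. apply injective_projections; simpl; ring. }
rewrite gE in K.
assert (En : E <> 0) by apply Cexp_nz.
assert (K2 : ((/ E - E) * RtoC b = 2 * PI * Ci)%C).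
{ replace ((/ E - E) * RtoC b)%C with (((1 - E * E) * RtoC b + (Ci * 0 + - Ci * 0)) / E)%C by (field; auto).
  rewrite K. field. auto. }
assert (iE : (/ E)%C = Cexp (0, - ((x - 1) * PI))%R).
{ unfold E. rewrite <- Cexp_opp. f_equal. apply injective_projections; simpl; ring. }
rewrite iE in K2. apply (f_equal snd) in K2. unfold E in K2. simpl in K2.
rewrite exp_0, sin_neg, cos_neg in K2.
replace (sin ((x - 1) * PI)) with (- sin (PI * x)) in K2.
2: { replace ((x - 1) * PI) with (- (PI - PI * x)) by ring. rewrite sin_neg, sin_PI_x. reflexivity. }
ring_simplify in K2. lra.
Qed.

Lemma RInt_Rmult (k : R) (h : R -> R) a b : ex_RInt h a b ->
  k * RInt h a b = RInt (fun t => k * h t) a b.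
Proof. intros H. symmetry. exact (RInt_scal (V := R_CompleteNormedModule) h a b k H). Qed.

(** Interpolates between [beta_density x] at [mu = -oo] and [0] at
    [mu = +oo].  With [lambda = exp mu] the damping is [exp (- lambda (1 + t))],
    whose derivative in [lambda] cancels the denominator [1 + t]. *)
Definition damped (x v mu : R) : R := beta_density x v * exp (- exp mu * (1 + exp v)).

Lemma RInt_euler_derive y a v : is_derive (fun v => RInt (euler_density y) a v) v (euler_density y v).
Proof.
apply (is_derive_RInt (V := R_NormedModule) (euler_density y) (fun v => RInt (euler_density y) a v) a v).
- apply filter_forall. intros t. apply (RInt_correct (V := R_CompleteNormedModule)). apply ex_RInt_cont, euler_density_cont.
- apply euler_density_cont.
Qed.

Lemma RInt_euler_shift y A B c : RInt (euler_density y) (A + c) (B + c) = RInt (euler_density y) 0 (B + c) - RInt (euler_density y) 0 (A + c).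
Proof.
assert (E : RInt (euler_density y) 0 (A + c) + RInt (euler_density y) (A + c) (B + c) = RInt (euler_density y) 0 (B + c)).
{ apply (RInt_Chasles (V := R_CompleteNormedModule)); apply ex_RInt_cont, euler_density_cont. }
lra.
Qed.

(** Integrating the derivative in [mu] turns the Beta integrand into a product
    of two Euler integrands, over the truncation
    [A + mu <= ln t' <= B + mu], [M <= mu <= N] of the plane.  It is an instance
    of Green's formula, with the inner integral as a primitive. *)
Lemma damped_identity (x A B M N : R) : A <= B -> M <= N ->
  RInt (fun v => damped x v M) A B - RInt (fun v => damped x v N) A B =
  RInt (fun mu => euler_density (1 - x) mu * RInt (euler_density x) (A + mu) (B + mu)) M N.
Proof.
intros hAB hMN.
assert (dQ : forall v mu, is_derive (fun t => - (euler_density (1 - x) mu * RInt (euler_density x) 0 (t + mu))) v (- (euler_density (1 - x) mu * euler_density x (v + mu)))).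
{ intros v mu.
  apply (is_derive_opp (K := R_AbsRing) (V := R_NormedModule) (fun t => euler_density (1 - x) mu * RInt (euler_density x) 0 (t + mu))).
  apply is_derive_scal.
  replace (euler_density x (v + mu)) with (scal (1:R) (euler_density x (v + mu))) by exact (Rmult_1_l _).
  apply (is_derive_comp (K := R_AbsRing) (V := R_NormedModule) (fun s => RInt (euler_density x) 0 s) (fun t => t + mu)).
  apply RInt_euler_derive. auto_derive; auto. }
assert (cQ : forall v mu, continuous (fun t => euler_density (1 - x) t * RInt (euler_density x) 0 (v + t)) mu).
{ intros v mu. apply (continuous_mult (K := R_AbsRing) (euler_density (1 - x)) (fun t => RInt (euler_density x) 0 (v + t))).
  apply euler_density_cont.
  apply (continuous_comp (U := R_UniformSpace) (fun t => v + t) (fun s => RInt (euler_density x) 0 s)).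
  - apply (ex_derive_continuous (K := R_AbsRing) (V := R_NormedModule)). auto_derive; auto.
  - apply (ex_derive_continuous (K := R_AbsRing) (V := R_NormedModule) (fun s => RInt (euler_density x) 0 s)).
    eexists. apply RInt_euler_derive. }
assert (G := Green_rectangle (fun v mu => damped x v mu) (fun v mu => - (euler_density (1 - x) mu * RInt (euler_density x) 0 (v + mu)))
  (fun v mu => - (euler_density (1 - x) mu * euler_density x (v + mu))) A B M N 1 hAB hMN Rlt_0_1).
rewrite <- (Ropp_involutive (RInt (fun v => damped x v M) A B - _)), Ropp_minus_distr, G.
- assert (ex : forall v, ex_RInt (fun mu => euler_density (1 - x) mu * RInt (euler_density x) 0 (v + mu)) M N).
  { intros v. apply ex_RInt_cont. apply cQ. }
  rewrite (RInt_opp (V := R_CompleteNormedModule) (fun y => euler_density (1 - x) y * RInt (euler_density x) 0 (B + y))) by apply ex.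
  rewrite (RInt_opp (V := R_CompleteNormedModule) (fun y => euler_density (1 - x) y * RInt (euler_density x) 0 (A + y))) by apply ex.
  transitivity (minus (RInt (fun mu => euler_density (1 - x) mu * RInt (euler_density x) 0 (B + mu)) M N) (RInt (fun mu => euler_density (1 - x) mu * RInt (euler_density x) 0 (A + mu)) M N)).
  unfold minus, plus, opp; simpl. ring.
  rewrite <- (RInt_minus (V := R_CompleteNormedModule)) by apply ex.
  apply RInt_ext. intros mu _. rewrite RInt_euler_shift. unfold minus, plus, opp; simpl. ring.
- intros v mu _ _. split; [|split; [|split; [|split]]].
  + unfold damped, beta_density, euler_density. auto_derive. auto. 
    pose proof (exp_pos v). 
    replace ((1 - x) * mu - exp mu) with (mu + (- (x * mu) + - exp mu)) by ring.
    replace (x * (v + mu) - exp (v + mu)) with (x * v + (x * mu + - (exp v * exp mu))).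
    2: { rewrite exp_plus. ring. }
    replace (- exp mu * (1 + exp v)) with (- exp mu + - (exp v * exp mu)) by ring.
    rewrite !exp_plus. rewrite (exp_Ropp (x * mu)). pose proof (exp_pos (x * mu)). field. lra.
  + apply dQ.
  + unfold damped. apply (continuous_mult (K := R_AbsRing)). apply beta_density_cont.
    apply (ex_derive_continuous (K := R_AbsRing) (V := R_NormedModule)). auto_derive; auto.
  + apply (continuous_opp (V := R_NormedModule)). apply cQ.
  + apply continuity_2d_pt_opp. apply continuity_2d_pt_mult.
    * apply (continuity_1d_2d_pt_comp (euler_density (1 - x)) (fun _ m => m)).
      apply continuity_pt_filterlim, euler_density_cont. apply continuity_2d_pt_id2.
    * apply (continuity_1d_2d_pt_comp (euler_density x) (fun u m => u + m)).
      apply continuity_pt_filterlim, euler_density_cont. apply continuity_2d_pt_plus. apply continuity_2d_pt_id1. apply continuity_2d_pt_id2.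
Qed.

Lemma damped_cont x mu v : continuous (fun v => damped x v mu) v.
Proof.
unfold damped. apply (continuous_mult (K := R_AbsRing)). apply beta_density_cont.
apply (ex_derive_continuous (K := R_AbsRing) (V := R_NormedModule)). auto_derive; auto.
Qed.

Lemma damped_pos x v mu : 0 <= damped x v mu.
Proof. unfold damped. apply Rmult_le_pos. apply beta_density_pos. left; apply exp_pos. Qed.

Lemma euler_convolution_cont x A B mu : continuous (fun mu => euler_density (1 - x) mu * RInt (euler_density x) (A + mu) (B + mu)) mu.
Proof.
apply (continuous_mult (K := R_AbsRing)). apply euler_density_cont.
apply (continuous_ext (fun m => RInt (euler_density x) 0 (B + m) - RInt (euler_density x) 0 (A + m))).
intros m. symmetry. apply RInt_euler_shift.
apply (continuous_minus (V := R_NormedModule) (fun m => RInt (euler_density x) 0 (B + m)) (fun m => RInt (euler_density x) 0 (A + m)));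
 (apply (continuous_comp (U := R_UniformSpace) (fun t => _ + t) (fun s => RInt (euler_density x) 0 s));
  [ apply (ex_derive_continuous (K := R_AbsRing) (V := R_NormedModule)); auto_derive; auto
  | apply (ex_derive_continuous (K := R_AbsRing) (V := R_NormedModule) (fun s => RInt (euler_density x) 0 s));
    eexists; apply RInt_euler_derive ]).
Qed.

Lemma Gamma_pos y : 0 < y -> 0 < Gamma y.
Proof.
intros hy. apply Rlt_le_trans with (RInt (euler_density y) 0 1).
apply RInt_gt_0. lra. intros; apply exp_pos. intros; apply euler_density_cont.
apply (Gamma_pos_integral y hy). exists 0, 1; split; auto; lra.
Qed.

(** Every box [A, B] x [M, N] is contained in a sheared domain of
    [damped_identity], provided that its interval is widened to
    [A - N, B - M]. *)
Lemma Gamma_Beta_le (x b : R) : 0 < x < 1 -> is_pos_integral (beta_density x) b -> Gamma x * Gamma (1 - x) <= b.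
Proof.
intros hx Hb.
assert (gx := Gamma_pos x ltac:(lra)).
assert (K : forall A B M N, A <= B -> M <= N -> RInt (euler_density x) A B * RInt (euler_density (1 - x)) M N <= b).
{ intros A B M N hAB hMN.
  apply Rle_trans with (RInt (fun mu => euler_density (1 - x) mu * RInt (euler_density x) ((A - N) + mu) ((B - M) + mu)) M N).
  - rewrite (RInt_Rmult (RInt (euler_density x) A B) (euler_density (1 - x)) M N) by (apply ex_RInt_cont, euler_density_cont).
    apply RInt_le; auto.
    + apply (ex_RInt_scal (V := R_NormedModule)). apply ex_RInt_cont, euler_density_cont.
    + apply ex_RInt_cont, euler_convolution_cont.
    + intros mu hmu. rewrite Rmult_comm. 
      apply Rmult_le_compat_l. apply euler_density_pos. apply RInt_pos_mono; try lra. apply euler_density_cont. apply euler_density_pos.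
  - rewrite <- damped_identity by lra.
    apply Rle_trans with (RInt (beta_density x) (A - N) (B - M)).
    + assert (0 <= RInt (fun v => damped x v N) (A - N) (B - M)).
      { apply RInt_ge_0. lra. apply ex_RInt_cont, damped_cont. intros; apply damped_pos. }
      assert (RInt (fun v => damped x v M) (A - N) (B - M) <= RInt (beta_density x) (A - N) (B - M)).
      { apply RInt_le. lra. apply ex_RInt_cont, damped_cont. apply ex_RInt_cont, beta_density_cont.
        intros v _. unfold damped. rewrite <- (Rmult_1_r (beta_density x v)) at 2. 
        apply Rmult_le_compat_l. apply beta_density_pos. apply Rle_trans with (exp 0); [left; apply exp_increasing | rewrite exp_0; lra].
        pose proof (exp_pos M). pose proof (exp_pos v). nra. }
      lra.
    + apply Hb. exists (A - N), (B - M). split; [lra|reflexivity]. }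
rewrite Rmult_comm. apply Rle_div_r; auto.
apply (Gamma_pos_integral (1 - x)). lra. intros s [M [N [hMN ->]]].
apply Rle_div_r; auto.
set (S := RInt (euler_density (1 - x)) M N) in *.
assert (hb : 0 <= b).
{ apply Rle_trans with (RInt (beta_density x) 0 1). apply RInt_ge_0. lra. apply ex_RInt_cont, beta_density_cont. intros; apply beta_density_pos.
  apply Hb. exists 0, 1; split; auto; lra. }
assert (hS : 0 <= S).
{ apply RInt_ge_0; auto. apply ex_RInt_cont, euler_density_cont. intros; apply euler_density_pos. }
destruct hS as [hS|<-]; [|lra].
rewrite Rmult_comm. apply Rle_div_r; auto.
apply (Gamma_pos_integral x). lra. intros s [A [B [hAB ->]]].
apply Rle_div_r; auto. apply K; auto.
Qed.

(** The sheared domains have mass at most [Gamma x * Gamma (1 - x)], while the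
    damping can be made negligible at [M] and total at [N] on [A, B]. *)
Lemma Gamma_Beta_ge (x b : R) : 0 < x < 1 -> is_pos_integral (beta_density x) b -> b <= Gamma x * Gamma (1 - x).
Proof.
intros hx Hb.
assert (gx := Gamma_pos x ltac:(lra)). assert (gy := Gamma_pos (1 - x) ltac:(lra)).
apply Hb. intros s [A [B [hAB ->]]]. set (I := RInt (beta_density x) A B).
assert (hI : 0 <= I).
{ apply RInt_ge_0; auto. apply ex_RInt_cont, beta_density_cont. intros; apply beta_density_pos. }
apply le_epsilon. intros eps heps.
(* [1 - d] and [d] will be the relative losses at the two ends [M] and [N] *)
set (d := eps / (2 * (I + 1))).
assert (hd : 0 < d) by (apply Rdiv_lt_0_compat; lra).
assert (dI : 2 * d * I <= eps).
{ unfold d. replace (2 * (eps / (2 * (I + 1))) * I) with (eps * (I / (I + 1))) by (field; lra).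
  assert (I / (I + 1) <= 1) by (apply Rle_div_l; lra). nra. }
clearbody d.
set (M := ln (d / (1 + exp B))). pose proof (exp_pos B).
assert (hM : exp M * (1 + exp B) = d).
{ unfold M. rewrite exp_ln. field; lra. apply Rdiv_lt_0_compat; lra. }
set (N := Rmax M (- ln d)).
assert (hMN : M <= N) by apply Rmax_l.
assert (hN : exp (- exp N) <= d).
{ apply Rle_trans with (exp (- N)).
  left. apply exp_increasing. assert (N < exp N). { pose proof (exp_ineq1_le N). lra. } lra.
  rewrite <- (exp_ln d) by auto. assert (- ln d <= N) by apply Rmax_r. 
  destruct (Req_dec (- N) (ln d)) as [->|]. lra. left; apply exp_increasing; lra. }
assert (up : RInt (fun v => damped x v M) A B - RInt (fun v => damped x v N) A B <= Gamma x * Gamma (1 - x)).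
{ rewrite damped_identity by lra.
  apply Rle_trans with (Gamma x * RInt (euler_density (1 - x)) M N).
  - rewrite (RInt_Rmult (Gamma x) (euler_density (1 - x)) M N) by (apply ex_RInt_cont, euler_density_cont).
    apply RInt_le; auto.
    + apply ex_RInt_cont, euler_convolution_cont.
    + apply (ex_RInt_scal (V := R_NormedModule)). apply ex_RInt_cont, euler_density_cont.
    + intros mu hmu. rewrite (Rmult_comm (Gamma x)).
      apply Rmult_le_compat_l. apply euler_density_pos. apply (Gamma_pos_integral x). lra. exists (A + mu), (B + mu); split; auto; lra.
  - apply Rmult_le_compat_l. lra. apply (Gamma_pos_integral (1 - x)). lra. exists M, N; split; auto. }
assert (lowM : (1 - d) * I <= RInt (fun v => damped x v M) A B).
{ unfold I. rewrite (RInt_Rmult (1 - d) (beta_density x) A B) by (apply ex_RInt_cont, beta_density_cont).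
  apply RInt_le; auto. apply (ex_RInt_scal (V := R_NormedModule)). apply ex_RInt_cont, beta_density_cont. apply ex_RInt_cont, damped_cont.
  intros v hv. unfold damped. rewrite Rmult_comm.
  apply Rmult_le_compat_l. apply beta_density_pos.
  apply Rle_trans with (1 + (- exp M * (1 + exp v))). 2: apply exp_ineq1_le.
  assert (exp v <= exp B) by (left; apply exp_increasing; lra). pose proof (exp_pos M). nra. }
assert (upN : RInt (fun v => damped x v N) A B <= d * I).
{ unfold I. rewrite (RInt_Rmult d (beta_density x) A B) by (apply ex_RInt_cont, beta_density_cont).
  apply RInt_le; auto. apply ex_RInt_cont, damped_cont. apply (ex_RInt_scal (V := R_NormedModule)). apply ex_RInt_cont, beta_density_cont. 
  intros v hv. unfold damped. rewrite Rmult_comm.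
  apply Rmult_le_compat_r. apply beta_density_pos.
  apply Rle_trans with (exp (- exp N)); auto. left. apply exp_increasing.
  pose proof (exp_pos v). pose proof (exp_pos N). nra. }
lra.
Qed.

Lemma Gamma_reflection (x : R) : 0 < x < 1 -> Gamma x * Gamma (1 - x) * sin (PI * x) = PI.
Proof.
intros hx. destruct (beta_density_integral x hx) as [b Hb].
replace (Gamma x * Gamma (1 - x)) with b. apply Beta_value; auto.
apply Rle_antisym. apply Gamma_Beta_ge; auto. apply Gamma_Beta_le; auto.
Qed.

(** * Hankel's formula *)

Lemma holo_ext (f g f' g' : C -> C) z : (forall u, f u = g u) -> (forall u, f' u = g' u) ->
  holo_at f f' z -> holo_at g g' z.
Proof.
intros h1 h2 [k1 [l k2]]. split.
- rewrite <- h2. revert k1. apply is_derive_ext. exact h1.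
- exists l. revert k2. apply is_derive_ext. exact h2.
Qed.

(** For entire functions the two heights may come in any order. *)
Lemma rectangle_Cauchy_entire (f f' : C -> C) (A B y1 y2 : R) :
  (forall z, holo_at f f' z) -> A <= B ->
  (CInt (fun x => f (x, y2)) A B - CInt (fun x => f (x, y1)) A B)%C =
  (Ci * (CInt (fun y => f (B, y)) y1 y2 - CInt (fun y => f (A, y)) y1 y2))%C.
Proof.
intros H hAB. destruct (Rle_dec y1 y2) as [h|h].
- apply (rectangle_Cauchy f f' A B y1 y2 1); auto. lra. intros; apply H.
- assert (E := rectangle_Cauchy f f' A B y2 y1 1 hAB ltac:(lra) Rlt_0_1 (fun x y _ _ => H (x, y))).
  rewrite (CInt_swap (fun y => f (B, y)) y2 y1), (CInt_swap (fun y => f (A, y)) y2 y1).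
  replace (CInt (fun x => f (x, y2)) A B - CInt (fun x => f (x, y1)) A B)%C with
    (- (CInt (fun x => f (x, y1)) A B - CInt (fun x => f (x, y2)) A B))%C by ring.
  rewrite E. ring.
  apply ex_CInt_v. lra. intros; eexists; apply H.
  apply ex_CInt_v. lra. intros; eexists; apply H.
Qed.

Lemma vertical_FTC (f f' : C -> C) (x y1 y2 : R) : (forall z, holo_at f f' z) ->
  is_CInt (fun y => Ci * f' (x, y))%C y1 y2 (f (x, y2) - f (x, y1))%C.
Proof.
intros H. apply is_CInt_pair. 
assert (c : forall y, ccont (fun t => f' (x, t)) y).
{ intros y. destruct (H (x, y)) as [_ [l hl]]. apply (Cderive_ccont f' x y l hl). }
split.
- apply (is_RInt_ext (V := R_NormedModule) (fun y => - Im (f' (x, y)))).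
  { intros y _. unfold Im; simpl. ring. }
  apply (is_RInt_derive (V := R_CompleteNormedModule) (fun y => Re (f (x, y)))).
  + intros y _. apply is_Cderive_vertical. apply H.
  + intros y _. apply (continuous_opp (V := R_NormedModule)). apply (proj1 (ccont_pair _ _) (c y)).
- apply (is_RInt_ext (V := R_NormedModule) (fun y => Re (f' (x, y)))).
  { intros y _. unfold Re; simpl. ring. }
  apply (is_RInt_derive (V := R_CompleteNormedModule) (fun y => Im (f (x, y)))).
  + intros y _. apply is_Cderive_vertical. apply H.
  + intros y _. apply (proj1 (ccont_pair _ _) (c y)).
Qed.

Lemma CInt_bound_abs (f : R -> C) (M : R) a b : (forall t, ccont f t) ->
  (forall t, Rmin a b <= t <= Rmax a b -> Cmod (f t) <= M) -> Cmod (CInt f a b) <= M * Rabs (b - a).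
Proof.
intros Hc H. assert (ex : forall a b, ex_CInt f a b) by (intros; apply ex_CInt_cont; auto).
destruct (Rle_dec a b) as [h|h].
- rewrite Rmin_left, Rmax_right in H by auto. rewrite Rabs_pos_eq by lra. apply CInt_bound_const; auto.
- rewrite Rmin_right, Rmax_left in H by lra. rewrite (CInt_swap f b a) by auto. rewrite Cmod_opp.
  rewrite Rabs_minus_sym, Rabs_pos_eq by lra. apply CInt_bound_const; auto. lra.
Qed.

(** With [s = exp u] and [w = exp lam], the form [exp (w s) s^(k-1) ds] of the
    Hankel integrand for [1 / Gamma (1 - k)]. *)
Definition hankel_fun (lam : C) (k : R) (u : C) : C := Cexp (Cexp (lam + u) + RtoC k * u).
(** The entire extension of [euler_density k]. *)
Definition euler_fun (k : R) (u : C) : C := Cexp (RtoC k * u - Cexp u).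

Lemma holo_hankel_fun lam k z : holo_at (hankel_fun lam k) (fun u => (Cexp (lam + u) + RtoC k) * hankel_fun lam k u)%C z.
Proof.
apply (holo_ext (fun u => Cexp (Cexp (lam + 1 * u) + (0 + RtoC k * u))) _
  (fun u => (1 * Cexp (lam + 1 * u) + RtoC k) * Cexp (Cexp (lam + 1 * u) + (0 + RtoC k * u)))%C).
- intros u. unfold hankel_fun. rewrite Cmult_1_l, Cplus_0_l. reflexivity.
- intros u. unfold hankel_fun. rewrite !Cmult_1_l, Cplus_0_l. reflexivity.
- apply (holo_Cexp (fun u => Cexp (lam + 1 * u) + (0 + RtoC k * u))%C (fun u => 1 * Cexp (lam + 1 * u) + RtoC k)%C).
  apply holo_plus.
  + apply (holo_Cexp (fun u => lam + 1 * u)%C (fun _ => RtoC 1)). apply holo_affine.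
  + apply holo_affine.
Qed.

Lemma holo_euler_fun k z : holo_at (euler_fun k) (fun u => (RtoC k + - (1) * Cexp u) * euler_fun k u)%C z.
Proof.
assert (h1 : holo_at (fun u => Cexp u) (fun u => Cexp u) z).
{ apply (holo_ext (fun u => Cexp (0 + 1 * u)) _ (fun u => 1 * Cexp (0 + 1 * u))%C).
  intros u; rewrite Cmult_1_l, Cplus_0_l; auto. intros u; rewrite !Cmult_1_l, Cplus_0_l; auto.
  apply (holo_Cexp (fun u => 0 + 1 * u)%C (fun _ => RtoC 1)). apply holo_affine. }
assert (h2 := holo_mult _ _ _ _ z (holo_affine (- (1)) 0 z) h1).
assert (h3 := holo_Cexp _ _ z (holo_plus _ _ _ _ z (holo_affine 0 (RtoC k) z) h2)).
revert h3. apply holo_ext.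
- intros u. unfold euler_fun. f_equal. ring.
- intros u. unfold euler_fun. replace (0 + RtoC k * u + (- (1) + 0 * u) * Cexp u)%C with (RtoC k * u - Cexp u)%C by ring. ring.
Qed.

Lemma Cexp_iPI_shift (u : C) (s : R) : s = PI \/ s = - PI -> Cexp (u + (0, s)) = (- Cexp u)%C.
Proof.
intros hs. rewrite Cexp_plus. replace (Cexp (0, s)) with (- (1))%C. ring.
destruct hs as [-> | ->]; unfold Cexp; simpl; apply injective_projections; simpl;
 rewrite exp_0, ?cos_neg, ?sin_neg, ?cos_PI, ?sin_PI; ring.
Qed.

(** On both sides of the cut the Hankel integrand is the same Euler integrand
    up to a constant phase, because [exp (+- i PI) = -1]. *)
Lemma hankel_fun_horizontal lam k v s : s = PI \/ s = - PI ->
  hankel_fun lam k (v, s) = (Cexp (RtoC k * ((0, s) - lam)) * euler_fun k (lam + RtoC v))%C.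
Proof.
intros hs. unfold hankel_fun, euler_fun. rewrite <- Cexp_plus. f_equal.
replace (lam + (v, s))%C with (lam + RtoC v + (0, s))%C by (apply injective_projections; simpl; ring).
rewrite Cexp_iPI_shift by auto.
replace (RtoC k * (v, s))%C with (RtoC k * (0, s) + RtoC k * RtoC v)%C by (apply injective_projections; simpl; ring).
ring.
Qed.

Lemma Cmod_euler_fun k u : Cmod (euler_fun k u) = exp (k * Re u - exp (Re u) * cos (Im u)).
Proof. unfold euler_fun. rewrite Cmod_Cexp. f_equal. unfold Cexp, Re, Im. simpl. ring. Qed.

Lemma Cmod_hankel_fun_le lam k X y : X <= 0 -> Cmod (hankel_fun lam k (X, y)) <= exp (exp (Re lam)) * exp (k * X).
Proof.
intros hX. unfold hankel_fun. rewrite Cmod_Cexp, <- exp_plus.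
assert (E : Re (Cexp (lam + (X, y)) + RtoC k * (X, y))%C = exp (Re lam + X) * cos (Im lam + y) + k * X).
{ unfold Cexp, Re, Im; simpl. ring. }
rewrite E.
assert (exp (Re lam + X) <= exp (Re lam)).
{ destruct (Req_dec X 0) as [->|]. rewrite Rplus_0_r; lra. left; apply exp_increasing; lra. }
pose proof (exp_pos (Re lam + X)). pose proof (COS_bound (Im lam + y)).
assert (k2 : exp (Re lam + X) * cos (Im lam + y) + k * X <= exp (Re lam) + k * X) by nra.
destruct k2 as [k2| ->]; [left; apply exp_increasing; auto| lra].
Qed.

Lemma double_exp_lim (k c : R) : 0 < c -> filterlim (fun B => exp (k * B - c * exp B)) at_pinf (locally 0).
Proof.
intros hc. pose proof (Rabs_pos k).
destruct (double_exp_bound (Rabs k) c) as [K HK]; try lra.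
apply (filterlim_le_le (fun _ => 0) _ (fun v => K * exp (-1 * v)) 0).
- exists 0. intros v hv. split. left; apply exp_pos.
  replace (-1 * v) with (- v) by ring. eapply Rle_trans. 2: apply HK.
  pose proof (Rle_abs k). assert (k2 : k * v - c * exp v <= Rabs k * v - c * exp v) by nra.
  destruct k2 as [k2| ->]; [left; apply exp_increasing; auto| lra].
- apply filterlim_const.
- apply lim_0_scal. typeclasses eauto. exact (lim_exp_pinf 1 Rlt_0_1).
Qed.

Lemma cos_mono_abs a b : Rabs a <= Rabs b -> Rabs b < PI / 2 -> cos b <= cos a.
Proof.
intros h1 h2. assert (E : forall t, cos t = cos (Rabs t)).
{ intros t. unfold Rabs. destruct (Rcase_abs t); auto. rewrite cos_neg; auto. }
rewrite (E a), (E b). pose proof (Rabs_pos a). pose proof PI_RGT_0. apply cos_decr_1; lra.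
Qed.

Lemma filterlim_shift_ends m : filterlim (fun ab : R * R => (fst ab + m, snd ab + m)) both_ends both_ends.
Proof.
intros P [Q1 Q2 [M1 h1] [M2 h2] H]. 
apply (both_ends_eventually (M1 - m) (M2 - m)). intros A B hA hB. apply H; simpl.
apply h1; lra. apply h2; lra.
Qed.

(** Rotating the ray of integration in Euler's integral: the line
    [Im u = Im lam] is moved to the real axis, where only the two vertical sides
    intervene.  Since [|Im lam| < PI / 2], the right one is killed by the double
    exponential, and the left one by [exp (y X)]. *)
Lemma rotated_Gamma (lam : C) (y : R) : 0 < y -> Rabs (Im lam) < PI / 2 ->
  Clim both_ends (fun ab => CInt (fun v => euler_fun y (lam + RtoC v)) (fst ab) (snd ab)) (RtoC (Gamma y)).
Proof.
intros hy hl. destruct lam as [m phi]. simpl in hl.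
assert (hc : 0 < cos phi) by (apply cos_gt_0; apply Rabs_def2 in hl; lra).
set (V := fun X => CInt (fun t => euler_fun y (X, t)) 0 phi).
assert (cv : forall X t, ccont (fun t => euler_fun y (X, t)) t).
{ intros X t. eapply Cderive_ccont. apply holo_euler_fun. }
assert (ch : forall Y t, ccont (fun t => euler_fun y (t, Y)) t).
{ intros X t. eapply Cderive_ccont. apply holo_euler_fun. }
assert (bd : forall X, Cmod (V X) <= exp (y * X - cos phi * exp X) * Rabs (phi - 0)).
{ intros X. apply CInt_bound_abs. apply cv. intros t ht. rewrite Cmod_euler_fun. simpl.
  assert (cos phi <= cos t). 
  { apply cos_mono_abs; auto. unfold Rmin, Rmax in ht. 
    destruct (Rle_dec 0 phi); [rewrite !Rabs_pos_eq|rewrite !Rabs_left1]; lra. }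
  pose proof (exp_pos X). assert (k : y * X - exp X * cos t <= y * X - cos phi * exp X) by nra.
  destruct k as [k| ->]; [left; apply exp_increasing; auto|lra]. }
assert (LB : Clim at_pinf V 0).
{ apply (Clim_0 _ _ (fun B => Rabs (phi - 0) * exp (y * B - cos phi * exp B))).
  apply filter_forall. intros B. rewrite Rmult_comm. apply bd.
  apply lim_0_scal. typeclasses eauto. apply double_exp_lim; auto. }
assert (LA : Clim at_minf V 0).
{ apply (Clim_0 _ _ (fun B => Rabs (phi - 0) * exp (y * B))).
  apply filter_forall. intros B. eapply Rle_trans. apply bd. rewrite Rmult_comm. apply Rmult_le_compat_l. apply Rabs_pos.
  left; apply exp_increasing. pose proof (exp_pos B). nra.
  apply lim_0_scal. typeclasses eauto. apply lim_exp_minf; auto. }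
assert (L : Clim both_ends (fun ab => RtoC (RInt (euler_density y) (fst ab) (snd ab)) + (Ci * V (snd ab) + (- Ci) * V (fst ab)))%C
   (RtoC (Gamma y) + (Ci * 0 + (- Ci) * 0))%C).
{ apply Clim_plus. typeclasses eauto.
  - apply Clim_RtoC. typeclasses eauto. apply Gamma_lim; auto.
  - apply Clim_plus. typeclasses eauto. 
    + apply Clim_scal. typeclasses eauto. apply (Clim_comp both_ends at_pinf V snd). apply filterlim_snd. exact LB.
    + apply Clim_scal. typeclasses eauto. apply (Clim_comp both_ends at_minf V fst). apply filterlim_fst. exact LA. }
replace (RtoC (Gamma y) + (Ci * 0 + (- Ci) * 0))%C with (RtoC (Gamma y)) in L by ring.
assert (L2 := Clim_comp both_ends both_ends _ _ _ (filterlim_shift_ends m) L). simpl in L2.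
revert L2. apply Clim_ext. typeclasses eauto.
apply (both_ends_eventually 0 0). intros A B hA hB. simpl.
assert (g0 : CInt (fun x => euler_fun y (x, 0)) (A + m) (B + m) = RtoC (RInt (euler_density y) (A + m) (B + m))).
{ rewrite (CInt_ext _ (fun v => RtoC (euler_density y v))).
  - rewrite CInt_pair. apply injective_projections; simpl. reflexivity.
    rewrite RInt_const. apply (Rmult_0_r).
    apply ex_CInt_cont. intros t _. apply ccont_pair. split. apply euler_density_cont. apply continuous_const.
  - intros t. unfold euler_fun, euler_density. rewrite <- Cexp_RtoC. f_equal. unfold Cexp; simpl.
    rewrite cos_0, sin_0. apply injective_projections; simpl; ring. }
rewrite <- g0. unfold V.
assert (sh : CInt (fun v => euler_fun y ((m, phi) + RtoC v)%C) A B = CInt (fun x => euler_fun y (x, phi)) (A + m) (B + m)).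
{ rewrite <- (CInt_shift (fun x => euler_fun y (x, phi)) A B m) by (apply ex_CInt_cont; intros; apply ch).
  apply CInt_ext. intros t. f_equal. apply injective_projections; simpl; ring. }
rewrite sh.
assert (R := rectangle_Cauchy_entire (euler_fun y) _ (A + m) (B + m) 0 phi (holo_euler_fun y) ltac:(lra)).
replace (CInt (fun x => euler_fun y (x, phi)) (A + m) (B + m)) with
  ((CInt (fun x => euler_fun y (x, phi)) (A + m) (B + m) - CInt (fun x => euler_fun y (x, 0)) (A + m) (B + m))
   + CInt (fun x => euler_fun y (x, 0)) (A + m) (B + m))%C by ring.
rewrite R. ring.
Qed.

(** The integral across the strip [|Im u| <= PI] at abscissa [X], which is the
    circle of radius [exp X] in the variable [s = exp u]. *)
Definition vert_int (f : C -> C) (X : R) : C := (Ci * CInt (fun y => f (X, y)) (- PI) PI)%C.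

Lemma Clim_snd (f : R -> C) l : Clim both_ends (fun ab => f (snd ab)) l -> Clim at_pinf f l.
Proof.
intros H eps. destruct (H eps) as [Q1 Q2 [M1 h1] [M2 h2] K]. exists M2. intros x hx.
apply (K (M1 - 1) x). apply h1; lra. apply h2; auto.
Qed.

Lemma vert_int_hankel_minf lam k : 0 < k -> Clim at_minf (vert_int (hankel_fun lam k)) 0.
Proof.
intros hk0. pose proof PI_RGT_0.
apply (Clim_0 _ _ (fun A => (2 * PI * exp (exp (Re lam))) * exp (k * A))).
- exists 0. intros A hA. unfold vert_int. rewrite Cmod_mult, Cmod_Ci, Rmult_1_l.
  eapply Rle_trans. apply (CInt_bound_const _ (exp (exp (Re lam)) * exp (k * A))). lra.
  + apply ex_CInt_v. lra. intros; eexists; apply holo_hankel_fun.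
  + intros t _. apply Cmod_hankel_fun_le. lra.
  + apply Req_le. ring.
- apply lim_0_scal. typeclasses eauto. apply lim_exp_minf; auto.
Qed.

(** Cauchy's theorem: the circle of radius [exp B] is deformed into the circle
    of radius [exp A] and the two sides of the cut. *)
Lemma vert_int_hankel_diff lam k A B : A <= B ->
  vert_int (hankel_fun lam k) B = (vert_int (hankel_fun lam k) A +
   (Cexp (RtoC k * ((0, PI) - lam)) - Cexp (RtoC k * ((0, - PI)%R - lam))) * CInt (fun v => euler_fun k (lam + RtoC v)) A B)%C.
Proof.
intros hAB. unfold vert_int.
assert (R := rectangle_Cauchy_entire (hankel_fun lam k) _ A B (- PI) PI (holo_hankel_fun lam k) hAB).
assert (ex : ex_CInt (fun v => euler_fun k (lam + RtoC v)) A B).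
{ destruct lam as [m phi]. apply ex_CInt_cont. intros t _.
  apply (continuous_ext (fun v => euler_fun k (m + v, phi))).
  intros v. f_equal. apply injective_projections; simpl; ring.
  apply (continuous_comp (U := R_UniformSpace) (fun v => m + v) (fun x => euler_fun k (x, phi))).
  apply (ex_derive_continuous (K := R_AbsRing) (V := R_NormedModule)). auto_derive; auto.
  eapply Cderive_ccont. apply holo_euler_fun. }
rewrite (CInt_ext (fun x => hankel_fun lam k (x, PI)) _ A B (fun v => hankel_fun_horizontal lam k v PI (or_introl eq_refl))) in R.
rewrite (CInt_ext (fun x => hankel_fun lam k (x, - PI)) _ A B (fun v => hankel_fun_horizontal lam k v (- PI) (or_intror eq_refl))) in R.
rewrite !CInt_Cmult in R by auto.
replace ((Cexp (RtoC k * ((0, PI) - lam)) - Cexp (RtoC k * ((0, - PI)%R - lam))) * CInt (fun v => euler_fun k (lam + RtoC v)) A B)%C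
 with (Cexp (RtoC k * ((0, PI) - lam)) * CInt (fun v => euler_fun k (lam + RtoC v)) A B - Cexp (RtoC k * ((0, - PI)%R - lam)) * CInt (fun v => euler_fun k (lam + RtoC v)) A B)%C by ring.
rewrite R. ring.
Qed.

(** Hankel's formula
    [1 / (2 PI i) int exp (w s) s^(-x) ds = w^(x-1) / Gamma x] with
    [w = exp lam].  By Cauchy's theorem, the contour truncated at [|s| = exp B]
    may be replaced by the circle of radius [exp B]. *)
Definition Hankel_holds (lam : C) (x : R) : Prop :=
  Clim at_pinf (vert_int (hankel_fun lam (1 - x))) (2 * PI * Ci * Cexp (RtoC (x - 1) * lam) / RtoC (Gamma x))%C.

(** The contour collapses on the cut, where the integral is
    [2 i sin (PI x) Gamma (1 - x)] times a power of [w]; the reflection formula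
    turns this into [2 PI i / Gamma x]. *)
Lemma Hankel_holds_0_1 lam x : Rabs (Im lam) < PI / 2 -> 0 < x < 1 -> Hankel_holds lam x.
Proof.
intros hl hx. apply Clim_snd.
set (c := (Cexp (RtoC (1 - x) * ((0, PI) - lam)) - Cexp (RtoC (1 - x) * ((0, - PI)%R - lam)))%C).
assert (gx := Gamma_pos x ltac:(lra)).
replace (2 * PI * Ci * Cexp (RtoC (x - 1) * lam) / RtoC (Gamma x))%C with (0 + c * RtoC (Gamma (1 - x)))%C.
- apply (Clim_ext _ (fun ab => vert_int (hankel_fun lam (1 - x)) (fst ab) + c * CInt (fun v => euler_fun (1 - x) (lam + RtoC v)) (fst ab) (snd ab))%C).
  + apply (both_ends_eventually 0 0). intros A B hA hB. simpl. symmetry. apply vert_int_hankel_diff. lra.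
  + apply Clim_plus. typeclasses eauto.
    * apply (Clim_comp both_ends at_minf (vert_int (hankel_fun lam (1 - x))) fst). apply filterlim_fst. apply vert_int_hankel_minf. lra.
    * apply Clim_scal. typeclasses eauto. apply rotated_Gamma; auto. lra.
- assert (hc : c = (2 * Ci * RtoC (sin (PI * x)) * Cexp (RtoC (x - 1) * lam))%C).
  { unfold c. 
    replace (RtoC (1 - x) * ((0, PI) - lam))%C with ((0, (1 - x) * PI)%R + RtoC (x - 1) * lam)%C by (apply injective_projections; simpl; ring).
    replace (RtoC (1 - x) * ((0, - PI)%R - lam))%C with ((0, - ((1 - x) * PI))%R + RtoC (x - 1) * lam)%C by (apply injective_projections; simpl; ring).
    rewrite !Cexp_plus.
    assert (s : (Cexp (0, (1 - x) * PI)%R - Cexp (0, - ((1 - x) * PI))%R = 2 * Ci * RtoC (sin (PI * x)))%C).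
    { replace (PI * x) with (PI - (1 - x) * PI) by ring. rewrite sin_PI_x.
      unfold Cexp; apply injective_projections; simpl; rewrite exp_0, ?cos_neg, ?sin_neg; ring. }
    rewrite <- s. ring. }
  rewrite hc. assert (rf := Gamma_reflection x hx).
  assert (gn : RtoC (Gamma x) <> 0) by (intros k; apply RtoC_inj in k; lra).
  assert (rfC : (RtoC (Gamma x) * RtoC (Gamma (1 - x)) * RtoC (sin (PI * x)) = RtoC PI)%C).
  { rewrite <- !RtoC_mult. f_equal. exact rf. }
  rewrite <- rfC. field. auto.
Qed.

(** For [x = 1] the two sides of the cut cancel and the integral is independent
    of the radius; it tends to [2 PI i] when the circle shrinks. *)
Lemma Hankel_holds_1 lam : Hankel_holds lam 1.
Proof.
pose proof PI_RGT_0.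
apply Clim_snd.
replace (2 * PI * Ci * Cexp (RtoC (1 - 1) * lam) / RtoC (Gamma 1))%C with (2 * PI * Ci)%C.
2: { rewrite Gamma_1. replace (RtoC (1 - 1) * lam)%C with (RtoC 0) by (apply injective_projections; simpl; ring). rewrite Cexp_0. field. }
replace (1 - 1) with 0 by ring.
apply (Clim_ext _ (fun ab => vert_int (hankel_fun lam 0) (fst ab))).
- apply (both_ends_eventually 0 0). intros A B hA hB. simpl. symmetry.
  rewrite (vert_int_hankel_diff lam 0 A B) by lra.
  replace (0 * ((0, PI) - lam))%C with (RtoC 0) by (apply injective_projections; simpl; ring).
  replace (0 * ((0, - PI)%R - lam))%C with (RtoC 0) by (apply injective_projections; simpl; ring).
  ring.
- apply (Clim_comp both_ends at_minf (vert_int (hankel_fun lam 0)) fst). apply filterlim_fst.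
  destruct (Cexp_first_order (mkposreal 1 Rlt_0_1)) as [del Hd]; simpl in Hd.
  assert (L : Clim at_minf (fun A => vert_int (hankel_fun lam 0) A - 2 * PI * Ci)%C 0).
  { apply (Clim_0 _ _ (fun A => (2 * exp (Re lam) * (2 * PI)) * exp (1 * A))).
    - exists (ln (del / exp (Re lam))). intros A hA.
      assert (hs : exp (Re lam + A) < del).
      { apply exp_increasing in hA. rewrite exp_ln in hA. rewrite exp_plus. apply Rlt_div_r in hA. lra. apply exp_pos.
        apply Rdiv_lt_0_compat. apply cond_pos. apply exp_pos. }
      assert (c1 : CInt (fun _ => RtoC 1) (- PI) PI = RtoC (2 * PI)).
      { rewrite (RInt_const (V := CV)). apply injective_projections; simpl; unfold scal; simpl; unfold mult; simpl; ring. }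
      assert (exc : ex_CInt (fun _ => RtoC 1) (- PI) PI) by apply (ex_RInt_const (V := CV)).
      assert (exh : ex_CInt (fun y => hankel_fun lam 0 (A, y)) (- PI) PI).
      { apply ex_CInt_v. lra. intros; eexists; apply holo_hankel_fun. }
      replace (vert_int (hankel_fun lam 0) A - 2 * PI * Ci)%C with (Ci * CInt (fun y => hankel_fun lam 0 (A, y) - 1)%C (- PI) PI)%C.
      2: { rewrite CInt_minus, c1 by auto. unfold vert_int. rewrite RtoC_mult. ring. }
      rewrite Cmod_mult, Cmod_Ci, Rmult_1_l.
      replace (2 * exp (Re lam) * (2 * PI) * exp (1 * A)) with (2 * exp (Re lam + A) * (PI - - PI)) by (rewrite Rmult_1_l, exp_plus; ring).
      apply CInt_bound_const. lra. apply (ex_RInt_minus (V := CV)); auto.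
      intros y _. unfold hankel_fun. replace (Cexp (lam + (A, y)) + 0 * (A, y))%C with (Cexp (lam + (A, y))) by ring.
      set (h := Cexp (lam + (A, y))). 
      assert (mh : Cmod h = exp (Re lam + A)) by (unfold h; rewrite Cmod_Cexp; reflexivity).
      specialize (Hd h ltac:(lra)).
      replace (Cexp h - 1)%C with ((Cexp h - 1 - h) + h)%C by ring.
      eapply Rle_trans. apply Cmod_triangle. lra.
    - apply lim_0_scal. typeclasses eauto. apply lim_exp_minf. lra. }
  assert (L2 := Clim_plus _ _ _ _ _ L (Clim_const _ (2 * PI * Ci)%C)).
  rewrite Cplus_0_l in L2. revert L2. apply Clim_ext. typeclasses eauto. apply filter_forall. intros A. simpl. ring.
Qed.

(** On the cut the modulus is a constant times [exp (k B - Re w * exp B)], where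
    [w = exp lam] and [Re w > 0] because [|Im lam| < PI / 2]. *)
Lemma hankel_fun_pinf lam k s : Rabs (Im lam) < PI / 2 -> s = PI \/ s = - PI ->
  Clim at_pinf (fun B => hankel_fun lam k (B, s)) 0.
Proof.
intros hl hs. 
assert (hc : 0 < cos (Im lam)) by (apply cos_gt_0; apply Rabs_def2 in hl; lra).
apply (Clim_0 _ _ (fun B => (Cmod (Cexp (RtoC k * ((0, s) - lam))) * exp (k * Re lam)) * exp (k * B - (exp (Re lam) * cos (Im lam)) * exp B))).
- apply filter_forall. intros B. rewrite hankel_fun_horizontal by auto. rewrite Cmod_mult, Cmod_euler_fun. 
  rewrite Rmult_assoc. apply Rmult_le_compat_l. apply Cmod_ge_0. rewrite <- exp_plus. right. f_equal.
  unfold Re, Im; simpl. rewrite exp_plus, Rplus_0_r. ring.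
- apply lim_0_scal. typeclasses eauto. apply double_exp_lim. apply Rmult_lt_0_compat; auto. apply exp_pos.
Qed.

(** Integration by parts: the derivative of [hankel_fun lam (- x)] is
    [w hankel_fun lam (1 - x) - x hankel_fun lam (- x)], and its integral across
    the strip is the difference of two end values, which vanish in the limit. *)
Lemma Hankel_holds_succ lam x : Rabs (Im lam) < PI / 2 -> 0 < x -> Hankel_holds lam x -> Hankel_holds lam (x + 1).
Proof.
intros hl hx H. unfold Hankel_holds in *.
pose proof PI_RGT_0.
assert (gx := Gamma_pos x hx).
assert (gn : RtoC (Gamma x) <> 0) by (intros k; apply RtoC_inj in k; lra).
assert (xn : RtoC x <> 0) by (intros k; apply RtoC_inj in k; lra).
replace (1 - (x + 1)) with (- x) by ring.
assert (E : forall B, vert_int (hankel_fun lam (- x)) B = (/ RtoC x * (Cexp lam * vert_int (hankel_fun lam (1 - x)) B + (- hankel_fun lam (- x) (B, PI) + hankel_fun lam (- x) (B, - PI)%R)))%C).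
{ intros B.
  assert (I1 := is_RInt_unique (V := CV) _ _ _ _ (vertical_FTC (hankel_fun lam (- x)) _ B (- PI) PI (holo_hankel_fun lam (- x)))).
  assert (ex : forall k, ex_CInt (fun y => hankel_fun lam k (B, y)) (- PI) PI).
  { intros k. apply ex_CInt_v. lra. intros; eexists; apply holo_hankel_fun. }
  assert (I2 : CInt (fun y => Ci * ((Cexp (lam + (B, y)) + RtoC (- x)) * hankel_fun lam (- x) (B, y)))%C (- PI) PI =
    (Cexp lam * vert_int (hankel_fun lam (1 - x)) B - RtoC x * vert_int (hankel_fun lam (- x)) B)%C).
  { rewrite (CInt_ext _ (fun y => (Cexp lam * Ci) * hankel_fun lam (1 - x) (B, y) - (RtoC x * Ci) * hankel_fun lam (- x) (B, y))%C).
    - rewrite CInt_minus, !CInt_Cmult by (auto; destruct (ex (1 - x)) as [l1 h1]; destruct (ex (- x)) as [l2 h2]; eexists; apply is_CInt_Cmult; eauto).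
      unfold vert_int. match goal with |- ?a = ?b => change (@eq C a b) end. ring.
    - intros y. 
      replace (hankel_fun lam (1 - x) (B, y)) with (Cexp (B, y) * hankel_fun lam (- x) (B, y))%C.
      2: { unfold hankel_fun. rewrite <- Cexp_plus. f_equal. replace (1 - x) with (1 + - x) by ring. rewrite RtoC_plus. ring. }
      rewrite Cexp_plus, RtoC_opp. ring. }
  cbv beta in I1; rewrite I2 in I1.
  replace (- hankel_fun lam (- x) (B, PI) + hankel_fun lam (- x) (B, - PI)%R)%C with (- (hankel_fun lam (- x) (B, PI) - hankel_fun lam (- x) (B, - PI)%R))%C by ring.
  rewrite <- I1. field. auto. }
apply (Clim_ext _ _ _ _ (filter_forall _ (fun B => eq_sym (E B)))).
replace (2 * PI * Ci * Cexp (RtoC (x + 1 - 1) * lam) / RtoC (Gamma (x + 1)))%C with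
 (/ RtoC x * (Cexp lam * (2 * PI * Ci * Cexp (RtoC (x - 1) * lam) / RtoC (Gamma x)) + (- (1) * 0 + 0)))%C.
- apply Clim_scal. typeclasses eauto. apply Clim_plus. typeclasses eauto. 
  apply Clim_scal; auto. typeclasses eauto.
  apply Clim_plus. typeclasses eauto.
  + apply (Clim_ext _ (fun B => - (1) * hankel_fun lam (- x) (B, PI))%C). apply filter_forall; intros; ring.
    apply Clim_scal. typeclasses eauto. apply hankel_fun_pinf; auto.
  + apply hankel_fun_pinf; auto.
- rewrite Gamma_recursion, RtoC_mult by auto.
  replace (RtoC (x + 1 - 1) * lam)%C with (lam + RtoC (x - 1) * lam)%C by (apply injective_projections; simpl; ring).
  rewrite Cexp_plus. field. auto.
Qed.

Lemma Hankel_formula lam x : Rabs (Im lam) < PI / 2 -> 0 < x -> Hankel_holds lam x.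
Proof.
intros hl hx. destruct (INR_unbounded x) as [n hn].
revert x hx hn. induction n as [|n IH]; intros x hx hn. simpl in hn; lra.
destruct (Rlt_dec x 1) as [h|h]. apply Hankel_holds_0_1; auto.
destruct (Req_dec x 1) as [->|h1]. apply Hankel_holds_1.
replace x with (x - 1 + 1) by ring. apply Hankel_holds_succ; auto. lra. apply IH. lra. rewrite S_INR in hn. lra.
Qed.

(** * The Mittag-Leffler series as a limit of contour integrals *)

Lemma Cexp_Clog (z : C) : 0 < Re z -> Cexp (Clog z) = z /\ Rabs (Im (Clog z)) < PI / 2.
Proof.
destruct z as [x y]. simpl. intros hx. unfold Clog, Carg. simpl.
destruct (Rlt_dec 0 x) as [_|n]; [|lra]. 
assert (hm : Cmod (x, y) = x * sqrt (1 + (y / x)²)).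
{ unfold Cmod. simpl. replace (x * (x * 1) + y * (y * 1)) with (x * x * (1 + (y / x)²)) by (unfold Rsqr; field; lra).
  rewrite sqrt_mult_alt by nra. rewrite sqrt_square by lra. reflexivity. }
assert (hp : 0 < sqrt (1 + (y / x)²)) by (apply sqrt_lt_R0; pose proof (Rle_0_sqr (y / x)); lra).
split.
- unfold Cexp; simpl. rewrite exp_ln. 2: rewrite hm; nra.
  rewrite hm, cos_atan, sin_atan. f_equal; field; lra.
- pose proof (atan_bound (y / x)). apply Rabs_def1; lra.
Qed.

Lemma scal_Cmult (r : R) (c : C) : scal (V := CV) r c = (RtoC r * c)%C.
Proof.
destruct c as [x y].
change ((r * x, r * y) = (RtoC r * (x, y))%C).
apply injective_projections; simpl; ring.
Qed.

Fixpoint Csum (u : nat -> C) (n : nat) : C :=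
  match n with O => RtoC 0 | S n => (Csum u n + u n)%C end.

Lemma sum_n_Csum (u : nat -> C) n : sum_n (G := C_R_CompleteNormedModule) u n = Csum u (S n).
Proof.
induction n as [|n IH]. rewrite sum_O. simpl. ring.
rewrite sum_Sn, IH. reflexivity.
Qed.

Lemma Csum_scal (c : C) (u : nat -> C) n : Csum (fun k => c * u k)%C n = (c * Csum u n)%C.
Proof. induction n as [|n IH]; simpl. ring. rewrite IH. ring. Qed.

Lemma Csum_ext (u v : nat -> C) n : (forall k, u k = v k) -> Csum u n = Csum v n.
Proof. intros H. induction n as [|n IH]; simpl; auto. rewrite IH, H. auto. Qed.

Lemma Clim_Csum {T} (F : (T -> Prop) -> Prop) {FF : Filter F} (f : nat -> T -> C) (l : nat -> C) n :
  (forall k, Clim F (f k) (l k)) -> Clim F (fun x => Csum (fun k => f k x) n) (Csum l n).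
Proof.
intros H. induction n as [|n IH]; simpl. apply Clim_const; auto. apply Clim_plus; auto.
Qed.

(** The Moore-Osgood argument for a sequence of approximations.  It yields the
    existence of both limits at once, so neither the convergence of the series
    nor that of the integral has to be established beforehand. *)
Lemma limit_exchange {T} (F : (T -> Prop) -> Prop) {FF : ProperFilter F} (f : T -> C)
  (s : nat -> T -> C) (S : nat -> C) (r : nat -> R) :
  (forall n, Clim F (s n) (S n)) ->
  (forall n, F (fun x => Cmod (f x - s n x)%C <= r n)) ->
  is_lim_seq r 0 ->
  exists L, Clim F f L /\ Clim eventually S L.
Proof.
intros H1 H2 H3.
assert (near : forall eps : posreal, exists n, r n < eps).
{ intros eps. apply is_lim_seq_spec in H3. destruct (H3 eps) as [n hn]. exists n.
  specialize (hn n (Nat.le_refl n)). rewrite Rminus_0_r in hn. eapply Rle_lt_trans. apply Rle_abs. exact hn. }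
assert (app : forall n (e : posreal), F (fun x => Cmod (f x - S n)%C < r n + e)).
{ intros n e. generalize (filter_and _ _ (H1 n e) (H2 n)). apply filter_imp. intros x [k1 k2].
  replace (f x - S n)%C with ((f x - s n x) + (s n x - S n))%C by ring.
  eapply Rle_lt_trans. apply Cmod_triangle. lra. }
assert (cv : exists L : C_R_CompleteNormedModule, filterlim f F (locally L)).
{ apply (proj1 (filterlim_locally_cauchy (U := C_R_CompleteNormedModule) (F := F) f)). intros eps.
  assert (hp : 0 < eps / 4) by (pose proof (cond_pos eps); lra).
  destruct (near (mkposreal _ hp)) as [n hn]. simpl in hn.
  exists (fun x => Cmod (f x - S n)%C < r n + eps / 4). split. apply (app n (mkposreal _ hp)).
  intros u v hu hv.
  assert (k : Cmod (f v - f u)%C < eps).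
  { replace (f v - f u)%C with ((f v - S n) + - (f u - S n))%C by ring.
    eapply Rle_lt_trans. apply Cmod_triangle. rewrite Cmod_opp. lra. }
  split; (eapply Rle_lt_trans; [|exact k]).
  exact (Rabs_Re_le_Cmod (f v - f u)%C). exact (Rabs_Im_le_Cmod (f v - f u)%C). }
destruct cv as [L HL]. exists L.
assert (CL : Clim F f L).
{ intros eps. assert (hp : 0 < eps / 2) by (pose proof (cond_pos eps); lra).
  assert (K : F (fun x => ball (M := C_R_CompleteNormedModule) L (eps / 2) (f x))).
  { apply HL. exists (mkposreal _ hp). auto. }
  revert K. apply filter_imp. intros x [k1 k2].
  destruct (f x) as [a b], L as [c d]. 
  change (Rabs (a - c) < eps / 2) in k1. change (Rabs (b - d) < eps / 2) in k2.
  eapply Rle_lt_trans. apply (Cmod_pair_le (a - c) (b - d)). lra. }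
split; auto.
intros eps. apply is_lim_seq_spec in H3. assert (hp : 0 < eps / 4) by (pose proof (cond_pos eps); lra).
destruct (H3 (mkposreal _ hp)) as [n0 hn0]. exists n0. intros n hn. specialize (hn0 n hn). simpl in hn0.
rewrite Rminus_0_r in hn0. apply Rabs_def2 in hn0.
destruct (filter_ex _ (filter_and _ _ (CL (mkposreal _ hp)) (app n (mkposreal _ hp)))) as [x [k1 k2]]. simpl in k1, k2.
replace (S n - L)%C with (- (f x - S n) + (f x - L))%C by ring.
eapply Rle_lt_trans. apply Cmod_triangle. rewrite Cmod_opp. lra.
Qed.

(** For [k = 1 - beta], the inverse Laplace integrand
    [exp (w s) s^(alpha - beta) / (s^alpha + 1) ds] in the variable
    [u = ln s]. *)
Definition ml_fun (alpha k : R) (lam : C) (u : C) : C := (hankel_fun lam k u * / pole_den alpha u)%C.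

Lemma hankel_fun_mult_exp lam k a u : (hankel_fun lam k u * Cexp (- RtoC a * u))%C = hankel_fun lam (k - a) u.
Proof. unfold hankel_fun. rewrite <- Cexp_plus. f_equal. rewrite RtoC_minus. ring. Qed.

(** With [q = exp (- alpha u)], this is [1 / (1 + q) = 1 - q / (1 + q)]. *)
Lemma ml_fun_step alpha k lam u : pole_den alpha u <> 0 ->
  ml_fun alpha k lam u = (hankel_fun lam k u - ml_fun alpha (k - alpha) lam u)%C.
Proof.
intros h. unfold ml_fun. rewrite <- hankel_fun_mult_exp. 
replace (Cexp (- RtoC alpha * u)) with (pole_den alpha u - 1)%C by (unfold pole_den; ring). field. auto.
Qed.

Lemma ml_fun_expansion alpha beta lam u n : pole_den alpha u <> 0 ->
  ml_fun alpha (1 - beta) lam u =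
  (Csum (fun k => (- (1)) ^ k * hankel_fun lam (1 - (alpha * INR k + beta)) u)%C n +
   (- (1)) ^ n * ml_fun alpha (1 - (alpha * INR n + beta)) lam u)%C.
Proof.
intros h. induction n as [|n IH].
- simpl. replace (1 - (alpha * 0 + beta)) with (1 - beta) by ring. ring.
- rewrite IH at 1. rewrite ml_fun_step by auto. 
  replace (1 - (alpha * INR n + beta) - alpha) with (1 - (alpha * INR (S n) + beta)) by (rewrite S_INR; ring).
  simpl Csum. rewrite Cpow_S. ring.
Qed.

Section Fixed_parameters.
Variables (alpha beta : R) (lam : C).
Hypotheses (ha : 1 < alpha < 2) (hb : 1 <= beta <= 2) (hl : Rabs (Im lam) < PI / 2).

Lemma ex_ml_fun_v k X a b : X <> 0 -> ex_CInt (fun y => ml_fun alpha k lam (X, y)) a b.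
Proof.
intros hX. apply ex_CInt_cont. intros y _. eapply Cderive_ccont. unfold ml_fun.
apply (holo_mult _ _ _ _ (X, y) (holo_hankel_fun lam k _) (holo_inv _ _ _ (holo_pole_den alpha (X, y)) (pole_den_nz_off_axis alpha X y ltac:(lra) hX))).
Qed.

Lemma Cexp_axis s : Cexp (- RtoC alpha * (0, s)) = (cos (alpha * s), - sin (alpha * s)).
Proof.
unfold Cexp; simpl. replace (- alpha * 0 - - 0 * s) with 0 by ring. replace (- alpha * s + - 0 * 0) with (- (alpha * s)) by ring.
rewrite exp_0, cos_neg, sin_neg. f_equal; ring.
Qed.

(** The lines [Im u = 0] and [Im u = +- PI] avoid the poles since
    [PI < alpha * PI < 2 * PI]. *)
Lemma pole_den_nz_contour s v : s = PI \/ s = - PI \/ s = 0 -> pole_den alpha (v, s) <> 0.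
Proof.
intros hs. pose proof PI_RGT_0. destruct (Req_dec v 0) as [->|hv]. 2: apply pole_den_nz_off_axis; auto; lra.
assert (st : forall t, (t = PI / alpha \/ t = - (PI / alpha)) -> Cexp (- RtoC alpha * (0, t)) = (- (1))%C).
{ intros t [->| ->]; rewrite Cexp_axis.
  replace (alpha * (PI / alpha)) with PI by (field; lra). rewrite cos_PI, sin_PI. apply injective_projections; simpl; ring.
  replace (alpha * - (PI / alpha)) with (- PI) by (field; lra). rewrite cos_neg, sin_neg, cos_PI, sin_PI. apply injective_projections; simpl; ring. }
assert (ap1 : PI < alpha * PI) by nra. assert (ap2 : alpha * PI < 2 * PI) by nra.
assert (e1 : alpha * (PI / alpha) = PI) by (field; lra).
destruct hs as [->|[->| ->]].
- apply (pole_den_nz alpha 0 PI (PI / alpha)); auto. lra. rewrite Rmult_minus_distr_l, e1; split; lra.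
  intros E. inversion E. nra.
- apply (pole_den_nz alpha 0 (- PI) (- (PI / alpha))); auto. lra. 
  replace (alpha * (- PI - - (PI / alpha))) with (PI - alpha * PI) by (field; lra). split; lra.
  intros E. inversion E. nra.
- apply (pole_den_nz alpha 0 0 (PI / alpha)); auto. lra. rewrite Rmult_minus_distr_l, e1; split; lra.
  intros E. inversion E. assert (0 < PI / alpha) by (apply Rdiv_lt_0_compat; lra). lra.
Qed.

Lemma ccont_ml_fun_h k s v : s = PI \/ s = - PI \/ s = 0 -> ccont (fun v => ml_fun alpha k lam (v, s)) v.
Proof.
intros hs. eapply Cderive_ccont. unfold ml_fun.
apply (holo_mult _ _ _ _ (v, s) (holo_hankel_fun lam k _) (holo_inv _ _ _ (holo_pole_den alpha (v, s)) (pole_den_nz_contour s v hs))).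
Qed.

Lemma ex_ml_fun_h k s a b : s = PI \/ s = - PI \/ s = 0 -> ex_CInt (fun v => ml_fun alpha k lam (v, s)) a b.
Proof. intros hs. apply ex_CInt_cont. intros v _. apply ccont_ml_fun_h; auto. Qed.

(** The bound cannot be read on the segment itself, where the integrand grows
    with [B].  The contour is first moved back to abscissa [1]; there, and on
    the edges [Im u = +- PI] where the Hankel integrand decays, the factor
    [exp (k v)] with [k <= - n] gives the decay in [n]. *)
Lemma vert_int_remainder_bound : exists K, forall n B, 1 <= B ->
  Cmod (vert_int (ml_fun alpha (1 - (alpha * INR n + beta)) lam) B) <= K * exp (-1 * INR n).
Proof.
pose proof PI_RGT_0.
assert (hc : 0 < cos (Im lam)) by (apply cos_gt_0; apply Rabs_def2 in hl; lra).
set (c := exp (Re lam) * cos (Im lam)).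
assert (hcc : 0 < c) by (apply Rmult_lt_0_compat; auto; apply exp_pos).
destruct (double_exp_bound 0 c) as [K0 HK0]; try lra.
assert (K0p : 0 <= K0).
{ specialize (HK0 0). rewrite Ropp_0, exp_0 in HK0. pose proof (exp_pos (0 * 0 - c * 1)). lra. }
exists (2 * (2 * PI) * exp (exp (Re lam + 1)) + 4 * K0). intros n B hB.
set (k := 1 - (alpha * INR n + beta)).
assert (hn := pos_INR n).
assert (hk1 : k <= - INR n) by (unfold k; nra).
assert (kv : forall v, 1 <= v -> exp (k * v) <= exp (-1 * INR n)).
{ intros v hv. assert (k0 : k * v <= -1 * INR n) by nra. destruct k0 as [k0| ->]; [left; apply exp_increasing; auto|lra]. }
set (en := exp (-1 * INR n)) in *. assert (0 < en) by apply exp_pos.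
assert (b1 : Cmod (vert_int (ml_fun alpha k lam) 1) <= 2 * (2 * PI) * exp (exp (Re lam + 1)) * en).
{ unfold vert_int. rewrite Cmod_mult, Cmod_Ci, Rmult_1_l. unfold ml_fun.
  replace (2 * (2 * PI) * exp (exp (Re lam + 1)) * en) with (2 * (PI - - PI) * (exp (exp (Re lam + 1)) * en)) by ring.
  eapply vertical_right; [apply holo_hankel_fun|lra| |lra|].
  apply Rle_div_l; lra.
  intros y _. unfold hankel_fun. rewrite Cmod_Cexp.
  apply Rle_trans with (exp (exp (Re lam + 1)) * exp (k * 1)).
  2: { apply Rmult_le_compat_l. left; apply exp_pos. apply kv. lra. }
  rewrite <- exp_plus.
  assert (E : Re (Cexp (lam + (1, y)) + RtoC k * (1, y))%C = exp (Re lam + 1) * cos (Im lam + y) + k * 1).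
  { unfold Cexp, Re, Im; simpl. ring. }
  rewrite E. pose proof (exp_pos (Re lam + 1)). pose proof (COS_bound (Im lam + y)).
  assert (k2 : exp (Re lam + 1) * cos (Im lam + y) + k * 1 <= exp (Re lam + 1) + k * 1) by nra.
  destruct k2 as [k2| ->]; [left; apply exp_increasing; auto| lra]. }
assert (b2 : forall s, s = PI \/ s = - PI -> Cmod (CInt (fun v => ml_fun alpha k lam (v, s)) 1 B) <= 2 * K0 * en).
{ intros s hs. assert (hs3 : s = PI \/ s = - PI \/ s = 0) by tauto.
  assert (I := exp_primitive (2 * K0 * en) (-1) 1 B ltac:(lra)).
  eapply Rle_trans. apply (CInt_bound _ (fun v => (2 * K0 * en) * exp (-1 * v))); auto.
  apply ex_ml_fun_h; auto. eexists; exact I.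
  - intros v hv. unfold ml_fun. rewrite Cmod_mult, Cmod_inv by (apply pole_den_nz_contour; auto).
    assert (hd : / 2 <= Cmod (pole_den alpha (v, s))).
    { eapply Rle_trans. 2: apply pole_den_lower_pos.
      replace (- alpha * v) with (- (alpha * v)) by ring. rewrite exp_Ropp.
      pose proof (exp_ge_2 (alpha * v) ltac:(nra)). assert (/ exp (alpha * v) <= / 2) by (apply Rinv_le_contravar; lra). lra. }
    assert (hi : / Cmod (pole_den alpha (v, s)) <= 2).
    { rewrite <- (Rinv_inv 2). apply Rinv_le_contravar; lra. }
    assert (hh : Cmod (hankel_fun lam k (v, s)) <= en * (K0 * exp (-1 * v))).
    { rewrite hankel_fun_horizontal by auto. rewrite Cmod_mult, Cmod_euler_fun, Cmod_Cexp, <- exp_plus.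
      replace (Re (RtoC k * ((0, s) - lam))%C + (k * Re (lam + RtoC v)%C - exp (Re (lam + RtoC v)%C) * cos (Im (lam + RtoC v)%C)))
        with (k * v + (0 * v - c * exp v)).
      2: { unfold c, Re, Im; simpl. rewrite exp_plus, Rplus_0_r. ring. }
      rewrite exp_plus. apply Rmult_le_compat; try (left; apply exp_pos). apply kv; lra.
      replace (-1 * v) with (- v) by ring. apply HK0. }
    replace (2 * K0 * en * exp (-1 * v)) with ((en * (K0 * exp (-1 * v))) * 2) by ring.
    apply Rmult_le_compat; auto. apply Cmod_ge_0. left; apply Rinv_0_lt_compat. lra.
  - rewrite (is_RInt_unique _ _ _ _ I). 
    replace (2 * K0 * en / -1) with (- (2 * K0 * en)) by field.
    assert (exp (-1 * 1) <= 1). { apply Rle_trans with (exp 0); [left; apply exp_increasing; lra | rewrite exp_0; lra]. }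
    pose proof (exp_pos (-1 * B)). assert (0 <= 2 * K0 * en) by (apply Rmult_le_pos; lra). nra. }
assert (R0 := rect_int_no_pole (hankel_fun lam k) _ alpha 1 B (- PI) PI (holo_hankel_fun lam k) ltac:(lra) ltac:(lra) ltac:(lra)).
unfold rect_int in R0.
assert (E : vert_int (ml_fun alpha k lam) B = (vert_int (ml_fun alpha k lam) 1 + (CInt (fun v => ml_fun alpha k lam (v, PI)) 1 B + - CInt (fun v => ml_fun alpha k lam (v, (- PI)%R)) 1 B))%C).
{ apply Ceq_minus. etransitivity; [|exact R0]. unfold vert_int, ml_fun. ring. }
rewrite E.
eapply Rle_trans. apply Cmod_triangle. eapply Rle_trans. apply Rplus_le_compat_l. apply Cmod_triangle.
rewrite Cmod_opp. pose proof (b2 PI (or_introl eq_refl)). pose proof (b2 (- PI) (or_intror eq_refl)). lra.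
Qed.

Lemma vert_int_expansion n B : 1 <= B ->
  vert_int (ml_fun alpha (1 - beta) lam) B =
  (Csum (fun k => (- (1)) ^ k * vert_int (hankel_fun lam (1 - (alpha * INR k + beta))) B)%C n +
   (- (1)) ^ n * vert_int (ml_fun alpha (1 - (alpha * INR n + beta)) lam) B)%C.
Proof.
intros hB. 
assert (exf : forall k, ex_CInt (fun y => ml_fun alpha k lam (B, y)) (- PI) PI) by (intros; apply ex_ml_fun_v; lra).
assert (exh : forall k, ex_CInt (fun y => hankel_fun lam k (B, y)) (- PI) PI).
{ intros k. pose proof PI_RGT_0. apply ex_CInt_v. lra. intros; eexists; apply holo_hankel_fun. }
assert (exs : forall c f, ex_CInt f (- PI) PI -> ex_CInt (fun y => c * f y)%C (- PI) PI).
{ intros c f [l h]. eexists. apply is_CInt_Cmult. exact h. }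
assert (S : ex_CInt (fun y => Csum (fun k => (- (1)) ^ k * hankel_fun lam (1 - (alpha * INR k + beta)) (B, y))%C n) (- PI) PI /\
  Csum (fun k => (- (1)) ^ k * vert_int (hankel_fun lam (1 - (alpha * INR k + beta))) B)%C n =
  (Ci * CInt (fun y => Csum (fun k => (- (1)) ^ k * hankel_fun lam (1 - (alpha * INR k + beta)) (B, y))%C n) (- PI) PI)%C).
{ induction n as [|n [IH1 IH2]]; simpl Csum.
  - split. apply (ex_RInt_const (V := CV)). rewrite (RInt_const (V := CV)).
    apply injective_projections; simpl; unfold scal; simpl; unfold mult; simpl; ring.
  - split. apply (ex_RInt_plus (V := CV)); auto.
    rewrite CInt_plus, CInt_Cmult by auto. rewrite IH2. unfold vert_int. ring. }
destruct S as [S1 S2]. rewrite S2. unfold vert_int.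
rewrite (CInt_ext _ _ (- PI) PI (fun y => ml_fun_expansion alpha beta lam (B, y) n (pole_den_nz_off_axis alpha B y ltac:(lra) ltac:(lra)))).
rewrite CInt_plus, CInt_Cmult by auto. ring.
Qed.

Lemma Mittag_Leffler_limit : exists L,
  Clim at_pinf (vert_int (ml_fun alpha (1 - beta) lam)) L /\
  Clim eventually (fun n => Csum (fun k => (- (1)) ^ k *
     (2 * PI * Ci * Cexp (RtoC (alpha * INR k + beta - 1) * lam) / RtoC (Gamma (alpha * INR k + beta))))%C n) L.
Proof.
destruct vert_int_remainder_bound as [K HK].
apply (limit_exchange at_pinf _ (fun n B => Csum (fun k => (- (1)) ^ k * vert_int (hankel_fun lam (1 - (alpha * INR k + beta))) B)%C n) _
  (fun n => K * exp (-1 * INR n))).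
- intros n. apply (Clim_Csum at_pinf (fun k B => (- (1)) ^ k * vert_int (hankel_fun lam (1 - (alpha * INR k + beta))) B)%C). intros k. apply Clim_scal. typeclasses eauto. apply Hankel_formula; auto.
  pose proof (pos_INR k). nra.
- intros n. exists 1. intros B hB. rewrite (vert_int_expansion n B) by lra.
  match goal with |- Cmod (?a + ?b - ?a)%C <= _ => replace (a + b - a)%C with b by ring end.
  rewrite Cmod_mult, Cmod_pow, Cmod_opp, Cmod_1, pow1, Rmult_1_l. apply HK. lra.
- replace (Finite 0) with (Rbar_mult K 0) by (simpl; f_equal; ring).
  apply is_lim_seq_scal_l.
  apply (filterlim_comp _ _ _ INR (fun x => exp (-1 * x)) _ at_pinf). exact is_lim_seq_INR.
  exact (lim_exp_pinf 1 Rlt_0_1).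
Qed.

(** The residue theorem in the upper and the lower half of the strip, each of
    which contains one pole; the common edge on the real axis cancels. *)
Lemma contour_identity A B : A < 0 -> 0 < B ->
  CInt (fun v => ml_fun alpha (1 - beta) lam (v, PI) - ml_fun alpha (1 - beta) lam (v, (- PI)%R))%C A B =
  (vert_int (ml_fun alpha (1 - beta) lam) B - vert_int (ml_fun alpha (1 - beta) lam) A -
   2 * PI * Ci * ((hankel_fun lam (1 - beta) (0, PI / alpha)%R + hankel_fun lam (1 - beta) (0, - (PI / alpha))%R) / RtoC alpha))%C.
Proof.
intros hA hB. pose proof PI_RGT_0. 
assert (e1 : alpha * (PI / alpha) = PI) by (field; lra).
assert (0 < PI / alpha) by (apply Rdiv_lt_0_compat; lra).
assert (PI / alpha < PI) by (apply Rlt_div_l; nra).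
set (k := 1 - beta).
assert (R1 := rect_int_pole (hankel_fun lam k) _ alpha A B 0 PI (PI / alpha) (holo_hankel_fun lam k) ltac:(lra) ltac:(lra) ltac:(lra)).
assert (R2 := rect_int_pole (hankel_fun lam k) _ alpha A B (- PI) 0 (- (PI / alpha)) (holo_hankel_fun lam k) ltac:(lra) ltac:(lra) ltac:(lra)).
assert (R3 := rect_int_split_v (ml_fun alpha k lam) A B (- PI) 0 PI).
rewrite CInt_minus by (apply ex_ml_fun_h; tauto).
unfold ml_fun in *.
rewrite R1, R2 in R3; try nra.
- unfold rect_int in R3. unfold vert_int.
  lapply R3; clear R3. intros R3. lapply R3; clear R3. intros R3.
  + set (I1 := CInt (fun x => hankel_fun lam k (x, (- PI)%R) * / pole_den alpha (x, (- PI)%R))%C A B) in *.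
    set (I2 := CInt (fun x => hankel_fun lam k (x, PI) * / pole_den alpha (x, PI))%C A B) in *.
    match type of R3 with ?l = ?r => assert (R4 : (I2 - I1 = (l + (I2 - I1)) - r)%C) by (rewrite R3; match goal with |- ?a = ?b => change (@eq C a b) end; ring) end.
    rewrite R4. unfold Cdiv. match goal with |- ?a = ?b => change (@eq C a b) end. ring.
  + intros x [->| ->]; apply ex_ml_fun_v; lra.
  + intros x [->| ->]; apply ex_ml_fun_v; lra.
- rewrite Cexp_axis. replace (alpha * - (PI / alpha)) with (- PI) by lra. rewrite cos_neg, sin_neg, cos_PI, sin_PI. apply injective_projections; simpl; ring.
- rewrite Cexp_axis, e1, cos_PI, sin_PI. apply injective_projections; simpl; ring.
Qed.

(** The exponent [1 - beta + alpha] is positive because [beta <= 2] and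
    [1 < alpha]. *)
Lemma vert_int_ml_minf : Clim at_minf (vert_int (ml_fun alpha (1 - beta) lam)) 0.
Proof.
pose proof PI_RGT_0.
apply (Clim_0 _ _ (fun A => (2 * (PI - - PI) * exp (exp (Re lam))) * exp ((1 - beta + alpha) * A))).
- exists (- (1)). intros A hA. unfold vert_int. rewrite Cmod_mult, Cmod_Ci, Rmult_1_l.
  replace (2 * (PI - - PI) * exp (exp (Re lam)) * exp ((1 - beta + alpha) * A)) with
    (2 * (PI - - PI) * ((exp (exp (Re lam)) * exp ((1 - beta) * A)) * exp (alpha * A))).
  2: { replace ((1 - beta + alpha) * A) with ((1 - beta) * A + alpha * A) by ring. rewrite exp_plus. ring. }
  unfold ml_fun. eapply vertical_left; [apply holo_hankel_fun|lra| |lra|].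
  assert (1 / alpha < 1) by (apply Rlt_div_l; lra). lra.
  intros y _. apply Cmod_hankel_fun_le. lra.
- apply lim_0_scal. typeclasses eauto. apply lim_exp_minf. lra.
Qed.

(** With [s = exp (alpha v)] and [k = 1 - beta], the difference of the edges is
    [s] times [e^(i k PI) / (s + e^(- i alpha PI)) - e^(- i k PI) / (s + e^(i alpha PI))]
    up to a common factor, and reducing to the common denominator
    [s^2 + 2 s cos (alpha PI) + 1] produces [H_fun]. *)
Lemma l_integrand v :
  scal (V := CV) (alpha * exp (alpha * v))
    (RtoC (H_fun alpha beta (exp (alpha * v))) *
        Cexp (- (Cexp lam * RtoC (Rpower (exp (alpha * v)) (1 / alpha)))) *
        Cexp (RtoC (1 - beta) * lam))%C =
  (Cexp (RtoC (1 - beta) * lam) / (2 * PI * Ci) * (ml_fun alpha (1 - beta) lam (v, PI) - ml_fun alpha (1 - beta) lam (v, (- PI)%R)))%C.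
Proof.
pose proof PI_RGT_0.
rewrite scal_Cmult.
assert (ra : Rpower (exp (alpha * v)) (1 / alpha) = exp v).
{ unfold Rpower. rewrite ln_exp. f_equal. field. lra. }
assert (rb : Rpower (exp (alpha * v)) ((1 - beta) / alpha) = exp ((1 - beta) * v)).
{ unfold Rpower. rewrite ln_exp. f_equal. field. lra. }
unfold H_fun. rewrite ra, rb.
assert (N1 := pole_den_nz_contour PI v (or_introl eq_refl)).
assert (N2 := pole_den_nz_contour (- PI) v (or_intror (or_introl eq_refl))).
unfold ml_fun. rewrite !hankel_fun_horizontal by auto.
set (s := exp (alpha * v)). assert (hs : 0 < s) by apply exp_pos.
assert (ek1 : euler_fun (1 - beta) (lam + RtoC v) = (Cexp (RtoC (1 - beta) * lam) * RtoC (exp ((1 - beta) * v)) * Cexp (- (Cexp lam * RtoC (exp v))))%C).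
{ unfold euler_fun. rewrite <- !Cexp_RtoC, <- !Cexp_plus. f_equal. rewrite RtoC_mult. ring. }
rewrite ek1.
set (w := Cexp (- (Cexp lam * RtoC (exp v)))).
assert (q1 : Cexp (RtoC (1 - beta) * ((0, PI) - lam)) = (Cexp (0, (1 - beta) * PI)%R * / Cexp (RtoC (1 - beta) * lam))%C).
{ rewrite <- Cexp_opp, <- Cexp_plus. f_equal. apply injective_projections; simpl; ring. }
assert (q2 : Cexp (RtoC (1 - beta) * ((0, - PI)%R - lam)) = (Cexp (0, - ((1 - beta) * PI))%R * / Cexp (RtoC (1 - beta) * lam))%C).
{ rewrite <- Cexp_opp, <- Cexp_plus. f_equal. apply injective_projections; simpl; ring. }
rewrite q1, q2.
assert (d1 : pole_den alpha (v, PI) = ((RtoC s + Cexp (0, - (alpha * PI))%R) / RtoC s)%C).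
{ unfold pole_den. replace (- RtoC alpha * (v, PI))%C with (RtoC (- (alpha * v)) + (0, - (alpha * PI))%R)%C by (apply injective_projections; simpl; ring).
  rewrite Cexp_plus, Cexp_RtoC, exp_Ropp. fold s. rewrite RtoC_inv by lra. field. intros k; apply RtoC_inj in k; lra. }
assert (d2 : pole_den alpha (v, (- PI)%R) = ((RtoC s + Cexp (0, alpha * PI)%R) / RtoC s)%C).
{ unfold pole_den. replace (- RtoC alpha * (v, (- PI)%R))%C with (RtoC (- (alpha * v)) + (0, alpha * PI)%R)%C by (apply injective_projections; simpl; ring).
  rewrite Cexp_plus, Cexp_RtoC, exp_Ropp. fold s. rewrite RtoC_inv by lra. field. intros k; apply RtoC_inj in k; lra. }
rewrite d1 in *. rewrite d2 in *.
assert (sn : RtoC s <> 0) by (intros k; apply RtoC_inj in k; lra).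
assert (M1 : (RtoC s + Cexp (0, - (alpha * PI))%R)%C <> 0).
{ intros k. apply N1. rewrite k. unfold Cdiv; ring. }
assert (M2 : (RtoC s + Cexp (0, alpha * PI)%R)%C <> 0).
{ intros k. apply N2. rewrite k. unfold Cdiv; ring. }
assert (PD : ((RtoC s + Cexp (0, - (alpha * PI))%R) * (RtoC s + Cexp (0, alpha * PI)%R) = RtoC (s ^ 2 + 2 * s * cos (alpha * PI) + 1))%C).
{ pose proof (sin2_cos2 (alpha * PI)) as sc. unfold Rsqr in sc.
  unfold Cexp. simpl. rewrite exp_0, cos_neg, sin_neg. apply injective_projections; simpl; nra. }
assert (hD : s ^ 2 + 2 * s * cos (alpha * PI) + 1 <> 0).
{ intros k. rewrite k in PD. apply (Cmult_neq_0 _ _ M1 M2 PD). }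
set (D := s ^ 2 + 2 * s * cos (alpha * PI) + 1) in *.
assert (dn : RtoC D <> 0) by (intros k; apply RtoC_inj in k; auto).
assert (NN : (Cexp (0, (1 - beta) * PI)%R * (RtoC s + Cexp (0, alpha * PI)%R) - Cexp (0, - ((1 - beta) * PI))%R * (RtoC s + Cexp (0, - (alpha * PI))%R)
   = 2 * Ci * RtoC (s * sin (beta * PI) - sin ((alpha - beta) * PI)))%C).
{ replace (sin (beta * PI)) with (sin ((1 - beta) * PI)).
  2: { rewrite <- sin_PI_x. f_equal. ring. }
  replace (sin ((alpha - beta) * PI)) with (- sin ((1 - beta) * PI + alpha * PI)).
  2: { replace ((1 - beta) * PI + alpha * PI) with ((alpha - beta) * PI + PI) by ring. rewrite neg_sin. ring. }
  rewrite sin_plus. unfold Cexp. simpl. rewrite exp_0, !cos_neg, !sin_neg. apply injective_projections; simpl; ring. }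
assert (F : (Cexp (0, (1 - beta) * PI)%R * / ((RtoC s + Cexp (0, - (alpha * PI))%R) / RtoC s) - Cexp (0, - ((1 - beta) * PI))%R * / ((RtoC s + Cexp (0, alpha * PI)%R) / RtoC s)
  = RtoC s * (2 * Ci * RtoC (s * sin (beta * PI) - sin ((alpha - beta) * PI))) / RtoC D)%C).
{ rewrite <- NN, <- PD. field. auto. }
set (T := s * sin (beta * PI) - sin ((alpha - beta) * PI)) in *.
assert (wn := Cexp_nz (RtoC (1 - beta) * lam)).
set (W := Cexp (RtoC (1 - beta) * lam)) in *.
assert (pn : RtoC PI <> 0) by (intros k; apply RtoC_inj in k; lra).
assert (an : RtoC alpha <> 0) by (intros k; apply RtoC_inj in k; lra).
assert (hpa : alpha * PI <> 0) by nra.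
rewrite !RtoC_mult, !RtoC_div, RtoC_mult by auto.
set (e := RtoC (exp ((1 - beta) * v))).
match goal with |- ?a = ?b => change (@eq C a b) end.
transitivity (W / (2 * PI * Ci) * (e * w * (RtoC s * (2 * Ci * RtoC T) / RtoC D)))%C.
- field. repeat split; auto. apply Ci_nz.
- rewrite <- F. field. repeat split; auto. apply Ci_nz.
Qed.
End Fixed_parameters.

(** * The integral representation *)

Lemma ccont_mult (f g : R -> C) t : ccont f t -> ccont g t -> ccont (fun s => f s * g s)%C t.
Proof.
intros hf hg. apply ccont_pair in hf. apply ccont_pair in hg. apply ccont_pair. split.
- apply (continuous_minus (V := R_NormedModule) (fun s => Re (f s) * Re (g s)) (fun s => Im (f s) * Im (g s)));
  apply (continuous_mult (K := R_AbsRing)); tauto.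
- apply (continuous_plus (V := R_NormedModule) (fun s => Re (f s) * Im (g s)) (fun s => Im (f s) * Re (g s)));
  apply (continuous_mult (K := R_AbsRing)); tauto.
Qed.

Lemma ccont_RtoC (f : R -> R) t : continuous f t -> ccont (fun s => RtoC (f s)) t.
Proof. intros h. apply ccont_pair. split. exact h. apply continuous_const. Qed.

Lemma Clim_is_series (u : nat -> C) (l : C) : Clim eventually (Csum u) l ->
  is_series (V := C_R_NormedModule) u l.
Proof.
intros H. apply (Clim_filterlim eventually (sum_n (G := C_R_CompleteNormedModule) u) l).
intros eps. destruct (H eps) as [N hN]. exists N. intros n hn. rewrite sum_n_Csum. apply hN. lia.
Qed.

Lemma CSeries_unique (u : nat -> C) (l : C) : is_series (V := C_R_NormedModule) u l -> CSeries u = l.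
Proof.
intros H. apply (iota_unique (V := C_R_CompleteNormedModule)); auto.
intros y hy. exact (filterlim_locally_unique (V := C_R_NormedModule) (F := eventually) _ _ _ hy H).
Qed.

Lemma sin_cos_quadratic_pos (s t : R) : sin t <> 0 -> 0 < s ^ 2 + 2 * s * cos t + 1.
Proof.
intros h. pose proof (sin2_cos2 t) as sc. unfold Rsqr in sc.
(* the polynomial is [(s + cos t)^2 + sin t^2] *)
replace (s ^ 2 + 2 * s * cos t + 1) with ((s + cos t) * (s + cos t) + sin t * sin t).
2: { rewrite <- sc. ring. }
assert (0 < sin t * sin t) by (apply Rsqr_pos_lt; exact h).
pose proof (Rle_0_sqr (s + cos t)) as hq. unfold Rsqr in hq. lra.
Qed.

Lemma l_integrand_continuous alpha beta (w c : C) s : 1 < alpha < 2 -> 0 < s ->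
  ccont (fun s => RtoC (H_fun alpha beta s) * Cexp (- (w * RtoC (Rpower s (1 / alpha)))) * c)%C s.
Proof.
intros ha hs. pose proof PI_RGT_0. 
assert (hsin : sin (alpha * PI) <> 0).
{ replace (alpha * PI) with (PI + (alpha - 1) * PI) by ring. rewrite Rplus_comm, neg_sin.
  assert (0 < sin ((alpha - 1) * PI)) by (apply sin_gt_0; nra). lra. }
assert (hr : continuous (fun s => Rpower s (1 / alpha)) s).
{ apply (ex_derive_continuous (K := R_AbsRing) (V := R_NormedModule)). unfold Rpower. auto_derive. auto. }
apply ccont_mult. apply ccont_mult.
- apply ccont_RtoC. apply (ex_derive_continuous (K := R_AbsRing) (V := R_NormedModule)).
  unfold H_fun, Rpower. auto_derive. split; auto. pose proof (sin_cos_quadratic_pos s (alpha * PI) hsin). simpl in *. lra.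
- destruct w as [w1 w2].
  apply (continuous_comp (U := R_UniformSpace) (W := C_UniformSpace) (fun s => Rpower s (1 / alpha)) (fun r => Cexp (- ((w1, w2) * RtoC r))%C)). exact hr.
  apply ccont_pair. unfold Cexp, Re, Im; simpl. split; apply (ex_derive_continuous (K := R_AbsRing) (V := R_NormedModule)); auto_derive; auto.
- apply continuous_const.
Qed.

Theorem proposition4p1 (alpha beta : R) (z : C)
  (halpha : 1 < alpha < 2) (hbeta : 1 <= beta <= 2) (hz : 0 < Re z) :
  mittag_leffler alpha beta (- z)%C =
  (omega_fun alpha beta z + l_fun alpha beta z)%C.
Proof.
pose proof PI_RGT_0 as hpi.
destruct (Cexp_Clog z hz) as [Hlog Harg].
set (lam := (RtoC (1 / alpha) * Clog z)%C).
assert (hlam : Rabs (Im lam) < PI / 2).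
{ unfold lam. replace (Im (RtoC (1 / alpha) * Clog z)%C) with (Im (Clog z) / alpha) by (unfold Im; simpl; field; lra).
  unfold Rdiv. rewrite Rabs_mult, (Rabs_pos_eq (/ alpha)) by (left; apply Rinv_0_lt_compat; lra).
  apply Rle_lt_trans with (Rabs (Im (Clog z))); auto. rewrite <- (Rmult_1_r (Rabs _)) at 2.
  apply Rmult_le_compat_l. apply Rabs_pos. rewrite <- Rinv_1. apply Rinv_le_contravar; lra. }
assert (an : RtoC alpha <> 0) by (intros k; apply RtoC_inj in k; lra).
assert (pn : RtoC PI <> 0) by (intros k; apply RtoC_inj in k; lra).
assert (zl : z = Cexp (RtoC alpha * lam)).
{ rewrite <- Hlog at 1. f_equal. unfold lam. rewrite Cmult_assoc, <- RtoC_mult.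
  replace (alpha * (1 / alpha)) with 1 by (field; lra). ring. }
assert (pw : forall r, Cpower z (RtoC (r / alpha)) = Cexp (RtoC r * lam)).
{ intros r. unfold Cpower, lam. f_equal. rewrite Cmult_assoc, <- RtoC_mult. do 2 f_equal. field. lra. }
assert (pw1 : Cpower z (RtoC (1 / alpha)) = Cexp lam) by (rewrite pw; f_equal; ring).
assert (pw2 : Cpower z (RtoC (1 / alpha * (1 - beta))) = Cexp (RtoC (1 - beta) * lam)).
{ rewrite <- pw. do 2 f_equal. field. lra. }
destruct (Mittag_Leffler_limit alpha beta lam halpha hbeta hlam) as [L [L1 L2]].
set (W := Cexp (RtoC (1 - beta) * lam)).
assert (Wn : W <> 0) by apply Cexp_nz.
set (c := (W / (2 * PI * Ci))%C).
assert (E1 : mittag_leffler alpha beta (- z)%C = (c * L)%C).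
{ apply CSeries_unique, Clim_is_series.
  assert (K := Clim_scal eventually c _ L L2). revert K. apply Clim_ext. typeclasses eauto.
  apply filter_forall. intros n. rewrite <- Csum_scal. apply Csum_ext. intros k.
  assert (hg : 0 < alpha * INR k + beta) by (pose proof (pos_INR k); nra).
  assert (gp := Gamma_pos _ hg).
  assert (gn : RtoC (Gamma (alpha * INR k + beta)) <> 0) by (intros q; apply RtoC_inj in q; lra).
  assert (zk : ((- z) ^ k)%C = ((- (1)) ^ k * (W * Cexp (RtoC (alpha * INR k + beta - 1) * lam)))%C).
  { replace (- z)%C with (- (1) * z)%C by ring. rewrite Cpow_mult_l. f_equal.
    rewrite zl, <- Cexp_mult_INR. unfold W. rewrite <- Cexp_plus. f_equal. rewrite !RtoC_minus, RtoC_plus, RtoC_mult. ring. }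
  rewrite zk. unfold c. field. repeat split; auto. apply Ci_nz. }
set (Res := ((hankel_fun lam (1 - beta) (0, PI / alpha)%R + hankel_fun lam (1 - beta) (0, - (PI / alpha))%R) / RtoC alpha)%C).
assert (E2 : omega_fun alpha beta z = (W * Res)%C).
{ unfold omega_fun, a_fun, b_fun, Res, hankel_fun. rewrite pw, pw1. fold W.
  assert (t1 : Cexp (lam + (0, PI / alpha)%R) = (Cexp lam * Cexp (RtoC PI * Ci / RtoC alpha))%C).
  { rewrite <- Cexp_plus. do 2 f_equal. unfold Cdiv. rewrite <- RtoC_inv by lra. apply injective_projections; simpl; field; lra. }
  assert (t2 : Cexp (lam + (0, - (PI / alpha))%R) = (Cexp lam * Cexp (- (RtoC PI * Ci / RtoC alpha)))%C).
  { rewrite <- Cexp_plus. do 2 f_equal. unfold Cdiv. rewrite <- RtoC_inv by lra. apply injective_projections; simpl; field; lra. }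
  rewrite t1, t2.
  replace (RtoC (1 - beta) * (0, PI / alpha)%R)%C with (RtoC ((1 - beta) / alpha) * RtoC PI * Ci)%C by (apply injective_projections; simpl; field; lra).
  replace (RtoC (1 - beta) * (0, - (PI / alpha))%R)%C with (- (RtoC ((1 - beta) / alpha) * RtoC PI * Ci))%C by (apply injective_projections; simpl; field; lra).
  unfold Cdiv, Cminus. ring. }
assert (E3 : l_fun alpha beta z = (c * (L - 2 * PI * Ci * Res))%C).
{ unfold l_fun. rewrite pw1, pw2.
  apply (RInt_gen_exp_subst (V := CV) _ alpha). lra.
  - intros s hs. apply l_integrand_continuous; auto.
  - apply Clim_filterlim. typeclasses eauto.
    set (J := vert_int (ml_fun alpha (1 - beta) lam)) in *.
    apply (Clim_ext _ (fun ab => c * (J (snd ab) + (- (1) * J (fst ab) + - (2 * PI * Ci * Res))))%C).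
    + apply (both_ends_eventually 0 0). intros A B hA hB. cbv beta. change (fst (A, B)) with A. change (snd (A, B)) with B.
      etransitivity; [| symmetry; exact (CInt_ext _ _ A B (l_integrand alpha beta lam halpha))].
      rewrite CInt_Cmult. 2: apply (ex_RInt_minus (V := CV)); apply ex_ml_fun_h; auto.
      rewrite contour_identity by auto. fold J. fold W. fold c. fold Res. ring.
    + replace (L - 2 * PI * Ci * Res)%C with (L + (- (1) * 0 + - (2 * PI * Ci * Res)))%C by ring.
      apply Clim_scal. typeclasses eauto. apply Clim_plus. typeclasses eauto.
      apply (Clim_comp both_ends at_pinf J snd). apply filterlim_snd. exact L1.
      apply Clim_plus. typeclasses eauto. apply Clim_scal. typeclasses eauto.
      apply (Clim_comp both_ends at_minf J fst). apply filterlim_fst. apply vert_int_ml_minf; auto.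
      apply Clim_const. typeclasses eauto. }
rewrite E1, E2, E3. unfold c. field. repeat split; auto. apply Ci_nz.
Qed.
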